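(* Let $\mathcal S$, $\Sigma_1,\Sigma_2$, $G^*$, $\mathcal Y$ and the correspondence $P\mapsto\mathcal O_P$ be as in the context, and let $\mathcal Z$ be the set of anisotropic points of $\mathrm{PG}(7,2)$. Let $R_0$ be the identity relation on $\mathcal Z$, and define relations $R_1,\dots,R_6$ on distinct points $P,Q\in\mathcal Z$ by: - $R_1$: $P\perp Q$, $\mathcal O_P\cap\mathcal O_Q$ is a point outside $\Sigma_1\cup\Sigma_2$, $|\mathcal O_P\cap Q^\perp|=3$, and the line $PQ$ intersects $\mathcal O_P$; - $R_2$: $P\perp Q$, $\mathcal O_P\cap\mathcal O_Q$ is a point in $\Sigma_1\cup\Sigma_2$, and $|\mathcal O_P\cap Q^\perp|=3$; - $R_3$: $P\perp Q$, $\mathcal O_P\cap\mathcal O_Q$ is a point outside $\Sigma_1\cup\Sigma_2$, $|\mathcal O_P\cap Q^\perp|=3$, and the line $PQ$ does not intersect $\mathcal O_P$; - $R_4$: $P\perp Q$, $\mathcal O_P\cap\mathcal O_Q$ is a point outside $\Sigma_1\cup\Sigma_2$, and $|\mathcal O_P\cap Q^\perp|=7$; - $R_5$: $P\not\perp Q$, $\mathcal O_P\cap\mathcal O_Q=\varnothing$, and $|\mathcal O_P\cap Q^\perp|=3$; - $R_6$: $P\not\perp Q$, $\mathcal O_P\cap\mathcal O_Q=\varnothing$, and $|\mathcal O_P\cap Q^\perp|=7$. Then $\{R_0,\dots,R_6\}$ is the $6$-class symmetric association scheme whose relations are the orbitals of the action of $G^*$ on $\mathcal Z$ (equivalently, via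 $P\mapsto\mathcal O_P$, on $\mathcal Y$). This scheme is isomorphic to the association scheme $(R_0',\dots,R_6')$ on spreads defined in the context, by a bijection of the underlying sets that maps $R_i$ to $R_i'$ for every $i$. The graph on $\mathcal Z$ with adjacency relation $R_5\cup R_6$ is $\overline{\mathrm{NO}^+(8,2)}$. The graph $\Gamma^*$ on $\mathcal Z$ with adjacency relation $R_3\cup R_4\cup R_6$ is another strongly regular graph with parameters $(120,56,28,24)$, and its full automorphism group is $G^*$ (acting on $\mathcal Z$).
   Context: Let $f$ be a non-degenerate hyperbolic quadratic form on $\mathbb F_2^8$, with quadric $\mathcal Q^+(7,2)$ in $\mathrm{PG}(7,2)$, and let $B(X,Y)=f(X+Y)-f(X)-f(Y)$, with associated polarity $\perp$; $P\perp Q$ means $B$ vanishes on the pair. Points with $f=0$ are isotropic (on the quadric), the other $120$ points are anisotropic. Generators are the maximal totally isotropic subspaces (projective dimension $3$); they split into two systems, $\pi,\rho$ being in the same system iff $\dim(\pi\cap\rho)$ is odd (projective dimension, $\dim\varnothing=-1$). An ovoid is a set of isotropic points containing exactly one point of each generator; a spread is a set of generators partitioning the isotropic points. Both have size $9$. $\mathrm{PGO}^+(8,2)$ is the group of collineations of $\mathrm{PG}(7,2)$ induced by linear maps preserving $f$ up to a nonzero scalar. Fix a spread $\mathcal S$ of $\mathcal Q^+(7,2)$ and distinct $\Sigma_1,\Sigma_2\in\mathcal S$. Let $G^*$ be the setwise stabiliser of $\{\Sigma_1,\Sigma_2\}$ and of $\mathcal S\setminus\{\Sigma_1,\Sigma_2\}$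 in $\mathrm{PGO}^+(8,2)$. It has two orbits, of sizes $120$ and $840$, on the ovoids of $\mathcal Q^+(7,2)$; let $\mathcal Y$ be the orbit of size $120$. Each anisotropic point $P$ is on a unique line $\ell_P$ meeting both $\Sigma_1$ and $\Sigma_2$; $\mathcal O_P$ denotes the unique ovoid in $\mathcal Y$ containing the points $\ell_P\cap\Sigma_1$ and $\ell_P\cap\Sigma_2$. The map $P\mapsto\mathcal O_P$ is a $G^*$-equivariant bijection from the anisotropic points to $\mathcal Y$. $\overline{\mathrm{NO}^+(8,2)}$ is the graph on the anisotropic points, adjacency being non-orthogonality. A graph is strongly regular with parameters $(n,k,\lambda,\mu)$ if it has $n$ vertices, is $k$-regular, and two distinct vertices have $\lambda$ common neighbours if adjacent and $\mu$ otherwise. A symmetric $d$-class association scheme is a list of $d+1$ relations whose $0/1$ adjacency matrices are symmetric, start with the identity matrix, sum to the all-one matrix, and span a commutative matrix algebra. Orbitals of a group action on a set are its orbits on ordered pairs. The scheme on spreads: take $V=\{x\in\mathbb F_2^9:\sum_i x_i=0\}$ with $f(X)=\sum_{1\le i<j\le 9}X_iX_j$ as model of $\mathcal Q^+(7,2)$, and let $Q_i$ be the point whose coordinate vector has a single $0$, in position $i$. Let $H\le\mathrm{Alt}_9$ (acting by coordinate permutation) be the setwise stabiliser of the coordinate set $\{1,2\}$. Let $\mathcal X$ be an orbit of $H$ of size $120$ on the spreads consisting of generators in a fixed system (the orbits have sizes $120$ and $840$). For a spread $\mathcal A$ let $\mathcal A_i$ be its element containing $Q_i$. Put $\mathrm{Inv}_1(\mathcal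 A,\mathcal T)=\dim(\mathcal A_1\cap\mathcal T_2)+\dim(\mathcal A_2\cap\mathcal T_1)$, and let $\mathrm{Inv}_2(\mathcal A,\mathcal T)$ be the number of generators in $\{\mathcal T_3,\dots,\mathcal T_9\}$ meeting both $\mathcal A_1$ and $\mathcal A_2$ in a line. $R_0'$ is the identity on $\mathcal X$, and for distinct $\mathcal A,\mathcal T\in\mathcal X$ the pair $(\mathcal A,\mathcal T)$ lies in $R_1',R_2',R_3',R_4',R_5',R_6'$ iff $(\mathrm{Inv}_1,\mathrm{Inv}_2)$ equals $(2,0),(-2,0),(-2,2),(2,2),(0,1),(0,3)$ respectively. *)

(* Defs.v *)
From mathcomp Require Import all_boot all_order all_algebra all_fingroup
  all_solvable.

Set Implicit Arguments.
Unset Strict Implicit.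
Unset Printing Implicit Defensive.

Import GRing.Theory.
Local Open Scope ring_scope.

(* Over F_2 every one-dimensional subspace has a unique nonzero vector, so a
   point of PG(n-1,2) is a nonzero vector of F_2^n, and a projective subspace
   is the set of its points. *)

Section Projective.
Variable n : nat.
Local Notation V := 'rV['F_2]_n.
Implicit Types (A U W O : {set V}) (Qd : {set V}) (S : {set {set V}}).

Definition pspan A : {set V} := [set x | (x != 0) && (x \in <<enum A>>%VS)].

Definition psubspace A : bool := A == pspan A.

(* Projective dimension; it is -1 on the empty set. *)
Definition pdim A : int := (\dim <<enum A>>%VS)%:Z - 1.

Definition pline A : bool := psubspace A && (pdim A == 1).

(* Below, Qd is the set of points of a quadric.  A subspace on which a quadratic
   form vanishes is totally isotropic for the form, hence generators are the
   maximal subspaces contained in Qd. *)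
Definition quadric_generator Qd U : bool :=
  maxset (fun W => psubspace W && (W \subset Qd)) U.

Definition same_system U W : bool := odd `|pdim (U :&: W)|%N.

Definition ovoid Qd O : bool :=
  (O \subset Qd) && [forall U, quadric_generator Qd U ==> (#|O :&: U| == 1%N)].

Definition spread Qd S : bool :=
  [forall U in S, quadric_generator Qd U] && partition S Qd.

End Projective.

Section QuadraticForm.
Variables (n : nat) (f : 'rV['F_2]_n -> 'F_2).
Local Notation V := 'rV['F_2]_n.

Definition polar (x y : V) : 'F_2 := f (x + y) - f x - f y.

Definition quadratic_form : Prop :=
  (forall (a : 'F_2) x, f (a *: x) = a ^+ 2 * f x)
  /\ bilinear_for *%R *%R polar.

Definition nondegenerate_form : Prop :=
  forall x, f x = 0 -> (forall y, polar x y = 0) -> x = 0.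

(* Witt index n / 2. *)
Definition hyperbolic_form : Prop :=
  exists U : {vspace V}, {in U, forall x, f x = 0} /\ n = (\dim U).*2.

Definition quadric : {set V} := [set x | (x != 0) && (f x == 0)].

Definition anisotropic : {set V} := [set x | (x != 0) && (f x != 0)].

Definition perp (x y : V) : bool := polar x y == 0.

Definition perp_points (x : V) : {set V} := [set y | (y != 0) && perp x y].

(* Collineations are encoded by the permutations of the underlying vectors that
   induce them; this loses nothing since the only nonzero scalar is 1. *)
Definition PGO : {set {perm V}} :=
  [set s : {perm V} |
    [exists g : 'M['F_2]_n, [forall x, s x == x *m g]]
    && [exists c : 'F_2, (c != 0) && [forall x, f (s x) == c * f x]]].

Definition NObar : {set V * V} :=
  [set p in setX anisotropic anisotropic | ~~ perp p.1 p.2].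

Section SpreadPair.
Variables (S : {set {set V}}) (Sg1 Sg2 : {set V}).

Definition Gstar : {set {perm V}} :=
  ('N_PGO([set Sg1; Sg2] | 'P^*) :&: 'N(S :\: [set Sg1; Sg2] | 'P^*))%g.

Definition ovoid_orbits : {set {set {set V}}} :=
  [set orbit 'P^*%act Gstar O | O : {set V} in ovoid quadric].

Definition ell (P : V) : {set V} :=
  odflt set0 [pick l : {set V} |
    [&& pline l, P \in l, l :&: Sg1 != set0 & l :&: Sg2 != set0]].

Definition ovoid_of (Y : {set {set V}}) (P : V) : {set V} :=
  odflt set0 [pick O in Y |
    (ell P :&: Sg1 \subset O) && (ell P :&: Sg2 \subset O)].

Definition point_rel (Y : {set {set V}}) (i : nat) : {set V * V} :=
  [set p in setX anisotropic anisotropic |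
    let P := p.1 in let Q := p.2 in
    let OP := ovoid_of Y P in let OQ := ovoid_of Y Q in
    let meet_out :=
      [exists x, (OP :&: OQ == [set x]) && (x \notin Sg1 :|: Sg2)] in
    let meet_in :=
      [exists x, (OP :&: OQ == [set x]) && (x \in Sg1 :|: Sg2)] in
    let m := #|OP :&: perp_points Q| in
    let line_meets := pspan [set P; Q] :&: OP != set0 in
    match i with
    | 0 => P == Q
    | 1 => [&& P != Q, perp P Q, meet_out, m == 3 & line_meets]
    | 2 => [&& P != Q, perp P Q, meet_in & m == 3]
    | 3 => [&& P != Q, perp P Q, meet_out, m == 3 & ~~ line_meets]
    | 4 => [&& P != Q, perp P Q, meet_out & m == 7]
    | 5 => [&& P != Q, ~~ perp P Q, OP :&: OQ == set0 & m == 3]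
    | 6 => [&& P != Q, ~~ perp P Q, OP :&: OQ == set0 & m == 7]
    | _ => false
    end%N].

End SpreadPair.
End QuadraticForm.

Section Schemes.
Variable T : finType.
Implicit Types (X : {set T}) (E : {set T * T}).

Definition adjmx X E : 'M[rat]_#|X| :=
  \matrix_(i, j) ((enum_val i, enum_val j) \in E)%:R.

Definition symmetric_scheme (d : nat) X (R : 'I_d.+1 -> {set T * T}) : Prop :=
  let A i := adjmx X (R i) in
  let W := <<[seq A i | i <- enum 'I_d.+1]>>%VS in
  [/\ forall i, R i \subset setX X X,
      forall i, (A i)^T = A i,
      A ord0 = 1%:M,
      \sum_i A i = const_mx 1
    & {in W &, forall M N : 'M[rat]_#|X|, (M *m N \in W) /\ M *m N = N *m M}].

Definition orbitals (gT : finGroupType) (to : {action gT &-> T})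
    (G : {set gT}) X : {set {set T * T}} :=
  [set [set (to p.1 g, to p.2 g) | g in G] | p in setX X X].

Definition strongly_regular (n k l m : nat) X E : Prop :=
  let nbr x := [set y in X | (x, y) \in E] in
  [/\ [/\ E \subset setX X X,
          {in X, forall x, (x, x) \notin E}
        & {in X &, forall x y, ((x, y) \in E) = ((y, x) \in E)}],
      #|X| = n,
      {in X, forall x, #|nbr x| = k}
    & {in X &, forall x y, x != y ->
        #|nbr x :&: nbr y| = if (x, y) \in E then l else m}].

(* Permutations of X preserving adjacency, extended by the identity outside X. *)
Definition graph_aut X E : {set {perm T}} :=
  [set s : {perm T} | perm_on X s &&
    [forall x in X, forall y in X, ((s x, s y) \in E) == ((x, y) \in E)]].

End Schemes.

Definition isomorphic (I : Type) (T T' : finType)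
    (X : {set T}) (R : I -> {set T * T})
    (X' : {set T'}) (R' : I -> {set T' * T'}) : Prop :=
  exists phi : T -> T',
    [/\ {in X &, injective phi}, phi @: X = X'
      & forall i, {in X &, forall x y,
          ((phi x, phi y) \in R' i) = ((x, y) \in R i)}].

Definition graph_isomorphic (T T' : finType) (X : {set T}) (E : {set T * T})
    (X' : {set T'}) (E' : {set T' * T'}) : Prop :=
  isomorphic X (fun _ : unit => E) X' (fun _ : unit => E').

(* The coordinates 1, ..., 9 are numbered 0, ..., 8 here. *)

Definition quadric9 : {set 'rV['F_2]_9} :=
  [set x : 'rV['F_2]_9 | [&& x != 0, \sum_i x 0 i == 0
    & \sum_(i < 9) \sum_(j < 9 | (i < j)%N) x 0 i * x 0 j == 0]].

Definition Qpoint (i : 'I_9) : 'rV['F_2]_9 := \row_j (j != i)%:R.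

Definition coord1 : 'I_9 := @Ordinal 9 0 isT.
Definition coord2 : 'I_9 := @Ordinal 9 1 isT.

Definition H9 : {set 'S_9} :=
  'N_('Alt_('I_9))([set coord1; coord2] | 'P)%g.

Definition coord_act (s : 'S_9) (A : {set {set 'rV['F_2]_9}}) :=
  [set [set col_perm s x | x in U] | U : {set 'rV['F_2]_9} in A].

Definition spread_orbits (rho : {set 'rV['F_2]_9}) :
    {set {set {set {set 'rV['F_2]_9}}}} :=
  [set [set coord_act s A | s in H9]
     | A : {set {set 'rV['F_2]_9}} in
       [pred A | spread quadric9 A && [forall U in A, same_system U rho]]].

Definition Inv1 (A T : {set {set 'rV['F_2]_9}}) : int :=
  pdim (pblock A (Qpoint coord1) :&: pblock T (Qpoint coord2))
  + pdim (pblock A (Qpoint coord2) :&: pblock T (Qpoint coord1)).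

Definition Inv2 (A T : {set {set 'rV['F_2]_9}}) : nat :=
  #|[set U in [set pblock T (Qpoint i) | i : 'I_9 in [pred i : 'I_9 | (1 < i)%N]] |
      pline (U :&: pblock A (Qpoint coord1))
      && pline (U :&: pblock A (Qpoint coord2))]|.

Definition spread_rel (X : {set {set {set 'rV['F_2]_9}}}) (i : nat) :
    {set {set {set 'rV['F_2]_9}} * {set {set 'rV['F_2]_9}}} :=
  [set p in setX X X |
    let A := p.1 in let T := p.2 in
    let inv := (Inv1 A T, Inv2 A T) in
    match i with
    | 0 => A == T
    | 1 => (A != T) && (inv == (2%:Z, 0%N))
    | 2 => (A != T) && (inv == (- 2%:Z, 0%N))
    | 3 => (A != T) && (inv == (- 2%:Z, 2%N))
    | 4 => (A != T) && (inv == (2%:Z, 2%N))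
    | 5 => (A != T) && (inv == (0%:Z, 1%N))
    | 6 => (A != T) && (inv == (0%:Z, 3%N))
    | _ => false
    end].

(* Main.v *)
From HB Require Import structures.
From Stdlib Require Import NArith Lia.
Require Import Defs.
From mathcomp Require Import all_boot all_order all_algebra all_fingroup
  all_solvable.
From mathcomp Require Import finfield zify ring.

Set Implicit Arguments.
Unset Strict Implicit.
Unset Printing Implicit Defensive.

Import GRing.Theory.
Local Open Scope ring_scope.

(* In suitable coordinates the form is the sum of the x_i x_(i+4), the spread
   is a fixed one, and its two distinguished members are the coordinate blocks:
   there are only eight spreads through the two blocks, all equivalent under
   the isometries that fix the blocks. The group G* is simply transitive on the
   coordinate systems of this kind, so a G*-invariant statement on pairs of
   anisotropic points needs to be verified on seven pairs only.

   The sum of the points of O in Sigma_1 and Sigma_2 is an equivariant map from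
   an orbit of 120 ovoids to the 120 anisotropic points, hence a bijection. It
   selects one of the eight ovoids through two given points. The orbitals are
   symmetric, which makes the algebra of the scheme commutative. In Gamma* the
   number of adjacent pairs of common neighbours of two vertices separates the
   relations R_i; so automorphisms of Gamma* preserve each R_i, and Gamma* is
   not the graph of non-orthogonality.

   On the side of the spreads the map A |-> {A_1, A_2} plays the role of the map
   on ovoids, and the isomorphism of the schemes intertwines two actions of
   degree 120, tabulated on generators. *)

(** The two groups are related by triality. [G*] preserves a spread and a pair of its members, [H9]
    preserves the ovoid of the points Q_i and a pair of its points; each acts on the nine objects as
    the even permutations that keep the pair, a group of order 5040. No isometry carries one action
    to the other: [H9] preserves the weight, which is 2 or 6 on the anisotropic points of its model,
    whereas [G*] is transitive on anisotropic points. So generators come as pairs of matrices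
    inducing the same permutation of nine objects, and neither triality nor the isomorphism of
    groups has to be constructed. The length 120 of the orbit is the decisive hypothesis on both
    sides. The 960 = 8 * 120 ovoids lie eight over each anisotropic point. In an orbit of length 120
    an ovoid is determined by its point, hence fixed by the stabiliser of that point; there an
    element of order 7 fixes one of the eight candidates and permutes the others, so it singles out
    the right one. The same element selects the right spread among eight candidates. The form, the
    spread and the orbit are arbitrary, so all evaluations happen on codes, and frames transfer
    them. *)

Notation xor := N.lxor.

(** * Vectors of F_2^8 as binary numbers *)

Fixpoint memN (k : N) (s : seq N) : bool :=
  if s is x :: s' then if N.eqb k x then true else memN k s' else false.

Lemma memNE k s : memN k s = (k \in s).
Proof.
elim: s => //= x s ->; rewrite in_cons.
by have -> : N.eqb k x = (k == x) by []; case: (k == x).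
Qed.

Definition subN (s t : seq N) : bool := all (fun k => memN k t) s.

Lemma subNP s t : subN s t -> {subset s <= t}.
Proof. by move=> /allP st k /st; rewrite memNE. Qed.

(* The linear map with columns g, on vectors of F_2^8 written in binary. *)
Fixpoint lin (g : seq N) (k : N) : N :=
  if g is v :: g' then
    let r := lin g' (N.div2 k) in if N.odd k then xor v r else r
  else 0%num.

Fixpoint spanl (s : seq N) : seq N :=
  if s is v :: s' then let l := spanl s' in l ++ map (xor v) l else [:: 0%num].

Definition codes : seq N := Eval vm_compute in map N.of_nat (iota 0 256).

Fixpoint odd_weight (p : positive) : bool :=
  match p with xH => true | xO p' => odd_weight p' | xI p' => ~~ odd_weight p' end.

(* The hyperbolic form [sum_(i < 4) x_i x_(i + 4)]. *)
Definition qform (k : N) : bool :=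
  if N.land (N.land k 15) (N.shiftr k 4) is Npos p then odd_weight p else false.

Definition bform (a b : N) : bool := qform (xor a b) (+) qform a (+) qform b.

Definition singular : seq N :=
  Eval vm_compute in [seq k <- codes | ~~ N.eqb k 0 && ~~ qform k].
Definition nonsingular : seq N := Eval vm_compute in filter qform codes.

(** [spanl] lists the zero vector first, so what remains are the projective points. *)
Definition span1 (s : seq N) : seq N := behead (spanl s).

Definition low_block : seq N := Eval vm_compute in span1 [:: 8; 4; 2; 1]%num.
Definition high_block : seq N := Eval vm_compute in span1 [:: 128; 64; 32; 16]%num.

(** The two coordinate blocks come first; [drop 2 std_spread] lists the seven further members. *)
Definition std_spread : seq (seq N) := Eval vm_compute in
  map span1 [:: [:: 8; 4; 2; 1]; [:: 128; 64; 32; 16];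
    [:: 18; 33; 72; 132]; [:: 20; 40; 97; 146]; [:: 120; 130; 148; 193];
    [:: 24; 52; 82; 225]; [:: 66; 88; 129; 164]; [:: 36; 56; 161; 210];
    [:: 65; 104; 180; 194]]%num.

Lemma xorA : associative xor. Proof. by move=> a b c; rewrite N.lxor_assoc. Qed.
Lemma xorC : commutative xor. Proof. exact: N.lxor_comm. Qed.
Lemma xor0 : right_id 0%num xor. Proof. exact: N.lxor_0_r. Qed.
Lemma xorn : self_inverse 0%num xor. Proof. exact: N.lxor_nilpotent. Qed.
Lemma xorCA : left_commutative xor.
Proof. by move=> a b c; rewrite !xorA (xorC a). Qed.
Lemma xorACA : interchange xor xor.
Proof. by move=> a b c e; rewrite -!xorA (xorCA b). Qed.
Lemma xor_eq0 a b : xor a b = 0%num -> a = b.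
Proof. exact: N.lxor_eq. Qed.

Lemma lin_xor g : {morph lin g : a b / xor a b}.
Proof.
elim: g => //= v g IH a b.
have -> : N.div2 (xor a b) = xor (N.div2 a) (N.div2 b).
  by rewrite !N.div2_spec N.shiftr_lxor.
have -> : N.odd (xor a b) = xorb (N.odd a) (N.odd b).
  by rewrite -!N.bit0_odd N.lxor_spec.
rewrite IH; case: (N.odd a); case: (N.odd b) => //=.
- by rewrite xorACA xorn N.lxor_0_l.
- by rewrite xorA.
by rewrite xorCA.
Qed.

Lemma lin0 g : lin g 0 = 0%num.
Proof. by elim: g => //= v g ->. Qed.

Lemma codesE k : (k \in codes) = N.ltb k 256.
Proof.
have codesE' : codes = map N.of_nat (iota 0 256) by vm_compute.
rewrite codesE'; apply/mapP/idP => [[m]|/N.ltb_lt lk].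
  rewrite mem_iota add0n => /andP[_ /ltP lm] ->; apply/N.ltb_lt.
  by rewrite -[256%num]/(N.of_nat 256); lia.
exists (N.to_nat k); last by rewrite Nnat.N2Nat.id.
rewrite mem_iota add0n /=; apply/ltP.
by move: lk; rewrite -[256%num]/(N.of_nat 256); lia.
Qed.

Lemma xor_codes a b : a \in codes -> b \in codes -> xor a b \in codes.
Proof.
have shiftE k : (k \in codes) = N.eqb (N.shiftr k 8) 0.
  rewrite codesE N.shiftr_div_pow2.
  apply/idP/idP => [/N.ltb_lt lk|/N.eqb_eq].
    by apply/N.eqb_eq; apply: N.div_small.
  by move/N.div_small_iff => h; apply/N.ltb_lt; apply: h.
by rewrite !shiftE => /N.eqb_eq ha /N.eqb_eq hb; rewrite N.shiftr_lxor ha hb.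
Qed.

Lemma codes_uniq : uniq codes. Proof. by vm_compute. Qed.
Lemma codes0 : 0%num \in codes. Proof. by rewrite codesE. Qed.

Lemma spanlP (P : N -> Prop) s : P 0%num ->
  (forall a b, P a -> P b -> P (xor a b)) ->
  {in s, forall k, P k} -> {in spanl s, forall k, P k}.
Proof.
move=> P0 PX; elim: s => [|v s IH] Ps k /=; first by rewrite inE => /eqP ->.
have {}IH : {in spanl s, forall k, P k}.
  by apply: IH => x xs; apply: Ps; rewrite inE xs orbT.
rewrite mem_cat => /orP[/IH //|/mapP[x /IH Px ->]].
by apply: PX => //; apply: Ps; rewrite mem_head.
Qed.

Lemma singularE k : (k \in singular) = [&& k \in codes, k != 0%num & ~~ qform k].
Proof.
have -> : singular = [seq k <- codes | ~~ N.eqb k 0 && ~~ qform k] by vm_compute.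
by rewrite mem_filter andbC.
Qed.

Lemma nonsingularE k : (k \in nonsingular) = (k \in codes) && qform k.
Proof.
have -> : nonsingular = filter qform codes by vm_compute.
by rewrite mem_filter andbC.
Qed.

Definition basis8 : seq N := [:: 128; 64; 32; 16; 8; 4; 2; 1]%num.

Lemma std_spread_low : low_block \in std_spread. Proof. by vm_compute. Qed.
Lemma std_spread_high : high_block \in std_spread. Proof. by vm_compute. Qed.

(** * Projective subspaces over F_2 *)

Lemma F2_cases (a : 'F_2) : a = 0 \/ a = 1.
Proof. by case: a => [[|[|m]]] // i; [left|right]; apply: val_inj. Qed.

Section Subspaces.
Variable n : nat.
Local Notation V := 'rV['F_2]_n.
Implicit Types (A : {set V}) (x y : V).

Lemma addrr2 x : x + x = 0.
Proof.
rewrite -mulr2n -scaler_nat.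
by have -> : 2%:R = 0 :> 'F_2; [apply: val_inj | rewrite scale0r].
Qed.

Lemma oppr2 x : - x = x.
Proof. by apply/eqP; rewrite eq_sym -addr_eq0 addrr2. Qed.

Lemma addr2_eq0 x y : x + y = 0 -> x = y.
Proof. by move/eqP; rewrite addr_eq0 oppr2 => /eqP. Qed.

Lemma addKr2 x y : x + (x + y) = y.
Proof. by rewrite addrA addrr2 add0r. Qed.

(** The only scalars are 0 and 1, so closure under sums of distinct points already makes [0 |: A] a
    linear subspace. *)
Lemma psubspaceP A :
  reflect (0 \notin A /\ {in A &, forall x y, x != y -> x + y \in A})
    (psubspace A).
Proof.
apply: (iffP eqP) => [->|[A0 AD]].
  split=> [|x y]; rewrite !inE ?eqxx //.
  move=> /andP[_ xA] /andP[_ yA] xy; rewrite memvD // andbT.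
  by apply: contra xy => /eqP/addr2_eq0 ->.
apply/setP=> x; rewrite inE; apply/idP/andP => [xA|[x0]].
  split; first by apply: contraNneq A0 => <-.
  by apply: memv_span; rewrite mem_enum.
suff : x \in <<enum A>>%VS -> (x == 0) || (x \in A).
  by move=> h /h; rewrite (negPf x0).
rewrite -[enum A]/(val (in_tuple (enum A))) => /coord_span ->.
have hv i a : a *: (in_tuple (enum A))`_i \in 0 |: A.
  case: (ltnP i (size (enum A))) => si; last first.
    by rewrite nth_default // scaler0 setU11.
  case: (F2_cases a) => ->; first by rewrite scale0r setU11.
  by rewrite scale1r inE -(mem_enum (mem A)) mem_nth ?orbT.
apply: (big_ind (fun z => (z == 0) || (z \in A))) => [|y z|i _].
- by rewrite eqxx.
- move=> /orP[/eqP->|yA] /orP[/eqP->|zA]; rewrite ?add0r ?addr0 ?eqxx ?yA ?zA ?orbT //.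
  by case: (eqVneq y z) => [->|yz]; rewrite ?addrr2 ?eqxx // AD ?orbT.
by have := hv i (coord (in_tuple (enum A)) i x); rewrite !inE.
Qed.

Lemma card_psubspace A : psubspace A -> #|A|.+1 = (2 ^ \dim <<enum A>>)%N.
Proof.
move=> /eqP sA.
have -> : #|A|.+1 = #|[set x in <<enum A>>%VS]|.
  rewrite -(_ : 0 |: A = [set x in <<enum A>>%VS]).
    rewrite cardsU1 sA !inE eqxx /= add1n; congr _.+1.
  apply/setP => x; rewrite {1}sA !inE.
  by case: eqVneq => // ->; rewrite mem0v.
have := @card_vspace 'F_2 V _ <<enum A>>%VS.
by rewrite card_Fp // => <-; apply: eq_card => x; rewrite inE.
Qed.

Lemma pdim_psubspace A m : psubspace A -> #|A|.+1 = (2 ^ m)%N -> pdim A = m%:Z - 1.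
Proof.
by move=> /card_psubspace -> /eqP; rewrite eqn_exp2l // /pdim => /eqP ->.
Qed.

Lemma plineE A : pline A = psubspace A && (#|A| == 3)%N.
Proof.
rewrite /pline; case: (boolP (psubspace A)) => //= sA.
rewrite -(eqr_int rat) -(@eqSS #|A|) (card_psubspace sA) (eqn_exp2l _ 2) // /pdim.
by rewrite eqr_int subr_eq.
Qed.

Lemma psubspaceI A B : psubspace A -> psubspace B -> psubspace (A :&: B).
Proof.
move=> /psubspaceP[A0 AD] /psubspaceP[_ BD]; apply/psubspaceP; split.
  by rewrite inE negb_and A0.
by move=> x y /setIP[xA xB] /setIP[yA yB] xy; rewrite inE AD ?BD.
Qed.

Lemma psubspace_line x y : x != 0 -> y != 0 -> x != y ->
  psubspace [set x; y; x + y].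
Proof.
move=> x0 y0 xy; apply/psubspaceP; split.
  rewrite !inE !negb_or !(eq_sym 0) x0 y0 /=.
  by apply: contra xy => /eqP/addr2_eq0 ->.
have yxE : y + (x + y) = x by rewrite (addrC x) addKr2.
move=> a b; rewrite !inE -!orbA.
move=> /or3P[] /eqP -> /or3P[] /eqP -> ab; try by rewrite eqxx in ab.
- by rewrite eqxx !orbT.
- by rewrite addKr2 eqxx orbT.
- by rewrite addrC eqxx !orbT.
- by rewrite yxE eqxx.
- by rewrite (addrC (x + y)) addKr2 eqxx orbT.
by rewrite (addrC (x + y)) yxE eqxx.
Qed.

Lemma pspan_pair x y : x != 0 -> y != 0 -> x != y ->
  pspan [set x; y] = [set x; y; x + y].
Proof.
move=> x0 y0 xy; have /eqP -> := psubspace_line x0 y0 xy.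
apply/setP => z; rewrite !inE; congr (_ && _); apply/idP/idP => z_in.
  apply: subvP z_in; apply: sub_span => w; rewrite !mem_enum !inE => ->.
  by [].
apply: subvP z_in; apply/span_subvP => w; rewrite mem_enum !inE -orbA.
have xs : x \in <<enum [set x; y]>>%VS.
  by apply: memv_span; rewrite mem_enum !inE eqxx.
have ys : y \in <<enum [set x; y]>>%VS.
  by apply: memv_span; rewrite mem_enum !inE eqxx orbT.
by case/or3P => /eqP -> //; apply: memvD.
Qed.

End Subspaces.

(** * Coordinate systems and sets of points given by codes *)

HB.lock Definition dset n (d : N -> 'rV['F_2]_n) (l : seq N) : {set 'rV['F_2]_n} :=
  [set x in map d l].

HB.lock Definition dsets n (d : N -> 'rV['F_2]_n) (fam : seq (seq N)) :
  {set {set 'rV['F_2]_n}} := [set U in map (dset d) fam].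

Section Decoder.
Variable n : nat.
Local Notation V := 'rV['F_2]_n.
Implicit Types (d : N -> V) (l : seq N) (A : {set V}).

(** A linear injection of the 256 codes into F_2^n: a basis if n = 8, a parametrised hyperplane if n
    = 9. Both cases occur, the second for the model of vectors with coordinate sum 0. *)
Record decoder d : Prop := Decoder {
  decD : {morph d : a b / xor a b >-> a + b};
  dec_eq0 : {in codes, forall k, d k = 0 -> k = 0%num} }.

Definition decode d A : seq N := [seq k <- codes | d k \in A].

Lemma dsetP d l x : reflect (exists2 k, k \in l & x = d k) (x \in dset d l).
Proof. by rewrite dset.unlock inE; apply: mapP. Qed.

Lemma mem_dset_map d l k : k \in l -> d k \in dset d l.
Proof. by move=> kl; apply/dsetP; exists k. Qed.

Lemma dsetsP d fam U : reflect (exists2 l, l \in fam & U = dset d l) (U \in dsets d fam).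
Proof. by rewrite dsets.unlock inE; apply: mapP. Qed.

Lemma mem_dsets d fam l : l \in fam -> dset d l \in dsets d fam.
Proof. by move=> kl; apply/dsetsP; exists l. Qed.

Lemma eq_dset d l l' : l =i l' -> dset d l = dset d l'.
Proof.
move=> ll; apply/setP=> x; apply/dsetP/dsetP => -[k kl ->]; exists k => //.
  by rewrite -ll.
by rewrite ll.
Qed.

Lemma sub_dset d l l' : {subset l <= l'} -> dset d l \subset dset d l'.
Proof. by move=> ll; apply/subsetP => x /dsetP[k kl ->]; apply/mem_dset_map/ll. Qed.

Lemma dset_decode_sub d A : A \subset dset d codes -> dset d (decode d A) = A.
Proof.
move=> sA; apply/setP=> x; apply/dsetP/idP => [[k]|xA].
  by rewrite mem_filter => /andP[kA _] ->.
have /dsetP[k kc xE] := subsetP sA _ xA.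
by exists k => //; rewrite mem_filter -xE xA.
Qed.

Lemma sub_decode d A : {subset decode d A <= codes}.
Proof. by move=> k; rewrite mem_filter => /andP[]. Qed.

Lemma decode_uniq d A : uniq (decode d A).
Proof. by rewrite filter_uniq ?codes_uniq. Qed.

Lemma dset_lin d g l : dset (d \o lin g) l = dset d (map (lin g) l).
Proof. by rewrite dset.unlock map_comp. Qed.

Lemma dsets_lin d g fam : dsets (d \o lin g) fam = dsets d (map (map (lin g)) fam).
Proof.
rewrite dsets.unlock -map_comp; apply/setP=> U; rewrite !inE; congr (_ \in _).
by apply: eq_map => l /=; rewrite dset_lin.
Qed.

Lemma additive_eq_on d d' s :
  {morph d : a b / xor a b >-> a + b} -> {morph d' : a b / xor a b >-> a + b} ->
  {in s, d =1 d'} -> {in spanl s, d =1 d'}.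
Proof.
move=> dD d'D ss; apply: (@spanlP (fun k => d k = d' k)) => //.
  by rewrite -(xorn 0%num) dD d'D !addrr2.
by move=> a b ea eb; rewrite dD d'D ea eb.
Qed.

Section Fixed.
Variable d : N -> V.
Hypothesis dP : decoder d.

Lemma dec0 : d 0%num = 0.
Proof. by rewrite -(xorn 0%num) (decD dP) addrr2. Qed.

Lemma dec_inj : {in codes &, injective d}.
Proof.
move=> a b ac bc ab; apply: xor_eq0; apply: (dec_eq0 dP); first exact: xor_codes.
by rewrite (decD dP) ab addrr2.
Qed.

Lemma mem_dset l k : {subset l <= codes} -> k \in codes ->
  (d k \in dset d l) = (k \in l).
Proof.
move=> lc kc; apply/idP/idP => [/dsetP[j jl] /dec_inj -> //|]; first exact: lc.
exact: mem_dset_map.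
Qed.

Lemma dset_inj l l' : {subset l <= codes} -> {subset l' <= codes} ->
  dset d l = dset d l' -> l =i l'.
Proof.
move=> lc l'c E k; apply/idP/idP => kl.
  by rewrite -(mem_dset l'c) ?lc // -E mem_dset_map.
by rewrite -(mem_dset lc) ?l'c // E mem_dset_map.
Qed.

Lemma card_dset l : {subset l <= codes} -> uniq l -> #|dset d l| = size l.
Proof.
move=> lc lu; rewrite -(size_map d) cardE.
apply/perm_size/uniq_perm; rewrite ?enum_uniq //.
  by rewrite map_inj_in_uniq // => a b /lc ac /lc bc; apply: dec_inj.
by move=> x; rewrite mem_enum dset.unlock inE.
Qed.

Lemma mem_decode A k : (k \in decode d A) = (d k \in A) && (k \in codes).
Proof. by rewrite mem_filter. Qed.

Lemma decode_dset l k : {subset l <= codes} -> (k \in decode d (dset d l)) = (k \in l).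
Proof.
move=> lc; rewrite mem_decode; apply/andP/idP => [[kl kc]|kl].
  by rewrite mem_dset in kl.
by rewrite mem_dset_map // lc.
Qed.

Lemma size_decode A : A \subset dset d codes -> size (decode d A) = #|A|.
Proof.
move=> sA; rewrite -[in RHS](dset_decode_sub sA) card_dset ?decode_uniq //.
exact: sub_decode.
Qed.

End Fixed.

Definition lin_ok (g : seq N) : bool :=
  all (fun k => memN (lin g k) codes && (if N.eqb k 0 then true else ~~ N.eqb (lin g k) 0)) codes.

Lemma lin_ok_codes g k : lin_ok g -> k \in codes -> lin g k \in codes.
Proof. by move=> /allP h /h /andP[]; rewrite memNE. Qed.

Lemma lin_ok_inj g : lin_ok g -> {in codes &, injective (lin g)}.
Proof.
move=> gok a b ac bc ab; apply: xor_eq0; have xc := xor_codes ac bc.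
have := allP gok _ xc; rewrite lin_xor ab xorn => /andP[_] /=.
by case: N.eqb_spec.
Qed.

Lemma decoder_lin d g : decoder d -> lin_ok g -> decoder (d \o lin g).
Proof.
move=> dP gok; split=> [a b|k kc] /=; first by rewrite lin_xor (decD dP).
move/(dec_eq0 dP (lin_ok_codes gok kc)) => g0.
by apply: (lin_ok_inj gok); rewrite ?codes0 // g0 lin0.
Qed.

End Decoder.

(** * Projective subspaces as row spaces *)

Section RowSpaceSets.
Variable n : nat.
Local Notation V := 'rV['F_2]_n.

Definition row_points m (M : 'M['F_2]_(m, n)) : {set V} :=
  [set x : V | (x != 0) && (x <= M)%MS].

Lemma psubspace_row_points m (M : 'M_(m, n)) : psubspace (row_points M).
Proof.
apply/psubspaceP; split; first by rewrite inE eqxx.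
move=> x y; rewrite !inE => /andP[_ xM] /andP[_ yM] xy; rewrite addmx_sub // andbT.
by apply: contra xy => /eqP/addr2_eq0 ->.
Qed.

Lemma vspace_matrix (U : {vspace V}) :
  {M : 'M_(\dim U, n) | row_free M & forall x, (x \in U) = (x <= M)%MS}.
Proof.
pose X := vbasis U; exists (\matrix_(i < \dim U) X`_i).
  rewrite -kermx_eq0; apply/rowV0P => v /sub_kermxP.
  rewrite mulmx_sum_row => v0; apply/rowP => i; rewrite !mxE.
  have /freeP := basis_free (vbasisP U); apply.
  by rewrite -[RHS]v0; apply: eq_bigr => j _; rewrite rowK.
move=> x; apply/idP/idP => [xU|/submxP[v ->]].
  rewrite (coord_vbasis xU); apply: summx_sub => i _; apply: scalemx_sub.
  by rewrite -(rowK (fun i => X`_i)) row_sub.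
rewrite mulmx_sum_row; apply: memv_suml => i _; rewrite memvZ // rowK.
by apply: vbasis_mem; rewrite mem_nth // size_tuple.
Qed.

Lemma psubspace_matrix (A : {set V}) : psubspace A ->
  exists m (M : 'M_(m, n)), [/\ row_free M, A = row_points M & #|A|.+1 = (2 ^ m)%N].
Proof.
move=> sA; have [M M1 ME] := vspace_matrix <<enum A>>%VS.
exists (\dim <<enum A>>), M; split; rewrite ?card_psubspace //.
by apply: etrans (eqP sA) _; apply/setP=> x; rewrite !inE ME.
Qed.

End RowSpaceSets.

(** * The polar form and the dimension of generators *)

Section Form.
Variable f : 'rV['F_2]_8 -> 'F_2.
Local Notation V := 'rV['F_2]_8.
Hypotheses (hf : quadratic_form f) (hnd : nondegenerate_form f).

Lemma formD x y : f (x + y) = f x + f y + polar f x y.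
Proof. by rewrite /polar -(addrA (f (x + y))) -opprD [RHS]addrC addrNK. Qed.

Definition gram : 'M['F_2]_8 := \matrix_(i, j) polar f (delta_mx 0 i) (delta_mx 0 j).

Lemma polarE x y : polar f x y = (x *m gram *m y^T) 0 0.
Proof.
have [_ [hl hr]] := hf.
pose hL y0 := GRing.isLinear.Build _ _ _ _ _ (hl y0).
pose Lf y0 : {linear V -> 'F_2 | *%R} := HB.pack (polar f ^~ y0) (hL y0).
pose hR x0 := GRing.isLinear.Build _ _ _ _ _ (hr x0).
pose Rf x0 : {linear V -> 'F_2 | *%R} := HB.pack (polar f x0) (hR x0).
have polL y0 x0 : polar f x0 y0 = \sum_i x0 0 i * polar f (delta_mx 0 i) y0.
  rewrite {1}(row_sum_delta x0) -[LHS]/(Lf y0 _) linear_sum.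
  by apply: eq_bigr => i _; rewrite linearZ.
have polR x0 y0 : polar f x0 y0 = \sum_i y0 0 i * polar f x0 (delta_mx 0 i).
  rewrite {1}(row_sum_delta y0) -[LHS]/(Rf x0 _) linear_sum.
  by apply: eq_bigr => i _; rewrite linearZ.
rewrite polR mxE; apply: eq_bigr => j _; rewrite mulrC polL !mxE.
by congr (_ * _); apply: eq_bigr => i _; rewrite !mxE.
Qed.

Lemma polarC x y : polar f x y = polar f y x.
Proof. by rewrite /polar (addrC x) addrAC. Qed.

Lemma form0 : f 0 = 0.
Proof. by have [/(_ 0 0)] := hf; rewrite scale0r expr2 !mul0r. Qed.

Lemma polar_row_points m k (X : 'M_(m, 8)) (Y : 'M_(k, 8)) x y :
  X *m gram *m Y^T = 0 -> (x <= X)%MS -> (y <= Y)%MS -> polar f x y = 0.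
Proof.
move=> XY /submxP[u ->] /submxP[v ->].
rewrite polarE trmx_mul -!mulmxA (mulmxA gram) (mulmxA X) (mulmxA X) XY.
by rewrite mul0mx mulmx0 mxE.
Qed.

Lemma polar_matrix m k (X : 'M_(m, 8)) (Y : 'M_(k, 8)) :
  (forall x y, (x <= X)%MS -> (y <= Y)%MS -> polar f x y = 0) ->
  X *m gram *m Y^T = 0.
Proof.
move=> XY; apply/matrixP=> i j; rewrite [RHS]mxE.
rewrite -(XY _ _ (row_sub i X) (row_sub j Y)) polarE -row_mul.
by rewrite [LHS]mxE [RHS]mxE; apply: eq_bigr => l _; rewrite [in RHS]mxE; congr (_ * _); rewrite !mxE.
Qed.

Lemma singular_gram m (X : 'M_(m, 8)) :
  (forall x, (x <= X)%MS -> f x = 0) -> X *m gram *m X^T = 0.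
Proof.
by move=> X0; apply: polar_matrix => x y xX yX; rewrite /polar !X0 ?addmx_sub ?subr0.
Qed.

(* A vector of a singular subspace in the radical vanishes, so the polarity is
   injective there. *)
Lemma singular_rank m k (X : 'M_(m, 8)) (Y : 'M_(k, 8)) :
  row_free X -> (forall x, (x <= X)%MS -> f x = 0) -> row_free Y ->
  X *m gram *m Y^T = 0 -> (m + k <= 8)%N.
Proof.
move=> X1 X0 Y1 XY.
have XB : row_free (X *m gram).
  rewrite -kermx_eq0; apply/rowV0P => v /sub_kermxP; rewrite mulmxA => v0.
  have vX : v *m X = 0.
    apply: hnd; first by rewrite X0 ?submxMl.
    by move=> y; rewrite polarE v0 mul0mx mxE.
  by apply: (row_free_inj X1); rewrite vX mul0mx.
by have := mulmx0_rank_max XY; rewrite mxrank_tr (eqP XB) (eqP Y1).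
Qed.

Hypothesis hhyp : hyperbolic_form f.

Lemma quadric_rowP m (X : 'M_(m, 8)) :
  reflect (forall x, (x <= X)%MS -> f x = 0) (row_points X \subset quadric f).
Proof.
apply: (iffP subsetP) => [h x xX|h x]; last first.
  by rewrite !inE => /andP[-> /h ->] /=.
case: (eqVneq x 0) => [->|x0]; first exact: form0.
by have := h x; rewrite !inE x0 xX => /(_ isT)/eqP.
Qed.

(** A singular subspace of rank w is orthogonal to itself, which gives 2 w <= 8. Conversely let N be
    a singular 4-space, C a complement of the intersection of M and N in M, and K the subspace of N
    orthogonal to C. Then K is orthogonal to M, so [M + K] is singular and equals M by maximality;
    the dimension formulas give 4 <= w. *)
Lemma generator_card W : quadric_generator (quadric f) W -> #|W| = 15%N.
Proof.
move=> /maxsetP[/andP[sW Wq] Wmax].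
have [w [M [M1 WE Wc]]] := psubspace_matrix sW.
have M0 : forall x, (x <= M)%MS -> f x = 0 by apply/quadric_rowP; rewrite -WE.
suff w4 : w = 4%N by move: Wc; rewrite w4 => -[].
have w_le4 : (w <= 4)%N.
  have := singular_rank M1 M0 M1 (singular_gram M0).
  by rewrite addnn -[8%N]/(4.*2)%N leq_double.
apply/eqP; rewrite eqn_leq w_le4 /=.
have [U [U0 dimU]] := hhyp.
have {}dimU : \dim U = 4%N by rewrite -[LHS]doubleK -dimU.
have [N N1 NU] := vspace_matrix U.
have {}U0 : forall x, (x <= N)%MS -> f x = 0 by move=> x; rewrite -NU => /U0.
pose C := (M :\: N)%MS; pose K := (N :&: kermx (gram *m C^T))%MS.
have rC : (\rank (M :&: N) + \rank C = w)%N.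
  by rewrite mxrank_cap_compl (eqP M1).
have rK : (4 <= \rank C + \rank K)%N.
  have := mxrank_mul_ker N (gram *m C^T); rewrite (eqP N1) -/K => rN.
  apply: (@leq_trans (\dim U)); first by rewrite dimU.
  rewrite -rN.
  by rewrite leq_add2r -(mxrank_tr C) (leq_trans (mxrankM_maxr _ _)) ?mxrankM_maxr.
have rMK := mxrank_sum_cap M K.
have cMK : (\rank (M :&: K) <= \rank (M :&: N))%N.
  by rewrite mxrankS // capmxS // capmxSl.
(* K is orthogonal to C by definition, and to the intersection of M and N because it lies in the
   singular space N. *)
have KM x y : (x <= K)%MS -> (y <= M)%MS -> polar f x y = 0.
  rewrite sub_capmx => /andP[xN /sub_kermxP xC].
  have : (M <= (M :&: N) + C)%MS by rewrite (addsmxC (M :&: N)%MS) addsmx_diff_cap_eq.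
  move=> h yM; have /sub_addsmxP[[u v] ->] := submx_trans yM h.
  rewrite polarE raddfD mulmxDr mxE /= -!polarE.
  rewrite (polar_row_points (singular_gram U0)) //; last first.
    by rewrite (submx_trans (submxMl _ _)) ?capmxSr.
  by rewrite polarE trmx_mul -mulmxA (mulmxA gram) (mulmxA x) xC mul0mx mxE addr0.
have MK0 x : (x <= M + K)%MS -> f x = 0.
  case/sub_addsmxP => -[u v] ->; rewrite formD M0 ?submxMl // add0r.
  rewrite polarC KM ?submxMl // addr0 U0 //.
  by rewrite (submx_trans (submxMl _ _)) ?capmxSl.
have MKW : row_points (M + K)%MS = W.
  apply: Wmax; first by rewrite psubspace_row_points; apply/quadric_rowP.
  rewrite WE; apply/subsetP=> x; rewrite !inE => /andP[-> xM].
  by rewrite (submx_trans xM) ?addsmxSl.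
have : (\rank (M + K)%MS <= w)%N.
  apply: leq_trans (rank_leq_row M); apply: mxrankS; apply/row_subP => i.
  case: (eqVneq (row i (M + K)%MS) 0) => [->|r0]; first exact: sub0mx.
  have : row i (M + K)%MS \in W by rewrite -MKW inE r0 row_sub.
  by rewrite WE inE => /andP[].
move: rC rK rMK cMK; rewrite (eqP M1); lia.
Qed.

End Form.

(** * Hyperbolic coordinates for two disjoint generators *)

Section PairFrame.

Lemma qform_bits : {in codes, forall k,
  qform k = (N.testbit k 0 && N.testbit k 4) (+) (N.testbit k 1 && N.testbit k 5)
    (+) (N.testbit k 2 && N.testbit k 6) (+) (N.testbit k 3 && N.testbit k 7)}.
Proof.
have /allP h : all (fun k => qform k ==
  (N.testbit k 0 && N.testbit k 4) (+) (N.testbit k 1 && N.testbit k 5)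
    (+) (N.testbit k 2 && N.testbit k 6) (+) (N.testbit k 3 && N.testbit k 7)) codes.
  by vm_compute.
by move=> k /h /eqP.
Qed.

(* The nibbles of a code: coordinates [4 s, ..., 4 s + 3]. *)
Definition nibble (s : nat) (k : N) : 'rV['F_2]_4 :=
  \row_i (N.testbit k (N.of_nat (4 * s + i)))%:R.

Lemma nibble_xor s : {morph nibble s : a b / xor a b >-> a + b}.
Proof.
move=> a b; apply/rowP=> i; rewrite !mxE N.lxor_spec.
by case: (N.testbit a _); case: (N.testbit b _); apply: val_inj.
Qed.

Lemma nibble_eq0 s k : nibble s k = 0 ->
  forall i, (i < 4)%N -> N.testbit k (N.of_nat (4 * s + i)) = false.
Proof.
move=> /rowP k0 i i4; have := k0 (Ordinal i4); rewrite !mxE /=.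
by case: (N.testbit _ _).
Qed.

Lemma code_nibbles0 : {in codes, forall k, nibble 0 k = 0 -> nibble 1 k = 0 -> k = 0%num}.
Proof.
have /allP h : all (fun k => has (fun i => N.testbit k (N.of_nat i)) (iota 0 8)
   || (k == 0%num)) codes by vm_compute.
move=> k /h /orP[/hasP[i]|/eqP //]; rewrite mem_iota add0n => /andP[_ i8] ki k0 k1.
case: (ltnP i 4) => i4; first by have := nibble_eq0 k0 i4; rewrite muln0 add0n ki.
have i4' : (i - 4 < 4)%N by lia.
by have := nibble_eq0 k1 i4'; rewrite muln1 subnKC // ki.
Qed.

Lemma nibble_low k : k \in low_block -> nibble 1 k = 0.
Proof.
have /allP h : all (fun k => all (fun i => ~~ N.testbit k (N.of_nat (4 + i))) (iota 0 4))
  low_block by vm_compute.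
move=> /h /allP kl; apply/rowP => i; rewrite !mxE muln1.
by have /negPf -> : ~~ N.testbit k (N.of_nat (4 + i)) by apply: kl; rewrite mem_iota /=.
Qed.

Lemma nibble_high k : k \in high_block -> nibble 0 k = 0.
Proof.
have /allP h : all (fun k => all (fun i => ~~ N.testbit k (N.of_nat i)) (iota 0 4))
  high_block by vm_compute.
move=> /h /allP kl; apply/rowP => i; rewrite !mxE muln0 add0n.
by have /negPf -> : ~~ N.testbit k (N.of_nat i) by apply: kl; rewrite mem_iota /=.
Qed.

Lemma nibbles_qform k : k \in codes ->
  (nibble 0 k *m (nibble 1 k)^T) 0 0 = (qform k)%:R.
Proof.
move=> kc; rewrite mxE !big_ord_recl big_ord0 !mxE /= (qform_bits kc).
by do 8![case: (N.testbit k _)]; apply: val_inj.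
Qed.

Lemma low_codes : {subset low_block <= codes}. Proof. by apply: subNP; vm_compute. Qed.
Lemma high_codes : {subset high_block <= codes}. Proof. by apply: subNP; vm_compute. Qed.
Lemma singular_codes : {subset singular <= codes}.
Proof. by apply: subNP; vm_compute. Qed.
Lemma nonsingular_codes : {subset nonsingular <= codes}.
Proof. by apply: subNP; vm_compute. Qed.

Lemma low_uniq : uniq low_block. Proof. by vm_compute. Qed.
Lemma high_uniq : uniq high_block. Proof. by vm_compute. Qed.

Lemma decoder_surj (d : N -> 'rV['F_2]_8) : decoder d -> dset d codes = setT.
Proof.
move=> dP; apply/eqP; rewrite eqEcard subsetT cardsT /= card_mx card_Fp //.
by rewrite card_dset ?codes_uniq.
Qed.

Variable f : 'rV['F_2]_8 -> 'F_2.
Local Notation V := 'rV['F_2]_8.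
Hypotheses (hf : quadratic_form f) (hnd : nondegenerate_form f).

Lemma dset_quadric (d : N -> V) : decoder d ->
  {in codes, forall k, f (d k) = (qform k)%:R} -> quadric f = dset d singular.
Proof.
move=> dP fd; apply/setP => x; have : x \in dset d codes by rewrite decoder_surj ?inE.
case/dsetP => k kc ->; rewrite (mem_dset dP singular_codes kc).
rewrite singularE kc inE fd //=; congr (_ && _); last by case: (qform k); rewrite ?eqxx ?oner_eq0.
by congr negb; apply/eqP/eqP => [/(dec_eq0 dP kc)|->]; rewrite ?(dec0 dP).
Qed.

(** The polar form pairs the two generators perfectly, so a basis of the first has a dual basis in
    the second. Together they form a basis in which f becomes [qform]. *)
Lemma pair_frame (U1 U2 : {set V}) :
  psubspace U1 -> psubspace U2 -> U1 \subset quadric f -> U2 \subset quadric f ->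
  #|U1| = 15%N -> #|U2| = 15%N -> [disjoint U1 & U2] ->
  exists d, [/\ decoder d, quadric f = dset d singular, U1 = dset d low_block
              & U2 = dset d high_block].
Proof.
move=> /psubspace_matrix[m [X [X1 XE]]] + /psubspace_matrix[m' [Y [Y1 YE]]] +.
move=> cm cm' U1q U2q c1 c2 dis.
have em : m = 4%N.
  by move: cm; rewrite c1 => /eqP; rewrite -[16%N]/(2 ^ 4)%N eqn_exp2l // => /eqP <-.
have em' : m' = 4%N.
  by move: cm'; rewrite c2 => /eqP; rewrite -[16%N]/(2 ^ 4)%N eqn_exp2l // => /eqP <-.
subst m m'.
have X0 : forall x, (x <= X)%MS -> f x = 0 by apply/(quadric_rowP hf); rewrite -XE.
have Y0 : forall x, (x <= Y)%MS -> f x = 0 by apply/(quadric_rowP hf); rewrite -YE.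
have XY0 (x : V) : (x <= X)%MS -> (x <= Y)%MS -> x = 0.
  move=> xX xY; apply/eqP/negPn/negP => x0.
  by have := disjoint_setI0 dis => /setP/(_ x); rewrite XE YE !inE x0 xX xY.
have XYfull (y : V) : (y <= X + Y)%MS.
  apply: submx_full; rewrite /row_full mxrank_disjoint_sum ?(eqP X1) ?(eqP Y1) //.
  apply/eqP/rowV0P => x; rewrite sub_capmx => /andP[]; exact: XY0.
pose M := X *m gram f *m Y^T.
(* A vector of U1 in the kernel of the pairing is orthogonal to U1 and to U2, which span the space,
   and it is singular; non-degeneracy makes it zero. *)
have Mu : M \in unitmx.
  rewrite -row_free_unit -kermx_eq0; apply/rowV0P => v /sub_kermxP vM.
  suff vX : v *m X = 0 by apply: (row_free_inj X1); rewrite vX mul0mx.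
  apply: hnd; first by rewrite X0 ?submxMl.
  move=> y; have /sub_addsmxP[[u w] ->] := XYfull y.
  rewrite polarE // raddfD mulmxDr mxE -!polarE //=.
  rewrite (polar_row_points hf (singular_gram hf X0)) ?submxMl // add0r.
  by rewrite polarE // trmx_mul -!mulmxA (mulmxA (gram f)) (mulmxA X) (mulmxA X) (mulmxA v) vM mul0mx mxE.
(* The basis of U2 dual to X. *)
pose Z := (invmx M)^T *m Y.
have XZ : X *m gram f *m Z^T = 1%:M by rewrite trmx_mul trmxK mulmxA mulmxV.
pose d k := nibble 0 k *m X + nibble 1 k *m Z.
have ZY (u : 'rV_4) : (u *m Z <= Y)%MS by rewrite mulmxA submxMl.
have dP : decoder d.
  split=> [a b|k kc]; first by rewrite /d !nibble_xor !mulmxDl addrACA.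
  move/addr2_eq0 => XZk.
  have lX0 : nibble 0 k *m X = 0 by apply: XY0; rewrite ?submxMl // XZk.
  have hZ0 : nibble 1 k *m Z = 0 by rewrite -XZk.
  apply: code_nibbles0 => //; first by apply: (row_free_inj X1); rewrite lX0 mul0mx.
  have hI0 : nibble 1 k *m (invmx M)^T = 0.
    by apply: (row_free_inj Y1); rewrite mul0mx -mulmxA.
  by rewrite -[nibble 1 k]mulmx1 -trmx1 -(mulmxV Mu) trmx_mul mulmxA hI0 mul0mx.
have fd : {in codes, forall k, f (d k) = (qform k)%:R}.
  move=> k kc; rewrite /d formD X0 ?submxMl // Y0 // !add0r polarE //.
  have -> : nibble 0 k *m X *m gram f *m (nibble 1 k *m Z)^T
      = nibble 0 k *m (X *m gram f *m Z^T) *m (nibble 1 k)^T.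
    by rewrite trmx_mul !mulmxA.
  by rewrite XZ mulmx1 nibbles_qform.
exists d; split=> //; first exact: dset_quadric.
  apply/eqP; rewrite eq_sym eqEcard c1 (card_dset dP low_codes low_uniq) andbT.
  apply/subsetP => x /dsetP[k kl ->].
  rewrite XE inE /d (nibble_low kl) mul0mx addr0 submxMl andbT.
  apply/eqP => k0; have : k = 0%num.
    by apply: (dec_eq0 dP); rewrite ?low_codes // /d (nibble_low kl) k0 mul0mx add0r.
  by move=> k0'; move: kl; rewrite k0' -memNE; vm_compute.
apply/eqP; rewrite eq_sym eqEcard c2 (card_dset dP high_codes high_uniq) andbT.
apply/subsetP => x /dsetP[k kl ->].
rewrite YE inE /d (nibble_high kl) mul0mx add0r ZY andbT.
apply/eqP => k0; have : k = 0%num.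
  by apply: (dec_eq0 dP); rewrite ?high_codes // /d (nibble_high kl) k0 mul0mx add0r.
by move=> k0'; move: kl; rewrite k0' -memNE; vm_compute.
Qed.

End PairFrame.

#[global] Opaque codes singular nonsingular low_block high_block.

(** * Enumeration of generators, of spreads through both blocks and of ovoids through two points *)

Fixpoint transversals (r : rel N) (blocks : seq (seq N)) (acc : seq N) : seq (seq N) :=
  if blocks is B :: blocks' then
    flatten [seq transversals r blocks' (p :: acc) | p <- B & all (r p) acc]
  else [:: acc].

(** One branch of the search chooses all its elements in [o]; they are pairwise compatible, so none
    of these choices is rejected. *)
Lemma transversalsP (r : rel N) (o : seq N) blocks acc :
  {in o &, forall p a, r p a} -> {subset acc <= o} ->
  {in blocks, forall B, has (fun p => memN p B) o} ->
  exists2 t, t \in transversals r blocks acc & {subset t <= o}.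
Proof.
move=> ro; elim: blocks acc => [|B bs IH] acc ao hB /=.
  by exists acc; rewrite ?mem_head.
have /hasP[p po pB] := hB B (mem_head _ _).
have [|C Cbs|t tin tso] := IH (p :: acc).
- by move=> x; rewrite inE => /predU1P[-> //|/ao].
- by apply: hB; rewrite inE Cbs orbT.
exists t => //; apply/flattenP; exists (transversals r bs (p :: acc)) => //.
apply/mapP; exists p => //; rewrite mem_filter -memNE pB andbT.
by apply/allP => a /ao; apply: ro.
Qed.

(** The singular 4-spaces disjoint from [high_block]. Such a space projects bijectively onto the low
    nibble, which [lin [:: 1; 2; 4; 8]] computes, so it has a unique basis with low nibbles 1, 2, 4,
    8. On singular vectors the condition [~~ qform (xor p a)] is orthogonality. *)
Definition gen_list : seq (seq N) := Eval vm_compute in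
  map span1 (transversals (fun p a => ~~ qform (xor p a))
    [seq [seq k <- singular | N.eqb (lin [:: 1; 2; 4; 8] k) t] | t <- [:: 1; 2; 4; 8]]%num
    [::]).

Definition covered (p : N) (fam : seq (seq N)) : bool := has (memN p) fam.

Definition meetN (u v : seq N) : bool := has (fun k => memN k v) u.

(* The result contains the empty list if the fuel n was insufficient. *)
Fixpoint covers (n : nat) (chosen : seq (seq N)) : seq (seq (seq N)) :=
  if [seq p <- singular | ~~ covered p chosen] is p :: _ then
    if n is n'.+1 then
      flatten [seq covers n' (u :: chosen)
        | u <- gen_list & memN p u && all (fun c => ~~ meetN u c) chosen]
    else [:: [::]]
  else [:: chosen].

Definition eqsetN (s t : seq N) : bool := subN s t && subN t s.

Definition eqfamN (f g : seq (seq N)) : bool :=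
  all (fun u => has (eqsetN u) g) f && all (fun u => has (eqsetN u) f) g.

(** One isometry for each of the eight spreads through the two blocks; it fixes both blocks and
    sends [std_spread] to that spread. *)
Definition spread_maps : seq (seq N) :=
  [:: [:: 1; 2; 4; 8; 16; 32; 64; 128]; [:: 1; 2; 4; 12; 16; 32; 192; 128];
      [:: 1; 2; 4; 15; 144; 160; 192; 128]; [:: 1; 2; 4; 9; 144; 32; 64; 128];
      [:: 1; 2; 4; 14; 16; 160; 192; 128]; [:: 1; 2; 4; 10; 16; 160; 64; 128];
      [:: 1; 2; 4; 13; 144; 32; 192; 128]; [:: 1; 2; 4; 11; 144; 160; 64; 128]]%num.

(** The standard ovoid. Its points in the two blocks are 1 and 16, and their sum is the base point
    17. *)
Definition root : seq N := [:: 1; 16; 51; 117; 215; 249; 155; 189; 95]%num.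

Definition ovoid_maps : seq (seq N) :=
  [:: [:: 1; 2; 4; 8; 16; 32; 64; 128]; [:: 1; 2; 4; 12; 16; 32; 192; 128];
      [:: 1; 2; 4; 10; 16; 160; 64; 128]; [:: 1; 2; 6; 12; 16; 224; 192; 128];
      [:: 1; 2; 6; 14; 16; 96; 192; 128]; [:: 1; 2; 6; 10; 16; 224; 64; 128];
      [:: 1; 2; 6; 8; 16; 96; 64; 128]; [:: 1; 2; 4; 14; 16; 160; 192; 128]]%num.

Definition isometry_code (g : seq N) : bool :=
  lin_ok g && subN (map (lin g) singular) singular.

Definition fixes_blocks (g : seq N) : bool :=
  eqsetN (map (lin g) low_block) low_block && eqsetN (map (lin g) high_block) high_block.

Lemma eqsetNP s t : eqsetN s t -> s =i t.
Proof. by case/andP => /subNP st /subNP ts k; apply/idP/idP => [/st|/ts]. Qed.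

Lemma covers_std : all (fun fam => has (fun m =>
    [&& isometry_code m, fixes_blocks m & eqfamN (map (map (lin m)) std_spread) fam])
  spread_maps) (covers 7 [:: low_block; high_block]).
Proof. by vm_compute. Qed.

(** The fuel 7 suffices because two of the nine members are given at the start. *)
Lemma covers_nonempty : all (fun fam => ~~ nilp fam) (covers 7 [:: low_block; high_block]).
Proof. by vm_compute. Qed.

Lemma gen_list_uniq : all (fun u => uniq u && (size u == 15%N) && subN u codes) gen_list.
Proof. by vm_compute. Qed.

Lemma transversals_std : all (fun t => (uniq t && (size t == 9%N)) && has (fun m =>
    [&& isometry_code m, fixes_blocks m, N.eqb (lin m 17) 17 & eqsetN (map (lin m) root) t])
  ovoid_maps)
  (transversals (fun p a => ~~ memN (xor p a) singular)
     ([:: 1] :: [:: 16] :: drop 2 std_spread)%num [::]).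
Proof. by vm_compute. Qed.

Lemma std_spread_ok :
  all (fun u => subN u singular && uniq u && (size u == 15%N)) std_spread.
Proof. by vm_compute. Qed.

#[global] Opaque gen_list std_spread root ovoid_maps spread_maps.
#[global] Arguments covers : simpl never.

Lemma low_codeP : {in codes, forall k, lin [:: 1; 2; 4; 8] k = 0%num \/
  lin [:: 1; 2; 4; 8] k \in low_block}%num.
Proof.
have /allP h : all (fun k => N.eqb (lin [:: 1; 2; 4; 8] k) 0
    || memN (lin [:: 1; 2; 4; 8] k) low_block)%num codes by vm_compute.
by move=> k /h /orP[/N.eqb_eq|]; [left|right; rewrite -memNE].
Qed.

Lemma low_code0 : {in codes, forall k, lin [:: 1; 2; 4; 8]%num k = 0%num ->
  k = 0%num \/ k \in high_block}.
Proof.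
have /allP h : all (fun k => ~~ N.eqb (lin [:: 1; 2; 4; 8] k) 0
    || (N.eqb k 0 || memN k high_block))%num codes by vm_compute.
move=> k /h + k0; rewrite k0 /= => /orP[/N.eqb_eq|]; first by left.
by right; rewrite -memNE.
Qed.

Lemma gen_list_nonzero : all (fun u => ~~ memN 0 u) gen_list.
Proof. by vm_compute. Qed.

Lemma std_spread_xor : all (fun u => all (fun a => all (fun b =>
  N.eqb (xor a b) 0 || memN (xor a b) singular) u) u) std_spread.
Proof. by vm_compute. Qed.

Lemma std_spread_cover : all (fun k => has (memN k) std_spread) singular.
Proof. by vm_compute. Qed.

Lemma singular_uniq : uniq singular. Proof. by vm_compute. Qed.

(** * Coordinates adapted to a spread or to an ovoid *)

Section Frames.
Variable n : nat.
Local Notation V := 'rV['F_2]_n.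
Implicit Types (Qd A B U O : {set V}) (S : {set {set V}}) (d : N -> V).

Lemma eq_dsets d f g : eqfamN f g -> dsets d f = dsets d g.
Proof.
move=> /andP[/allP fg /allP gf]; apply/setP=> U; apply/dsetsP/dsetsP => -[u].
  by move=> /fg /hasP[v vg /eqsetNP uv] ->; exists v => //; apply: eq_dset.
by move=> /gf /hasP[v vg /eqsetNP uv] ->; exists v => //; apply: eq_dset.
Qed.

Lemma isometry_singular d g Qd : decoder d -> Qd = dset d singular ->
  isometry_code g -> Qd = dset (d \o lin g) singular.
Proof.
move=> dP -> /andP[gok gs]; apply/eqP; rewrite eq_sym eqEcard.
have dgP := decoder_lin dP gok.
rewrite dset_lin sub_dset /=; last exact: subNP.
rewrite -(dset_lin d g singular) (card_dset dgP singular_codes singular_uniq).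
by rewrite (card_dset dP singular_codes singular_uniq) leqnn.
Qed.

Lemma dset_fixed d g l : eqsetN (map (lin g) l) l -> dset (d \o lin g) l = dset d l.
Proof. by move=> /eqsetNP gl; rewrite dset_lin; apply: eq_dset. Qed.

(** The properties of a spread on which the classification relies, for any ambient dimension: it is
    applied to the quadric of F_2^8 and to the model in F_2^9. *)
Definition cspread Qd S : Prop :=
  partition S Qd /\ {in S, forall U, psubspace U /\ #|U| = 15%N}.

Definition gframe Qd S A B d : Prop :=
  [/\ decoder d, Qd = dset d singular, S = dsets d std_spread,
      A = dset d low_block & B = dset d high_block].

Lemma partition_eq Qd S U W x :
  partition S Qd -> U \in S -> W \in S -> x \in U -> x \in W -> U = W.
Proof.
move=> /and3P[_ tS _] US WS xU xW; apply/eqP/negPn/negP => /(trivIsetP tS _ _ US WS).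
by move=> /disjoint_setI0/setP/(_ x); rewrite !inE xU xW.
Qed.

Section Decoded.
Variables (Qd : {set V}) (d : N -> V).
Hypotheses (dP : decoder d) (dQ : Qd = dset d singular).

Lemma mem_Qd k : k \in codes -> (d k \in Qd) = (k \in singular).
Proof. by move=> kc; rewrite dQ (mem_dset dP singular_codes kc). Qed.

Lemma sub_Qd_codes U : U \subset Qd -> U \subset dset d codes.
Proof. by move=> UQ; rewrite (subset_trans UQ) // dQ sub_dset //; apply: singular_codes. Qed.

(** Disjointness from the high block makes the low nibble injective on the 15 points of U, hence
    onto the 15 nonzero nibbles. The points over 1, 2, 4, 8 are a transversal of the enumeration,
    and they span U. *)
Lemma generator_in_list U : psubspace U -> U \subset Qd -> #|U| = 15%N ->
  [disjoint U & dset d high_block] -> exists2 u, u \in gen_list & U = dset d u.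
Proof.
move=> /psubspaceP[U0 UD] UQ cU dis; pose o := decode d U.
have Uo : dset d o = U by apply: dset_decode_sub; apply: sub_Qd_codes.
have oc : {subset o <= codes} := @sub_decode _ _ _.
have oU k : k \in o -> d k \in U by rewrite mem_decode => /andP[].
have os : size o = 15%N by rewrite (size_decode dP) ?sub_Qd_codes.
have oX a b : a \in o -> b \in o -> a = b \/ xor a b \in o.
  move=> ao bo; case: (eqVneq a b) => [->|ab]; [by left|right].
  rewrite mem_decode (decD dP) xor_codes ?oc // andbT UD ?oU //.
  by apply: contra ab => /eqP/(dec_inj dP) ->; rewrite ?oc.
have on0 k : k \in o -> k != 0%num.
  by move=> /oU dk; apply: contraNneq U0 => k0; rewrite -(dec0 dP) -k0.
pose lo := lin [:: 1; 2; 4; 8]%num.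
have lo_inj : {in o &, injective lo}.
  move=> a b ao bo ab; have [//|xo] := oX a b ao bo.
  have : lo (xor a b) = 0%num by rewrite /lo lin_xor -/lo ab xorn.
  case/low_code0 => [|/xor_eq0 //|xh]; first exact: oc.
  have /setP/(_ (d (xor a b))) := disjoint_setI0 dis.
  by rewrite in_setI oU // mem_dset_map // in_set0.
have lo_sub : {subset map lo o <= low_block}.
  move=> _ /mapP[k ko ->]; have [k0|//] := low_codeP (oc _ ko).
  have [k00|kh] := low_code0 (oc _ ko) k0; first by have := on0 _ ko; rewrite k00 eqxx.
  have /setP/(_ (d k)) := disjoint_setI0 dis.
  by rewrite in_setI oU // mem_dset_map // in_set0.
have lo_uniq : uniq (map lo o) by rewrite map_inj_in_uniq ?decode_uniq.
have lo_all : map lo o =i low_block.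
  by have [] := uniq_min_size lo_uniq lo_sub; rewrite size_map os.
have [||t|t] := @transversalsP (fun p a => ~~ qform (xor p a)) o
  [seq [seq k <- singular | N.eqb (lin [:: 1; 2; 4; 8] k) t] | t <- [:: 1; 2; 4; 8]]%num [::].
- move=> a b ao bo; have [->|/oU] := oX a b ao bo; first by rewrite xorn.
  by move=> /(subsetP UQ); rewrite mem_Qd ?xor_codes ?oc // singularE => /and3P[].
- by [].
- move=> tB; apply/hasP; move: tB => /mapP[i i4 ->].
  have /mapP[p po pi] : i \in map lo o.
    have i4' : {subset [:: 1; 2; 4; 8]%num <= low_block} by apply: subNP.
    by rewrite lo_all i4'.
  exists p => //; rewrite memNE mem_filter -mem_Qd ?oc //.
  by rewrite (subsetP UQ) ?oU // andbT pi; apply/N.eqb_eq.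
move=> tt to; exists (span1 t).
  have -> : gen_list = map span1 (transversals (fun p a => ~~ qform (xor p a))
    [seq [seq k <- singular | N.eqb (lin [:: 1; 2; 4; 8] k) t] | t <- [:: 1; 2; 4; 8]]%num
    [::]) by vm_compute.
  exact: map_f.
have ug : span1 t \in gen_list.
  have -> : gen_list = map span1 (transversals (fun p a => ~~ qform (xor p a))
    [seq [seq k <- singular | N.eqb (lin [:: 1; 2; 4; 8] k) t] | t <- [:: 1; 2; 4; 8]]%num
    [::]) by vm_compute.
  exact: map_f.
have /andP[/andP[uu /eqP us] /subNP uc] := allP gen_list_uniq _ ug.
apply/eqP; rewrite eq_sym eqEcard cU (card_dset dP uc uu) us leqnn andbT.
apply/subsetP => x /dsetP[k ku ->]; apply: oU.
suff : k = 0%num \/ k \in o.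
  case=> // k0; have := allP gen_list_nonzero _ ug; rewrite memNE -k0 ku.
  by [].
apply: (@spanlP (fun k => k = 0%num \/ k \in o) t); first by left.
- move=> a b [->|ao] [->|bo]; rewrite ?N.lxor_0_l ?xor0; [by left|by right|by right|].
  by have [->|] := oX a b ao bo; [left; rewrite xorn | right].
- by move=> k' kt; right; apply: to.
by apply: mem_behead.
Qed.

Lemma coversE m chosen : covers m chosen =
  if [seq p <- singular | ~~ covered p chosen] is p :: _ then
    if m is m'.+1 then
      flatten [seq covers m' (u :: chosen)
        | u <- gen_list & memN p u && all (fun c => ~~ meetN u c) chosen]
    else [:: [::]]
  else [:: chosen].
Proof. by case: m. Qed.

Lemma covered_spread S chosen : cspread Qd S ->
  {in chosen, forall c, {subset c <= codes} /\ dset d c \in S} ->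
  [seq p <- singular | ~~ covered p chosen] = [::] -> S = dsets d chosen.
Proof.
move=> [pS gS] hch E; have /and3P[/eqP cS _ _] := pS.
apply/setP=> U; apply/idP/dsetsP => [US|[c cc ->]]; last by have [] := hch c cc.
have [_ cU] := gS _ US; have /card_gt0P[x xU] : (0 < #|U|)%N by rewrite cU.
have : x \in Qd by rewrite -cS; apply/bigcupP; exists U.
rewrite dQ => /dsetP[k ks xE].
have : k \notin [seq p <- singular | ~~ covered p chosen] by rewrite E.
rewrite mem_filter ks andbT negbK => /hasP[c cc]; rewrite memNE => kc; exists c => //.
by apply: (partition_eq pS US (proj2 (hch c cc)) xU); rewrite xE mem_dset_map.
Qed.

(** S itself dictates a branch of the search: the first uncovered point is on a member of S, which
    is disjoint from the chosen members and therefore in [gen_list]. The alternative [nilp fam] is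
    the case of exhausted fuel. *)
Lemma coversP S m chosen : cspread Qd S -> high_block \in chosen ->
  {in chosen, forall c, {subset c <= codes} /\ dset d c \in S} ->
  exists2 fam, fam \in covers m chosen & nilp fam \/ S = dsets d fam.
Proof.
move=> SS; have [pS gS] := SS; have /and3P[/eqP cS _ _] := pS.
elim: m chosen => [|m IH] chosen hc hch; rewrite coversE;
  case E : [seq p <- singular | ~~ covered p chosen] => [|p rest];
  try by exists [::]; [rewrite mem_head | left].
all: try by exists chosen; [rewrite mem_head | right; apply: covered_spread].
have : p \in [seq p <- singular | ~~ covered p chosen] by rewrite E mem_head.
rewrite mem_filter => /andP[pnc ps]; have pc := singular_codes ps.
have : d p \in cover S by rewrite cS dQ mem_dset_map.
case/bigcupP => U US pU.
have nU c : c \in chosen -> U != dset d c.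
  move=> cc; apply: contra pnc => /eqP UE; apply/hasP; exists c => //.
  by rewrite memNE -(mem_dset dP (proj1 (hch c cc)) pc) -UE.
have [sU cU] := gS _ US.
have UQ : U \subset Qd by rewrite -cS; apply: bigcup_sup.
have [|u ug UE] := generator_in_list sU UQ cU.
  have /and3P[_ tS _] := pS; apply: (trivIsetP tS) => //; last exact: nU.
  by have [] := hch _ hc.
have /andP[_ /subNP uc] := allP gen_list_uniq _ ug.
have [||fam] := IH (u :: chosen); first by rewrite inE hc orbT.
- move=> c; rewrite inE => /predU1P[->|]; last exact: hch.
  by rewrite -UE.
move=> famc famS; exists fam => //; apply/flattenP; exists (covers m (u :: chosen)) => //.
apply/mapP; exists u => //; rewrite mem_filter ug andbT memNE -(mem_dset dP uc pc) -UE pU /=.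
apply/allP => c cc; apply/hasP => -[k ku]; rewrite memNE => kc.
case/negP: (nU c cc); apply/eqP.
apply: (partition_eq pS US (proj2 (hch c cc))) (mem_dset_map d kc).
by rewrite UE mem_dset_map.
Qed.

(** The search ends with eight spreads, and the map of [spread_maps] that produces the one found is
    the required change of coordinates; it leaves the blocks in place. *)
Lemma spread_frame S : cspread Qd S -> dset d low_block \in S ->
  dset d high_block \in S ->
  exists d', gframe Qd S (dset d low_block) (dset d high_block) d'.
Proof.
move=> cS lS hS.
have [|c|fam famc famS] := @coversP S 7 [:: low_block; high_block] cS.
- by rewrite !inE eqxx orbT.
- rewrite !inE => /orP[] /eqP ->; split=> //; [exact: low_codes|exact: high_codes].
have := allP covers_nonempty _ famc; case: famS => [-> //|SE _].
have /hasP[m _ /and3P[im /andP[ml mh] mf]] := allP covers_std _ famc.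
exists (d \o lin m); split; rewrite ?(dset_fixed d ml) ?(dset_fixed d mh) //.
- by case/andP: im => mok _; apply: decoder_lin.
- exact: isometry_singular im.
by rewrite SE dsets_lin; symmetry; apply: eq_dsets.
Qed.

(* A partial ovoid of size 9 meets all nine members of the spread, once each. *)
Lemma ovoid_frame O : O \subset Qd -> #|O| = 9%N ->
  {in O &, forall x y, x + y \notin Qd} -> d 1%num \in O -> d 16%num \in O ->
  exists m, [/\ m \in ovoid_maps, isometry_code m, fixes_blocks m, lin m 17 = 17%num
              & O = dset (d \o lin m) root].
Proof.
move=> OQ cO OD O1 O16; pose o := decode d O.
have Oo : dset d o = O by apply: dset_decode_sub; apply: sub_Qd_codes.
have oc : {subset o <= codes} := @sub_decode _ _ _.
have oO k : k \in o -> d k \in O by rewrite mem_decode => /andP[].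
have osing k : k \in o -> k \in singular.
  by move=> ko; rewrite -mem_Qd ?oc // (subsetP OQ) ?oO.
have os : size o = 9%N by rewrite (size_decode dP) ?sub_Qd_codes.
have oX a b : a \in o -> b \in o -> ~~ memN (xor a b) singular.
  by move=> ao bo; rewrite memNE -mem_Qd ?xor_codes ?oc // (decD dP) OD ?oO.
(* The index of the member through k. Two points of O in one member have a zero or singular sum, and
   [oX] leaves only zero; so the nine indices are distinct and exhaust the members. *)
pose bi k := find (memN k) std_spread.
have bi_has k : k \in o -> has (memN k) std_spread.
  by move=> /osing; apply: (allP std_spread_cover).
have bi_uniq : uniq (map bi o).
  rewrite map_inj_in_uniq ?decode_uniq // => a b ao bo ab.
  have ha := nth_find [::] (bi_has a ao); have hb := nth_find [::] (bi_has b bo).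
  have hi : nth [::] std_spread (bi a) \in std_spread.
    by rewrite mem_nth // -has_find bi_has.
  rewrite -/(bi b) -ab in hb; rewrite -/(bi a) in ha.
  have /allP/(_ a) := allP std_spread_xor _ hi; rewrite -memNE => /(_ ha)/allP/(_ b).
  rewrite -memNE => /(_ hb); rewrite (negPf (oX _ _ ao bo)) orbF.
  by move=> /N.eqb_eq/xor_eq0.
have bi_all : map bi o =i iota 0 9.
  have sub : {subset map bi o <= iota 0 9}.
    by move=> _ /mapP[k ko ->]; rewrite mem_iota /= add0n -[9%N]/(size std_spread) -has_find bi_has.
  by have [] := uniq_min_size bi_uniq sub; rewrite size_map os.
have o1 : 1%num \in o by rewrite mem_decode O1.
have o16 : 16%num \in o by rewrite mem_decode O16.
have [|//|B|t] := @transversalsP (fun p a => ~~ memN (xor p a) singular) o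
    ([:: 1] :: [:: 16] :: drop 2 std_spread)%num [::].
- by move=> a b; apply: oX.
- rewrite 2!in_cons => /or3P[/eqP->|/eqP->|/mem_drop Bs].
  + by apply/hasP; exists 1%num.
  + by apply/hasP; exists 16%num.
  have : index B std_spread \in map bi o by rewrite bi_all mem_iota /= -index_mem in Bs *.
  case/mapP => k ko ik; apply/hasP; exists k => //.
  by have := nth_find [::] (bi_has k ko); rewrite -/(bi k) -ik nth_index.
move=> tt to; have /andP[/andP[tu /eqP ts] /hasP[m mO]] := allP transversals_std _ tt.
case/and4P=> im fm /N.eqb_eq m17 mr; exists m; split=> //.
rewrite dset_lin (eq_dset d (eqsetNP mr)); apply/eqP; rewrite eq_sym eqEcard cO.
rewrite (card_dset dP) ?ts ?leqnn ?andbT //; last by move=> k /to/oc.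
by apply/subsetP=> x /dsetP[k /to ko ->]; apply: oO.
Qed.

End Decoded.
End Frames.

(** * The table of the two actions of degree 120 *)

Section Closure.
Variables (G : eqType) (T : eqType) (key : T -> N) (act : G -> T -> T) (gens : seq G).

(* Breadth-first search; elements are told apart by their keys only. *)
Fixpoint closure (n : nat) (visited todo : seq T) : seq T :=
  if todo is x :: todo' then
    if n is n'.+1 then
      let visited' := x :: visited in
      closure n' visited'
        (foldl (fun acc g =>
           if memN (key (act g x)) (map key visited' ++ map key acc) then acc
           else rcons acc (act g x)) todo' gens)
    else visited
  else visited.

(** Only soundness of the search is proved. That it reaches every element wanted is confirmed by
    evaluation where it is used. *)
Lemma closure_ind (P : T -> Prop) n visited todo :
  {in gens, forall g x, P x -> P (act g x)} ->
  {in visited, forall x, P x} -> {in todo, forall x, P x} ->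
  {in closure n visited todo, forall x, P x}.
Proof.
move=> PG; elim: n visited todo => [|n IH] visited [|x todo] Pv Pt //=.
have Px : P x by apply: Pt; rewrite mem_head.
have Pv' : {in x :: visited, forall y, P y}.
  by move=> y; rewrite inE => /predU1P[->|/Pv].
apply: IH => //; have {}Pt : {in todo, forall y, P y}.
  by move=> y yt; apply: Pt; rewrite inE yt orbT.
elim: gens PG todo Pt => //= g gs IHg PG todo Pt; apply: IHg.
  by move=> h hgs; apply: PG; rewrite inE hgs orbT.
case: ifP => // _ y; rewrite mem_rcons inE => /predU1P[->|/Pt //].
by apply: PG; rewrite ?mem_head.
Qed.

End Closure.

Definition rot7 : seq N := [:: 1; 4; 8; 6; 16; 96; 128; 32]%num.
Definition rot6 : seq N := [:: 16; 32; 64; 192; 1; 2; 12; 8]%num.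
Definition swap_spread : seq N := [:: 32; 80; 160; 64; 10; 1; 8; 5]%num.
Definition swap_ovoid : seq N := [:: 16; 40; 4; 8; 1; 10; 64; 170]%num.

(* [rot7] and [rot6] generate the common stabiliser of std_spread and root, of
   order 42; the third pair consists of a transposition of the seven further
   members of std_spread, and the same transposition of the points of root. *)
Definition gen_pairs : seq (seq N * seq N) :=
  [:: (rot7, rot7); (rot6, rot6); (swap_spread, swap_ovoid)].

Definition entry : Type := N * (seq N * seq (seq N)).

(** The first matrix moves the point and its ovoid, the second one the spread, since these are acted
    on by two different groups. The spread is stored by bases; [spread_sets] recovers its points. *)
Definition act_entry (gh : seq N * seq N) (e : entry) : entry :=
  (lin gh.1 e.1, (map (lin gh.1) e.2.1, map (map (lin gh.2)) e.2.2)).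

Definition spread_bases : seq (seq N) :=
  [:: [:: 8; 4; 2; 1]; [:: 128; 64; 32; 16];
    [:: 18; 33; 72; 132]; [:: 20; 40; 97; 146]; [:: 120; 130; 148; 193];
    [:: 24; 52; 82; 225]; [:: 66; 88; 129; 164]; [:: 36; 56; 161; 210];
    [:: 65; 104; 180; 194]]%num.

Definition entry0 : entry := (17%num, (root, spread_bases)).

(* Over the nonsingular code c: the ovoid and the spread corresponding to it. *)
Definition table : seq entry := Eval vm_compute in
  closure fst act_entry gen_pairs 200 [::] [:: entry0].

Definition lookup (c : N) : seq N * seq (seq N) :=
  (nth entry0 table (find (fun e : entry => N.eqb c e.1) table)).2.

Definition ovoid_code (c : N) : seq N := (lookup c).1.
Definition spread_code (c : N) : seq (seq N) := (lookup c).2.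

Lemma table_ind (P : entry -> Prop) : P entry0 ->
  {in gen_pairs, forall gh e, P e -> P (act_entry gh e)} -> {in table, forall e, P e}.
Proof.
move=> P0 PG; have -> : table = closure fst act_entry gen_pairs 200 [::] [:: entry0].
  by vm_compute.
by apply: closure_ind => // e; rewrite inE => /eqP ->.
Qed.

Lemma mem_lookup c : c \in nonsingular -> (c, lookup c) \in table.
Proof.
move=> cn; have cM : has (fun e : entry => N.eqb c e.1) table.
  have /allP h : all (fun c => has (fun e : entry => N.eqb c e.1) table) nonsingular.
    by vm_compute.
  exact: h.
have /N.eqb_eq {1}-> := nth_find entry0 cM.
by rewrite /lookup -surjective_pairing mem_nth // -has_find.
Qed.

Definition gens : seq (seq N) := [:: rot7; rot6; swap_spread].

(** The code in position i is in relation R_i with 17. *)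
Definition reps : seq N := [:: 17; 34; 19; 53; 38; 39; 35]%num.

Lemma nonsingular_ind (P : N -> Prop) : P 17%num ->
  {in gens, forall g c, P c -> P (lin g c)} -> {in nonsingular, forall c, P c}.
Proof.
move=> P0 PG c /mem_lookup; apply: (@table_ind (fun e => P e.1)) => //.
move=> [g h] gh e; apply: PG.
by move: gh; rewrite !inE => /or3P[] /eqP[-> _]; rewrite eqxx ?orbT.
Qed.

Lemma nonsingular_stab (P : N -> Prop) : {in reps, forall c, P c} ->
  {in [:: rot7; rot6], forall g c, P c -> P (lin g c)} -> {in nonsingular, forall c, P c}.
Proof.
move=> P0 PG c cn.
have : c \in closure id lin [:: rot7; rot6] 200 [::] reps.
  by apply: subNP cn; vm_compute.
exact: closure_ind.
Qed.

Lemma gens_nonsingular : all (fun g => subN (map (lin g) nonsingular) nonsingular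
  && subN nonsingular (map (lin g) nonsingular)) gens.
Proof. by vm_compute. Qed.

(* The group generated by gens is transitive, and reps represents the orbits of
   the stabiliser of 17. *)
Lemma nonsingular_ind2 (P : N -> N -> Prop) : {in reps, forall c, P 17%num c} ->
  {in gens, forall g a b, P a b -> P (lin g a) (lin g b)} ->
  {in nonsingular &, forall a b, P a b}.
Proof.
move=> P0 PG; suff : {in nonsingular, forall a, {in nonsingular, forall b, P a b}}.
  by move=> h a b an bn; apply: h.
apply: nonsingular_ind => [|g gG a Pa b bn].
  apply: nonsingular_stab P0 _ => g gG c Pc.
  have -> : 17%num = lin g 17 by move: gG; rewrite !inE => /orP[] /eqP ->.
  by apply: PG Pc; move: gG; rewrite !inE => /orP[] ->; rewrite ?orbT.
have /andP[_ /subNP/(_ b bn)/mapP[b' b'n ->]] := allP gens_nonsingular _ gG.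
by apply: PG gG _ _ _; apply: Pa.
Qed.

(** Membership in [G*], written in the coordinates of a frame. *)
Definition frame_code (g : seq N) : bool :=
  [&& isometry_code g, eqfamN (map (map (lin g)) std_spread) std_spread
    & fixes_blocks g || (eqsetN (map (lin g) low_block) high_block
                         && eqsetN (map (lin g) high_block) low_block)].

Lemma gens_frame : all frame_code gens. Proof. by vm_compute. Qed.

Lemma table_ovoid : all (fun e : entry =>
  subN e.2.1 singular && uniq e.2.1 && (size e.2.1 == 9%N)) table.
Proof. by vm_compute. Qed.

(** Keeps the ovoid with the point, so that checks over many pairs consult the table once for each
    point. *)
Definition pointed (c : N) : N * seq N := (c, ovoid_code c).

(** The value 7 means that none of the relations R_0, ..., R_6 holds. *)
Definition rel_index (p r : N * seq N) : nat :=
  (if N.eqb p.1 r.1 then 0 else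
  let common := [seq x <- p.2 | memN x r.2] in
  let m := count (fun x => ~~ bform x r.1) p.2 in
  if bform p.1 r.1 then
    if common is [::] then (if eqn m 3 then 5 else if eqn m 7 then 6 else 7) else 7
  else if common is [:: z] then
    if memN z low_block || memN z high_block then (if eqn m 3 then 2 else 7)
    else if eqn m 7 then 4
    else if eqn m 3 then (if memN (xor p.1 r.1) p.2 then 1 else 3) else 7
  else 7)%N.

Definition rel_code (a b : N) : nat := rel_index (pointed a) (pointed b).

Lemma rel_codeE a b : rel_code a b =
  (if N.eqb a b then 0 else
  let common := [seq x <- ovoid_code a | memN x (ovoid_code b)] in
  let m := count (fun x => ~~ bform x b) (ovoid_code a) in
  if bform a b then
    if common is [::] then (if eqn m 3 then 5 else if eqn m 7 then 6 else 7) else 7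
  else if common is [:: z] then
    if memN z low_block || memN z high_block then (if eqn m 3 then 2 else 7)
    else if eqn m 7 then 4
    else if eqn m 3 then (if memN (xor a b) (ovoid_code a) then 1 else 3) else 7
  else 7)%N.
Proof. by []. Qed.

(** Both orders of each pair are evaluated: their agreement is the symmetry of the orbitals. *)
Lemma rel_code_reps :
  all (fun i => (rel_code 17 (nth 0%num reps i) == i) && (rel_code (nth 0%num reps i) 17 == i))
    (iota 0 7).
Proof. by vm_compute. Qed.
#[global] Opaque table gens gen_pairs reps rel_code rel_index lookup pointed.

Lemma qform0 : qform 0%num = false. Proof. by []. Qed.

Lemma gframe_lin n (Qd : {set 'rV['F_2]_n}) S A B d g : frame_code g ->
  gframe Qd S A B d -> gframe Qd S A B (d \o lin g) \/ gframe Qd S B A (d \o lin g).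
Proof.
move=> /and3P[ig Sg bg] [dP dQ dS dA dB]; have dgP : decoder (d \o lin g).
  by apply: decoder_lin => //; case/andP: ig.
have dgQ := isometry_singular dP dQ ig.
have dgS : S = dsets (d \o lin g) std_spread.
  by rewrite dS dsets_lin; symmetry; apply: eq_dsets.
case/orP: bg => /andP[lg hg]; [left|right]; split=> //.
- by rewrite dset_fixed.
- by rewrite dset_fixed.
- by rewrite dset_lin dB; apply: eq_dset => k; rewrite (eqsetNP lg).
- by rewrite dset_lin dA; apply: eq_dset => k; rewrite (eqsetNP hg).
Qed.

(** * The group [G*] and its action on frames *)

Section Group.
Variable f : 'rV['F_2]_8 -> 'F_2.
Local Notation V := 'rV['F_2]_8.
Hypotheses (hf : quadratic_form f) (hnd : nondegenerate_form f).
Variables (S : {set {set V}}) (Sg1 Sg2 : {set V}).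
Local Notation G := (Gstar f S Sg1 Sg2).

(** A function with values in F_2 is determined by its zeros, so coordinates standard for the
    quadric are standard for the form. *)
Lemma form_decoder (d : N -> V) : decoder d -> quadric f = dset d singular ->
  {in codes, forall k, f (d k) = (qform k)%:R}.
Proof.
move=> dP dQ k kc; have := mem_Qd dP dQ kc; rewrite singularE kc inE /=.
case: (eqVneq k 0%num) => [->|k0]; first by rewrite (dec0 dP) form0 // qform0.
have -> : d k != 0 by apply: contra k0 => /eqP/(dec_eq0 dP kc) ->.
by case: (F2_cases (f (d k))) => ->; case: (qform k) => //=; rewrite ?eqxx ?oner_eq0.
Qed.

Lemma anisotropic_dset (d : N -> V) : decoder d -> quadric f = dset d singular ->
  anisotropic f = dset d nonsingular.
Proof.
move=> dP dQ; apply/setP => x; have : x \in dset d codes by rewrite decoder_surj ?inE.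
case/dsetP => k kc ->; rewrite (mem_dset dP nonsingular_codes kc).
rewrite nonsingularE kc inE (form_decoder dP dQ kc) /=.
have [->|k0] := eqVneq k 0%num; first by rewrite (dec0 dP) qform0 eqxx.
have -> : d k != 0 by apply: contra k0 => /eqP/(dec_eq0 dP kc) ->.
by case: (qform k); rewrite ?eqxx ?oner_eq0.
Qed.

(** Both orders are allowed because elements of [G*] may exchange the two members. *)
Definition frame (d : N -> V) : Prop :=
  gframe (quadric f) S Sg1 Sg2 d \/ gframe (quadric f) S Sg2 Sg1 d.

Lemma frame_decoder d : frame d -> decoder d.
Proof. by case=> -[]. Qed.

Lemma frame_quadric d : frame d -> quadric f = dset d singular.
Proof. by case=> -[]. Qed.

Lemma frame_spread d : frame d -> S = dsets d std_spread.
Proof. by case=> -[]. Qed.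

Lemma gframe_blocks d A B : gframe (quadric f) S A B d ->
  [set A; B] = [set dset d low_block; dset d high_block].
Proof. by case=> _ _ _ -> ->. Qed.

Lemma frame_blocks d : frame d ->
  [set Sg1; Sg2] = [set dset d low_block; dset d high_block].
Proof. by case=> /gframe_blocks // <-; apply: setUC. Qed.

Lemma frame_lin d g : frame_code g -> frame d -> frame (d \o lin g).
Proof. by move=> gF [] /(gframe_lin gF) []; [left|right|right|left]. Qed.

(** The scale factor in [PGO] is a nonzero element of F_2, hence 1, and similarities are
    isometries. *)
Lemma GstarP (s : {perm V}) : reflect
  [/\ exists g : 'M['F_2]_8, forall x, s x = x *m g, forall x, f (s x) = f x,
      forall U : {set V}, (s @: U \in [set Sg1; Sg2]) = (U \in [set Sg1; Sg2])
    & forall U : {set V}, (s @: U \in S :\: [set Sg1; Sg2]) = (U \in S :\: [set Sg1; Sg2])]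
  (s \in G).
Proof.
have actE (U : {set V}) : 'P^*%act U s = s @: U by apply: eq_imset => x.
rewrite /Gstar in_setI in_setI [s \in PGO f]inE -!andbA.
apply: (iffP and4P) => [[/existsP[g /forallP gs] /existsP[c /andP[c0 /forallP fc]]]|].
  move=> /astabsP s1 /astabsP s2; split.
  - by exists g => x; apply/eqP.
  - move=> x; rewrite (eqP (fc x)); case: (F2_cases c) c0 => -> //.
    by rewrite mul1r.
  - by move=> U; rewrite -actE s1.
  by move=> U; rewrite -actE s2.
move=> [[g gs] fs s1 s2]; split.
- by apply/existsP; exists g; apply/forallP => x; rewrite gs.
- by apply/existsP; exists 1; rewrite oner_neq0; apply/forallP => x; rewrite fs mul1r.
- by apply/astabsP => U; rewrite actE s1.
by apply/astabsP => U; rewrite actE s2.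
Qed.

Lemma Gstar_add (s : {perm V}) : s \in G -> {morph s : x y / x + y}.
Proof. by case/GstarP=> -[g gs] _ _ _ x y; rewrite !gs mulmxDl. Qed.

Lemma dset_perm (s : {perm V}) d l : dset (s \o d) l = s @: dset d l.
Proof.
apply/setP=> x; apply/dsetP/imsetP => [[k kl ->]|[_ /dsetP[k kl ->] ->]].
  by exists (d k); rewrite // mem_dset_map.
by exists k.
Qed.

Hypotheses (hSg1 : Sg1 \in S) (hSg2 : Sg2 \in S).

Lemma Gstar_spread (s : {perm V}) (U : {set V}) : s \in G -> (s @: U \in S) = (U \in S).
Proof.
case/GstarP=> _ _ /(_ U) + /(_ U); rewrite !in_setD.
case: (boolP (U \in [set Sg1; Sg2])) => h h' /=; last by rewrite h'.
move=> _; have -> : U \in S by case/set2P: h => ->.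
by case/set2P: h' => ->.
Qed.

Lemma frame_act (s : {perm V}) d : s \in G -> frame d -> frame (s \o d).
Proof.
move=> sG; have sD := Gstar_add sG; have [_ fs sB _] := GstarP _ sG.
have s0 : s 0 = 0 by rewrite -[in LHS](addrr2 0) sD addrr2.
have sQ : s @: quadric f = quadric f.
  apply/eqP; rewrite eqEcard card_imset ?leqnn ?andbT; last exact: perm_inj.
  apply/subsetP => _ /imsetP[x + ->]; rewrite !inE fs => /andP[x0 ->]; rewrite andbT.
  by apply: contra x0 => /eqP h; apply/eqP/(@perm_inj _ s); rewrite s0.
have sS : [set s @: (U : {set V}) | U in S] = S.
  apply/eqP; rewrite eqEcard card_imset ?leqnn ?andbT; last first.
    exact/imset_inj/perm_inj.
  by apply/subsetP => _ /imsetP[U US ->]; rewrite Gstar_spread.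
have E (A B : {set V}) : [set A; B] = [set Sg1; Sg2] -> gframe (quadric f) S A B d ->
    gframe (quadric f) S A B (s \o d) \/ gframe (quadric f) S B A (s \o d).
  move=> AB [dP dQ dS dA dB].
  have dsP : decoder (s \o d).
    split=> [a b|k kc] /=; first by rewrite (decD dP) sD.
    by move=> h; apply: (dec_eq0 dP) => //; apply: (@perm_inj _ s); rewrite s0.
  have dsQ : quadric f = dset (s \o d) singular by rewrite dset_perm -dQ sQ.
  have dsS : S = dsets (s \o d) std_spread.
    rewrite -{1}sS dS; apply/setP => U; apply/imsetP/dsetsP => [[_ /dsetsP[u us ->] ->]|].
      by exists u; rewrite // dset_perm.
    by case=> u us ->; exists (dset d u); rewrite ?mem_dsets // dset_perm.
  have sA : s @: A \in [set A; B] by rewrite AB sB -AB !inE eqxx.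
  have sB' : s @: B \in [set A; B] by rewrite AB sB -AB !inE eqxx orbT.
  have AneB : A != B.
    rewrite dA dB; apply/eqP => /(dset_inj dP low_codes high_codes) /(_ 1%num).
    by rewrite -!memNE; vm_compute.
  have sAneB : s @: A != s @: B by apply: contra AneB => /eqP/(imset_inj (@perm_inj _ s)) ->.
  case/set2P: sA => sAE; case/set2P: sB' => sBE.
  - by rewrite sAE sBE eqxx in sAneB.
  - left; split; [exact: dsP | exact: dsQ | exact: dsS | |].
      by rewrite dset_perm -dA sAE.
    by rewrite dset_perm -dB sBE.
  - right; split; [exact: dsP | exact: dsQ | exact: dsS | |].
      by rewrite dset_perm -dA sAE.
    by rewrite dset_perm -dB sBE.
  - by rewrite sAE sBE eqxx in sAneB.
case=> fd; first exact: (E _ _ erefl fd).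
by apply/or_comm; exact: (E _ _ (setUC [set Sg2] [set Sg1]) fd).
Qed.

Definition code_of (d : N -> V) (x : V) : N := nth 0%num codes (find (fun k => d k == x) codes).

Lemma code_ofK (d : N -> V) : decoder d -> {in codes, cancel d (code_of d)}.
Proof.
move=> dP k kc; have h : has (fun j => d j == d k) codes by apply/hasP; exists k.
have /eqP := nth_find 0%num h; apply: (dec_inj dP) => //.
by rewrite mem_nth // -has_find.
Qed.

Lemma decoderP (d : N -> V) x : decoder d -> exists2 k, k \in codes & x = d k.
Proof. by move=> dP; apply/dsetP; rewrite decoder_surj ?inE. Qed.

(** The map [d'] after the inverse of [d] is linear. It preserves the form, the spread and the pair
    of members, as each of them consists of the images of the same codes in both frames. *)
Lemma frame_transitive d d' : frame d -> frame d' ->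
  exists2 s, s \in G & {in codes, forall k, s (d k) = d' k}.
Proof.
move=> dF dF'; have dP := frame_decoder dF; have dP' := frame_decoder dF'.
have sfun_inj : injective (fun x => d' (code_of d x)).
  move=> x y; have [a ac ->] := decoderP x dP; have [b bc ->] := decoderP y dP.
  by rewrite !(code_ofK dP) // => /(dec_inj dP') ->.
pose s := perm sfun_inj.
have sd : {in codes, forall k, s (d k) = d' k} by move=> k kc; rewrite permE (code_ofK dP).
have sl l : {subset l <= codes} -> s @: dset d l = dset d' l.
  move=> lc; rewrite -dset_perm; apply/setP => x.
  by apply/dsetP/dsetP => -[k kl ->]; exists k; rewrite //= sd ?lc.
have sD : {morph s : x y / x + y}.
  move=> x y; have [a ac ->] := decoderP x dP; have [b bc ->] := decoderP y dP.
  by rewrite -(decD dP) !sd ?xor_codes // (decD dP').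
have s0 : s 0 = 0 by rewrite -[in LHS](addrr2 0) sD addrr2.
have sB (U : {set V}) : (s @: U \in [set Sg1; Sg2]) = (U \in [set Sg1; Sg2]).
  rewrite (frame_blocks dF) -{1}(frame_blocks dF) (frame_blocks dF') !inE.
  rewrite -!sl ?(inj_eq (imset_inj (@perm_inj _ s))) //; [exact: high_codes|exact: low_codes].
have sS (U : {set V}) : (s @: U \in S) = (U \in S).
  rewrite {1}(frame_spread dF') (frame_spread dF).
  have sc u : u \in std_spread -> {subset u <= codes}.
    move=> us; have /andP[/andP[/subNP h _] _] := allP std_spread_ok _ us.
    by move=> k /h/singular_codes.
  apply/dsetsP/dsetsP => -[u us E]; exists u => //.
    by apply: (imset_inj (@perm_inj _ s)); rewrite E (sl u (sc u us)).
  by rewrite E (sl u (sc u us)).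
exists s => //; apply/GstarP; split=> //; last by move=> U; rewrite !in_setD sS sB.
  exists (\matrix_(i < 8) s (delta_mx 0 i)) => x.
  rewrite {1}(row_sum_delta x) mulmx_sum_row (big_morph s sD s0).
  apply: eq_bigr => i _; rewrite rowK; case: (F2_cases (x 0 i)) => ->.
    by rewrite !scale0r s0.
  by rewrite !scale1r.
move=> x; have [k kc ->] := decoderP x dP.
by rewrite sd // (form_decoder dP' (frame_quadric dF')) // (form_decoder dP (frame_quadric dF)).
Qed.

(** The frame is moved instead of the points: a generator g applied to the codes is absorbed by
    passing from [d] to [d \o lin g]. *)
Lemma frame_pair d : frame d -> {in nonsingular &, forall a b,
  exists d' r, [/\ frame d', r \in reps, d' 17%num = d a & d' r = d b]}.
Proof.
move=> dF a b an bn; move: a b an bn d dF.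
apply: nonsingular_ind2 => [r rr d dF|g gG a b ab d dF]; first by exists d, r.
exact: (ab _ (frame_lin (allP gens_frame _ gG) dF)).
Qed.

Lemma point_pair d : frame d -> {in anisotropic f &, forall x y,
  exists d' r, [/\ frame d', r \in reps, x = d' 17%num & y = d' r]}.
Proof.
move=> dF x y; rewrite (anisotropic_dset (frame_decoder dF) (frame_quadric dF)).
move=> /dsetP[a an ->] /dsetP[b bn ->].
have [d' [r [dF' rr e1 e2]]] := frame_pair dF an bn.
by exists d', r; rewrite e1 e2.
Qed.

Hypotheses (hhyp : hyperbolic_form f) (hS : spread (quadric f) S) (hSg : Sg1 != Sg2).

Lemma spread_cspread : cspread (quadric f) S.
Proof.
have /andP[/forallP gS pS] := hS; split=> // U US.
have gU : quadric_generator (quadric f) U by move/implyP: (gS U); apply.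
split; last exact: (generator_card hf hnd hhyp gU).
by have /maxsetP[/andP[sU _] _] := gU; exact: sU.
Qed.

Lemma frame_exists : exists d, frame d.
Proof.
have [pS gS] := spread_cspread; have [s1 c1] := gS _ hSg1; have [s2 c2] := gS _ hSg2.
have /and3P[/eqP cS tS _] := pS.
have q1 : Sg1 \subset quadric f by rewrite -cS bigcup_sup.
have q2 : Sg2 \subset quadric f by rewrite -cS bigcup_sup.
have dis : [disjoint Sg1 & Sg2] by apply: (trivIsetP tS).
have [d [dP dQ d1 d2]] := pair_frame hf hnd s1 s2 q1 q2 c1 c2 dis.
have [||d' d'P] := spread_frame dP dQ spread_cspread; rewrite -?d1 -?d2 //.
by exists d'; left; move: d'P; rewrite -d1 -d2.
Qed.

End Group.

(** * The ovoids of the orbit Y in a frame *)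

Lemma low_high_sum : all (fun a => all (fun b => [&& memN (xor a b) codes, ~~ N.eqb (xor a b) 0
    & N.eqb (xor a b) 17 ==> (N.eqb a 1 && N.eqb b 16)]) high_block) low_block.
Proof. by vm_compute. Qed.

(** [rot7] has order 7 and fixes 1 and 16, so it permutes the eight ovoids through them; [root] is
    its only fixed one. *)
Lemma rot7_ovoids : all (fun m =>
    eqsetN (map (lin rot7) (map (lin m) root)) (map (lin m) root)
    ==> eqsetN (map (lin m) root) root) ovoid_maps.
Proof. by vm_compute. Qed.

Lemma rot7_frame : frame_code rot7. Proof. by vm_compute. Qed.

Lemma root_codes : {subset root <= codes}. Proof. by apply: subNP; vm_compute. Qed.

Lemma one_low : 1%num \in low_block. Proof. by rewrite -memNE; vm_compute. Qed.
Lemma sixteen_high : 16%num \in high_block. Proof. by rewrite -memNE; vm_compute. Qed.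
Lemma nonsingular17 : 17%num \in nonsingular. Proof. by rewrite -memNE; vm_compute. Qed.
Lemma reps_nonsingular : {subset reps <= nonsingular}. Proof. by apply: subNP; vm_compute. Qed.

Section Ovoids.
Variable f : 'rV['F_2]_8 -> 'F_2.
Local Notation V := 'rV['F_2]_8.
Hypotheses (hf : quadratic_form f) (hnd : nondegenerate_form f) (hhyp : hyperbolic_form f).
Variables (S : {set {set V}}) (Sg1 Sg2 : {set V}).
Local Notation G := (Gstar f S Sg1 Sg2).
Hypotheses (hS : spread (quadric f) S).
Hypotheses (hSg1 : Sg1 \in S) (hSg2 : Sg2 \in S) (hSg : Sg1 != Sg2).

Lemma eqEcard_T (T : finType) (A B : {set T}) : A \subset B -> #|A| = #|B| -> A = B.
Proof. by move=> AB c; apply/eqP; rewrite eqEcard AB c leqnn. Qed.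

Lemma card_quadric : #|quadric f| = 135%N.
Proof.
have [d dF] := frame_exists hf hnd hSg1 hSg2 hhyp hS hSg.
rewrite (frame_quadric dF) (card_dset (frame_decoder dF) singular_codes singular_uniq).
by vm_compute.
Qed.

Lemma card_anisotropic : #|anisotropic f| = 120%N.
Proof.
have [d dF] := frame_exists hf hnd hSg1 hSg2 hhyp hS hSg.
rewrite (anisotropic_dset hf (frame_decoder dF) (frame_quadric dF)).
rewrite (card_dset (frame_decoder dF) nonsingular_codes); first by vm_compute.
by vm_compute.
Qed.

(** The spread S cuts the 135 points of the quadric into 9 generators of 15 points, and O has one
    point in each of them. *)
Lemma ovoid_card O : ovoid (quadric f) O -> #|O| = 9%N.
Proof.
case/andP=> OQ /forallP Og; have [pS gS] := spread_cspread hf hnd hhyp hS.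
have cS : #|S| = 9%N.
  have := card_uniform_partition (fun U US => proj2 (gS U US)) pS.
  by rewrite card_quadric => /eqP; rewrite -[135%N]/(9 * 15)%N eqn_pmul2r // => /eqP <-.
have /and3P[/eqP covS tS _] := pS.
have -> : #|O| = (\sum_(x in cover S | x \in O) 1)%N.
  rewrite -sum1_card; apply: eq_bigl => x; rewrite covS andbC.
  by case: (boolP (x \in O)) => //= /(subsetP OQ) ->.
rewrite big_trivIset_cond // -cS -sum1_card; apply: eq_bigr => U US.
have gU : quadric_generator (quadric f) U.
  by have /andP[/forallP h _] := hS; move/implyP: (h U); apply.
have /implyP/(_ gU)/eqP c1 := Og U; rewrite -[RHS]c1 -sum1_card.
by apply: eq_bigl => x; rewrite inE andbC.
Qed.

(** If x + y were singular, the line of x and y would lie in the quadric, hence in a generator,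
    which would meet O twice. *)
Lemma ovoid_nonperp O : ovoid (quadric f) O -> {in O &, forall x y, x + y \notin quadric f}.
Proof.
case/andP=> OQ /forallP Og x y xO yO; apply/negP => xyQ.
have x0 : x != 0 by have := subsetP OQ _ xO; rewrite inE => /andP[].
have y0 : y != 0 by have := subsetP OQ _ yO; rewrite inE => /andP[].
have xy : x != y.
  by apply: contraTneq xyQ => ->; rewrite addrr2 inE eqxx.
have lP : psubspace [set x; y; x + y] && ([set x; y; x + y] \subset quadric f).
  rewrite psubspace_line //=; apply/subsetP => z; rewrite !inE -orbA.
  by case/or3P => /eqP ->; [have := subsetP OQ _ xO|have := subsetP OQ _ yO|have := xyQ];
     rewrite inE.
have [W gW /subsetP lW] :=
  @maxset_exists _ (fun W => psubspace W && (W \subset quadric f)) _ lP.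
have /implyP/(_ gW)/cards1P[z /setP Wz] := Og W.
have : x \in O :&: W by rewrite inE xO lW // !inE eqxx.
have : y \in O :&: W by rewrite inE yO lW // !inE eqxx orbT.
by rewrite !Wz !inE => /eqP yz /eqP xz; rewrite xz yz eqxx in xy.
Qed.

(** Follows from being an ovoid but refers to the members of S in place of all generators. This is
    directly seen to be invariant under [G*] and is what [ovoid_frame] and [base_point] work
    with. *)
Definition partial_ovoid (O : {set V}) : Prop :=
  [/\ O \subset quadric f, #|O| = 9%N, {in O &, forall x y, x + y \notin quadric f}
    & {in S, forall U, #|O :&: U| = 1%N}].

Lemma ovoid_partial O : ovoid (quadric f) O -> partial_ovoid O.
Proof.
move=> Oo; split; [by case/andP: Oo | exact: ovoid_card | exact: ovoid_nonperp |].
case/andP: Oo => _ /forallP Og U US; have /andP[/forallP gS _] := hS.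
have gU : quadric_generator (quadric f) U by move/implyP: (gS U); apply.
by have /implyP/(_ gU)/eqP := Og U.
Qed.

Lemma Gstar1 : (1%g : {perm V}) \in G.
Proof.
apply/GstarP; split=> [|x|U|U]; rewrite ?perm1 //.
- by exists 1%:M => x; rewrite perm1 mulmx1.
- by rewrite (_ : _ @: U = U) // -[RHS]imset_id; apply: eq_imset => x; rewrite perm1.
by rewrite (_ : _ @: U = U) // -[RHS]imset_id; apply: eq_imset => x; rewrite perm1.
Qed.

Lemma imset_permM (s t : {perm V}) (U : {set V}) : (s * t)%g @: U = t @: (s @: U).
Proof. by rewrite -imset_comp; apply: eq_imset => x; rewrite permM. Qed.

Lemma GstarM (s t : {perm V}) : s \in G -> t \in G -> (s * t)%g \in G.
Proof.
move=> /GstarP[[g gs] fs s1 s2] /GstarP[[h ht] ft t1 t2].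
apply/GstarP; split=> [|x|U|U]; rewrite ?imset_permM.
- by exists (g *m h) => x; rewrite permM ht gs mulmxA.
- by rewrite permM ft fs.
- by rewrite t1 s1.
by rewrite t2 s2.
Qed.

Lemma Gstar_group_set : group_set G.
Proof. by apply/group_setP; split=> [|s t]; [apply: Gstar1 | apply: GstarM]. Qed.

Local Notation B := (Sg1 :|: Sg2).

Lemma frame_union d : frame f S Sg1 Sg2 d -> B = dset d low_block :|: dset d high_block.
Proof. by case=> -[_ _ _ -> ->] //; apply: setUC. Qed.

Lemma Gstar_union (s : {perm V}) : s \in G -> s @: B = B.
Proof.
move=> sG; have [d dF] := frame_exists hf hnd hSg1 hSg2 hhyp hS hSg.
rewrite {2}(frame_union (frame_act hSg1 hSg2 sG dF)) (frame_union dF) imsetU.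
by rewrite !dset_perm.
Qed.

(* The anisotropic point on the line through the points of O in Sg1 and Sg2. *)
Definition base_point (O : {set V}) : V := \sum_(x in O :&: B) x.

Lemma base_point_act (s : {perm V}) (O : {set V}) : s \in G -> base_point (s @: O) = s (base_point O).
Proof.
move=> sG; have sD := Gstar_add sG.
have s0 : s 0 = 0 by rewrite -[in LHS](addrr2 0) sD addrr2.
rewrite /base_point -{1}(Gstar_union sG) -imsetI; last by move=> x y _ _; apply: perm_inj.
rewrite big_imset /=; last by move=> x y _ _; apply: perm_inj.
by rewrite (big_morph s sD s0).
Qed.

Lemma ovoid_blocks O d : partial_ovoid O -> frame f S Sg1 Sg2 d ->
  exists a b, [/\ a \in low_block, b \in high_block, d a \in O & d b \in O] /\
    [/\ O :&: B = [set d a; d b], base_point O = d (xor a b) & xor a b \in nonsingular].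
Proof.
move=> Oo dF; have dP := frame_decoder dF; have dQ := frame_quadric dF.
have [OQ cO ON Og] := Oo.
have blk u : u \in std_spread -> exists2 a, a \in u & O :&: dset d u = [set d a].
  move=> us; have uS : dset d u \in S by rewrite (frame_spread dF) mem_dsets.
  have /eqP/cards1P[x xE] := Og _ uS.
  have : x \in O :&: dset d u by rewrite xE inE.
  by rewrite inE => /andP[_ /dsetP[a au xa]]; exists a => //; rewrite xE xa.
have [a al aE] := blk _ std_spread_low; have [b bh bE] := blk _ std_spread_high.
have aO : d a \in O.
  by have : d a \in [set d a] := set11 _; rewrite -aE inE => /andP[].
have bO : d b \in O.
  by have : d b \in [set d b] := set11 _; rewrite -bE inE => /andP[].
have /and3P[xc x0 _] := allP (allP low_high_sum _ al) _ bh; rewrite memNE in xc.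
have OB : O :&: B = [set d a; d b] by rewrite (frame_union dF) setIUr aE bE.
exists a, b; split=> //; split=> //.
  rewrite /base_point OB big_setU1 ?big_set1 ?(decD dP) //= inE.
  apply: contra x0 => /eqP /(dec_inj dP) ab; apply/N.eqb_eq.
  by rewrite ab ?xorn //; [exact: low_codes|exact: high_codes].
rewrite nonsingularE xc /=; apply: contraR (ON _ _ aO bO) => nq.
by rewrite -(decD dP) (mem_Qd dP dQ xc) singularE xc nq andbT; apply: contra x0 => /eqP ->.
Qed.

Lemma base_point17 O d : partial_ovoid O -> frame f S Sg1 Sg2 d ->
  base_point O = d 17%num -> d 1%num \in O /\ d 16%num \in O.
Proof.
move=> Oo dF; have [a [b [[al bh aO bO] [_ -> xn]]]] := ovoid_blocks Oo dF.
move/(dec_inj (frame_decoder dF)) => ab.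
have /and3P[_ _ /implyP h] := allP (allP low_high_sum _ al) _ bh.
have /andP[/N.eqb_eq a1 /N.eqb_eq b16] : N.eqb a 1 && N.eqb b 16.
  by apply: h; rewrite ab //; apply: nonsingular_codes => //; apply: nonsingular17.
by rewrite -{1}a1 -b16.
Qed.

Lemma base_point17_eq O d : partial_ovoid O -> frame f S Sg1 Sg2 d ->
  d 1%num \in O -> d 16%num \in O -> base_point O = d 17%num.
Proof.
move=> Oo dF O1 O16; have dP := frame_decoder dF.
have [a [b [[al bh aO bO] [OB -> xn]]]] := ovoid_blocks Oo dF.
have hc := high_codes; have lc := low_codes.
have dis x : x \in low_block -> x \in high_block -> False.
  move=> xl xh; have /and3P[_ /negP + _] := allP (allP low_high_sum _ xl) _ xh.
  by rewrite xorn.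
have : d 1%num \in O :&: B.
  by rewrite inE O1 (frame_union dF) inE mem_dset_map // one_low.
have : d 16%num \in O :&: B.
  by rewrite inE O16 (frame_union dF) inE (mem_dset_map _ sixteen_high) orbT.
have l1 := one_low; have h16 := sixteen_high.
have inj := dec_inj dP; rewrite OB => /set2P[e16|e16].
  by case: (dis a); rewrite // -(inj _ _ (hc _ h16) (lc _ al) e16).
move=> /set2P[e1|e1]; last first.
  by case: (dis 1%num); rewrite // (inj _ _ (lc _ l1) (hc _ bh) e1).
by rewrite -(inj _ _ (hc _ h16) (hc _ bh) e16) -(inj _ _ (lc _ l1) (lc _ al) e1).
Qed.

Variable Y : {set {set V}}.
Hypotheses (hY : Y \in ovoid_orbits f S Sg1 Sg2) (hY120 : #|Y| = 120%N).

Lemma partial_ovoid_act (s : {perm V}) (O : {set V}) : s \in G -> partial_ovoid O ->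
  partial_ovoid (s @: O).
Proof.
move=> sG [OQ cO ON Og]; have /GstarP[_ fs _ _] := sG.
have sD := Gstar_add sG.
have s0 : s 0 = 0 by rewrite -[in LHS](addrr2 0) sD addrr2.
have sQ x : (s x \in quadric f) = (x \in quadric f).
  by rewrite !inE fs -{1}s0 (inj_eq perm_inj).
split.
- by apply/subsetP => _ /imsetP[x xO ->]; rewrite sQ (subsetP OQ).
- by rewrite card_imset //; apply: perm_inj.
- by move=> _ _ /imsetP[x xO ->] /imsetP[y yO ->]; rewrite -sD sQ ON.
move=> U US; have siG : (s^-1)%g \in G := groupVr (G := Group Gstar_group_set) sG.
have UE : U = s @: ((s^-1)%g @: U).
  by rewrite -imset_permM mulVg -[LHS]imset_id; apply: eq_imset => x; rewrite perm1.
rewrite UE -imsetI; last by move=> x y _ _; apply: perm_inj.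
rewrite card_imset; last exact: perm_inj.
by apply: Og; rewrite (Gstar_spread hSg1 hSg2 _ siG).
Qed.

Lemma orbit_ovoid O : O \in Y -> partial_ovoid O.
Proof.
case/imsetP: hY => O0 O0o ->; case/imsetP => s sG ->.
rewrite (_ : 'P^*%act O0 s = s @: O0); last by apply: eq_imset => x.
by apply: partial_ovoid_act => //; apply: ovoid_partial.
Qed.

Lemma orbit_act (s : {perm V}) (O : {set V}) : s \in G -> O \in Y -> s @: O \in Y.
Proof.
case/imsetP: hY => O0 O0o -> sG; case/imsetP => t tG ->; apply/imsetP.
exists (t * s)%g; first exact: GstarM.
have actE r : 'P^*%act O0 r = r @: O0 by apply: eq_imset => x.
by rewrite !actE imset_permM.
Qed.

Lemma base_point_inj : {in Y &, injective base_point}.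
Proof.
apply/imset_injP; rewrite hY120 -card_anisotropic; apply/eqP; congr #|pred_of_set _|.
have [d dF] := frame_exists hf hnd hSg1 hSg2 hhyp hS hSg.
have Z17 d' : frame f S Sg1 Sg2 d' -> d' 17%num \in anisotropic f.
  move=> dF'; rewrite (anisotropic_dset hf (frame_decoder dF') (frame_quadric dF')).
  exact: (mem_dset_map _ nonsingular17).
have bZ O : O \in Y -> base_point O \in anisotropic f.
  move=> /orbit_ovoid Oo; have [a [b [_ [_ -> xn]]]] := ovoid_blocks Oo dF.
  by rewrite (anisotropic_dset hf (frame_decoder dF) (frame_quadric dF)) mem_dset_map.
apply/setP => z; apply/imsetP/idP => [[O OY ->]|zZ]; first exact: bZ.
have [O OY] : exists O, O \in Y by apply/card_gt0P; rewrite hY120.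
(* The base point of O and the point z both have the code 17 in suitable frames; the element of [G*]
   relating these frames takes O to an ovoid of Y over z. *)
have [d1 [r1 [dF1 _ e1 _]]] := point_pair hf dF (bZ _ OY) zZ.
have [d2 [r2 [dF2 _ e2 _]]] := point_pair hf dF zZ zZ.
have [s sG sE] := frame_transitive hf dF1 dF2.
exists (s @: O); first exact: orbit_act.
by rewrite base_point_act // e1 e2 sE //; apply: nonsingular_codes nonsingular17.
Qed.

Lemma frame_code_act d g : frame f S Sg1 Sg2 d -> frame_code g ->
  exists2 s, s \in G & {in codes, forall k, s (d k) = d (lin g k)}.
Proof. by move=> dF gF; apply: (frame_transitive hf dF (frame_lin gF dF)). Qed.

(** In a frame where the base point is 17, O is one of the eight images of [root]. The element of
    [G*] given by [rot7] fixes the base point, hence O by injectivity of [base_point], and this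
    leaves only [root]. *)
Lemma orbit_root O : O \in Y -> exists d, frame f S Sg1 Sg2 d /\ O = dset d root.
Proof.
move=> OY; have Oo := orbit_ovoid OY.
have [d0 dF0] := frame_exists hf hnd hSg1 hSg2 hhyp hS hSg.
have bZ : base_point O \in anisotropic f.
  have [a [b [_ [_ -> xn]]]] := ovoid_blocks Oo dF0.
  by rewrite (anisotropic_dset hf (frame_decoder dF0) (frame_quadric dF0)) mem_dset_map.
have [d [r [dF _ bE _]]] := point_pair hf dF0 bZ bZ.
have dP := frame_decoder dF; have dQ := frame_quadric dF.
have [O1 O16] := base_point17 Oo dF bE; have [OQ cO ON _] := Oo.
have [m [mm mi _ m17 OE]] := ovoid_frame dP dQ OQ cO ON O1 O16.
exists d; split; rewrite // OE; rewrite dset_lin in OE *.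
have [s sG sE] := frame_code_act dF rot7_frame.
have sO : s @: O = O.
  apply: base_point_inj => //; first exact: orbit_act.
  rewrite base_point_act // bE sE; first by [].
  exact: nonsingular_codes nonsingular17.
have mc : {subset map (lin m) root <= codes}.
  by case/andP: mi => mok _ _ /mapP[k kr ->]; apply: lin_ok_codes => //; apply: root_codes.
have rc : {subset map (lin rot7) (map (lin m) root) <= codes}.
  move=> _ /mapP[k kr ->]; apply: lin_ok_codes (mc _ kr).
  by have /and3P[/andP[]] := rot7_frame.
have : eqsetN (map (lin rot7) (map (lin m) root)) (map (lin m) root).
  suff h : map (lin rot7) (map (lin m) root) =i map (lin m) root.
    by apply/andP; split; apply/allP => k; rewrite memNE h.
  apply: (dset_inj dP rc mc); rewrite -dset_lin -OE -{1}sO OE -dset_perm.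
  apply/setP => x; apply/dsetP/dsetP => -[k kr ->]; exists k => //=; rewrite sE //; exact: mc.
by move=> /(implyP (allP rot7_ovoids _ mm))/eqsetNP; apply: eq_dset.
Qed.

Lemma frame_root d : frame f S Sg1 Sg2 d -> dset d root \in Y.
Proof.
move=> dF; have [O OY] : exists O, O \in Y by apply/card_gt0P; rewrite hY120.
have [d' [dF' OE]] := orbit_root OY; have [s sG sE] := frame_transitive hf dF' dF.
rewrite (_ : dset d root = s @: O); first exact: orbit_act.
rewrite OE -dset_perm; apply/setP => x.
by apply/dsetP/dsetP => -[k kr ->]; exists k; rewrite //= sE //; apply: root_codes.
Qed.

End Ovoids.

(** * The relations R_i in a frame *)

Lemma bformC a b : bform a b = bform b a.
Proof. by rewrite /bform xorC addbAC. Qed.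

Lemma card_line n (x y : 'rV['F_2]_n) : x != 0 -> y != 0 -> x != y ->
  #|[set x; y; x + y]| = 3%N.
Proof.
move=> x0 y0 xy; rewrite setUC cardsU1 cards2 xy.
have -> // : x + y \notin [set x; y].
rewrite !inE negb_or -{2}(addr0 x) (inj_eq (addrI x)) y0.
by rewrite -{2}(add0r y) (inj_eq (addIr y)) x0.
Qed.

Section SmallDsets.
Variables (n : nat) (d : N -> 'rV['F_2]_n).
Hypothesis dP : decoder d.

Lemma dset_eq0 l : (dset d l == set0) = nilp l.
Proof.
case: l => [|k l] /=; first by apply/eqP/setP => x; rewrite inE; apply/dsetP => -[].
by apply/negP => /eqP/setP/(_ (d k)); rewrite inE mem_dset_map ?mem_head.
Qed.

Lemma dset_seq1 k : dset d [:: k] = [set d k].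
Proof.
apply/setP => x; rewrite inE; apply/dsetP/eqP => [[j]|->]; last by exists k; rewrite ?mem_head.
by rewrite inE => /eqP ->.
Qed.

Lemma exists_dset1 (p : pred 'rV['F_2]_n) l : {subset l <= codes} -> uniq l ->
  [exists x, (dset d l == [set x]) && p x] = if l is [:: z] then p (d z) else false.
Proof.
move=> lc lu; case: l lc lu => [|k [|j l]] lc lu.
- apply/existsP => -[x /andP[/eqP/setP/(_ x)]]; rewrite set11.
  by move/dsetP => -[].
- apply/existsP/idP => [[x]|pk]; last by exists (d k); rewrite dset_seq1 eqxx.
  by rewrite dset_seq1 => /andP[/eqP/set1_inj ->].
apply/existsP => -[x /andP[/eqP E _]].
by have := card_dset dP lc lu; rewrite E cards1.
Qed.

End SmallDsets.

Section Relations.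
Variable f : 'rV['F_2]_8 -> 'F_2.
Local Notation V := 'rV['F_2]_8.
Hypotheses (hf : quadratic_form f) (hnd : nondegenerate_form f) (hhyp : hyperbolic_form f).
Variables (S : {set {set V}}) (Sg1 Sg2 : {set V}).
Local Notation G := (Gstar f S Sg1 Sg2).
Hypotheses (hS : spread (quadric f) S).
Hypotheses (hSg1 : Sg1 \in S) (hSg2 : Sg2 \in S) (hSg : Sg1 != Sg2).
Variable Y : {set {set V}}.
Hypotheses (hY : Y \in ovoid_orbits f S Sg1 Sg2) (hY120 : #|Y| = 120%N).
Local Notation frame := (frame f S Sg1 Sg2).

Lemma block_points d x y : frame d -> x \in Sg1 -> y \in Sg2 ->
  exists a b, [/\ a \in low_block, b \in high_block, x + y = d (xor a b)
    & (x = d a /\ y = d b) \/ (x = d b /\ y = d a)].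
Proof.
move=> dF; have dP := frame_decoder dF.
case: dF => -[_ _ _ -> ->] /dsetP[a al ->] /dsetP[b bl ->].
  by exists a, b; split=> //; [rewrite (decD dP) | left].
by exists b, a; split=> //; [rewrite (decD dP) addrC | right].
Qed.

Lemma low_high17 a b : a \in low_block -> b \in high_block -> xor a b = 17%num ->
  a = 1%num /\ b = 16%num.
Proof.
move=> al bh ab; have /and3P[_ _] := allP (allP low_high_sum _ al) _ bh.
by rewrite ab => /andP[/N.eqb_eq -> /N.eqb_eq ->].
Qed.

(** A line through the anisotropic point 17 that meets both members is spanned by a point of each,
    and 17 is their sum. The only such decomposition is 17 = 1 + 16, so this is the line chosen by
    [ell]. *)
Lemma ell17 d : frame d -> {in Y, forall O : {set V},
  (ell Sg1 Sg2 (d 17%num) :&: Sg1 \subset O) && (ell Sg1 Sg2 (d 17%num) :&: Sg2 \subset O)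
  = (d 1%num \in O) && (d 16%num \in O)}.
Proof.
move=> dF O OY; have dP := frame_decoder dF; have dQ := frame_quadric dF.
have c17 := nonsingular_codes nonsingular17.
have nQ17 : d 17%num \notin quadric f.
  by rewrite (mem_Qd dP dQ c17) -memNE; vm_compute.
have BQ x : x \in Sg1 :|: Sg2 -> x \in quadric f.
  rewrite (frame_union dF) dQ => /setUP[] /dsetP[k kb ->]; apply: mem_dset_map; move: k kb.
    by apply: subNP; vm_compute.
  by apply: subNP; vm_compute.
have d17 : d 1%num + d 16%num = d 17%num by rewrite -(decD dP).
have n0 k : k \in codes -> k != 0%num -> d k != 0.
  by move=> kc; apply: contra => /eqP/(dec_eq0 dP kc) ->.
have d10 : d 1%num != 0 by apply: n0 => //; apply: low_codes one_low.
have d160 : d 16%num != 0 by apply: n0 => //; apply: high_codes sixteen_high.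
have dneq : d 1%num != d 16%num.
  apply/eqP => e; have := dec_inj dP (low_codes one_low) (high_codes sixteen_high) e.
  by [].
rewrite /ell; case: pickP => [l /and4P[] | none] /=.
  rewrite plineE => /andP[/psubspaceP[l0 lD] /eqP cl] l17 /set0Pn[x] /setIP[xl x1].
  move=> /set0Pn[y] /setIP[yl y2].
  have [a [b [al bh xyE ab]]] := block_points dF x1 y2.
  have xy : x != y.
    apply/eqP => exy; move: xyE; rewrite exy addrr2 => /esym/(dec_eq0 dP) h0.
    have /and3P[xc /negP + _] := allP (allP low_high_sum _ al) _ bh.
    by rewrite h0 // -memNE.
  have xyl : x + y \in l by apply: lD.
  have n0l z : z \in l -> z != 0 by move=> zl; apply: contraNneq l0 => <-.
  have lE : [set x; y; x + y] = l.
    apply: eqEcard_T.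
      by apply/subsetP => z; rewrite !inE -orbA => /or3P[] /eqP ->.
    by rewrite cl card_line ?n0l.
  have e17 : d 17%num = x + y.
    move: l17; rewrite -lE !inE -orbA => /or3P[] /eqP // e; case/negP: nQ17.
      by rewrite e BQ // inE x1.
    by rewrite e BQ // inE y2 orbT.
  have [a1 b16] : a = 1%num /\ b = 16%num.
    apply: low_high17 => //; apply: (dec_inj dP) => //; last by rewrite -xyE.
    by have /and3P[xc _ _] := allP (allP low_high_sum _ al) _ bh; rewrite memNE in xc.
  subst a b; apply/andP/andP => [[/subsetP h1 /subsetP h2]|[h1 h2]].
    have xO : x \in O by apply: h1; rewrite inE xl.
    have yO : y \in O by apply: h2; rewrite inE yl.
    by case: ab xO yO => -[-> ->].
  have lO z : z \in l -> z \in Sg1 :|: Sg2 -> z \in O.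
    rewrite -lE !inE -orbA -e17 => /or3P[] /eqP -> zB.
    - by case: ab => -[-> _].
    - by case: ab => -[_ ->].
    by case/negP: nQ17; apply: BQ; rewrite inE.
  by split; apply/subsetP => z /setIP[zl zB]; apply: lO zl _; rewrite inE zB ?orbT.
(* The line of 1 and 16 satisfies the condition, so the default of [ell] never occurs. *)
have [z1 z2] : (exists2 x, x \in [set d 1%num; d 16%num] & x \in Sg1)
    /\ (exists2 x, x \in [set d 1%num; d 16%num] & x \in Sg2).
  have e1 : d 1%num \in dset d low_block := mem_dset_map _ one_low.
  have e16 : d 16%num \in dset d high_block := mem_dset_map _ sixteen_high.
  case: dF => -[_ _ _ -> ->]; split.
  - by exists (d 1%num); rewrite // set21.
  - by exists (d 16%num); rewrite // set22.
  - by exists (d 16%num); rewrite // set22.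
  by exists (d 1%num); rewrite // set21.
case/negP: (none [set d 1%num; d 16%num; d 1%num + d 16%num]).
rewrite plineE psubspace_line //= card_line // eqxx /=; apply/and3P; split.
- by rewrite -d17 !inE eqxx orbT.
- by case: z1 => x xl x1; apply/set0Pn; exists x; rewrite inE x1 andbT inE xl.
by case: z2 => x xl x1; apply/set0Pn; exists x; rewrite inE x1 andbT inE xl.
Qed.

Lemma ovoid_of17 d : frame d -> ovoid_of Sg1 Sg2 Y (d 17%num) = dset d root.
Proof.
move=> dF; have rY := frame_root hf hnd hhyp hS hSg1 hSg2 hSg hY hY120 dF.
have rO := orbit_ovoid hf hnd hhyp hS hSg1 hSg2 hSg hY rY.
have rr : (d 1%num \in dset d root) && (d 16%num \in dset d root).
  by rewrite !mem_dset_map // -memNE; vm_compute.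
rewrite /ovoid_of; case: pickP => [O /andP[OY] | none] /=.
  rewrite (ell17 dF OY) => /andP[O1 O16].
  have OO := orbit_ovoid hf hnd hhyp hS hSg1 hSg2 hSg hY OY.
  apply: (base_point_inj hf hnd hhyp hS hSg1 hSg2 hSg hY hY120) => //.
  case/andP: rr => r1 r16.
  by rewrite (base_point17_eq OO dF) // (base_point17_eq rO dF).
by have := none (dset d root); rewrite rY (ell17 dF rY) rr.
Qed.

(** The induction over the table quantifies over all frames, because each generator is transferred
    from the code to the frame. *)
Lemma ovoid_of_code d : frame d -> {in nonsingular, forall c,
  ovoid_of Sg1 Sg2 Y (d c) = dset d (ovoid_code c)}.
Proof.
move=> dF c /mem_lookup ct; move: d dF; rewrite /ovoid_code.
pose P (e : entry) := forall d, frame d -> ovoid_of Sg1 Sg2 Y (d e.1) = dset d e.2.1.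
suff : P (c, lookup c) by [].
apply: (@table_ind P) ct => [d dF|[g h] gh e IH d dF]; first exact: ovoid_of17.
have gG : g \in gens.
  by move: gh; rewrite !inE => /or3P[] /eqP[-> _]; rewrite eqxx ?orbT.
have := IH _ (frame_lin (allP gens_frame _ gG) dF); rewrite dset_lin.
by [].
Qed.

Lemma perp_code d : frame d -> {in codes &, forall a b, perp f (d a) (d b) = ~~ bform a b}.
Proof.
move=> dF a b ac bc; have dP := frame_decoder dF; have dQ := frame_quadric dF.
rewrite /perp /polar -(decD dP) !(form_decoder hf dP dQ) ?xor_codes // /bform.
by case: (qform (xor a b)); case: (qform a); case: (qform b).
Qed.

Lemma point_rel_frame d : frame d -> {in nonsingular &, forall a b i, (i < 7)%N ->
  ((d a, d b) \in point_rel f Sg1 Sg2 Y i) = (rel_code a b == i)}.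
Proof.
move=> dF a b an bn i i7; have dP := frame_decoder dF; have dQ := frame_quadric dF.
have ac := nonsingular_codes an; have bc := nonsingular_codes bn.
have nZ := anisotropic_dset hf dP dQ.
rewrite inE in_setX /= nZ !mem_dset_map //= !(ovoid_of_code dF) //.
rewrite (perp_code dF ac bc) (inj_in_eq (dec_inj dP) ac bc).
set oa := ovoid_code a; set ob := ovoid_code b.
have ovP c : c \in nonsingular -> {subset ovoid_code c <= singular} /\ uniq (ovoid_code c).
  move=> /mem_lookup ct.
  by have /andP[/andP[/subNP h1 h2] _] := allP table_ovoid _ ct.
have [oas oau] := ovP _ an; have [obs obu] := ovP _ bn.
have oac : {subset oa <= codes} by move=> k /oas/singular_codes.
have obc : {subset ob <= codes} by move=> k /obs/singular_codes.
pose common := [seq x <- oa | memN x ob].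
have IE : dset d oa :&: dset d ob = dset d common.
  apply/setP => x; rewrite inE; apply/andP/dsetP => [[/dsetP[k ka ->]]|[k]].
    by rewrite (mem_dset dP obc (oac _ ka)) => kb; exists k; rewrite // mem_filter ka memNE kb.
  by rewrite mem_filter memNE => /andP[kb ka] ->; rewrite !mem_dset_map.
have cc : {subset common <= codes} by move=> k; rewrite mem_filter => /andP[_ /oac].
have cu : uniq common by rewrite filter_uniq.
have mE : #|dset d oa :&: perp_points f (d b)| = count (fun x => ~~ bform x b) oa.
  rewrite -size_filter -(card_dset dP) ?filter_uniq //; last first.
    by move=> k; rewrite mem_filter => /andP[_ /oac].
  congr #|pred_of_set _|; apply/setP => x; rewrite inE; apply/andP/dsetP => [[/dsetP[k ka ->]]|[k]].
    rewrite inE (perp_code dF bc (oac _ ka)) bformC => /andP[_ kb].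
    by exists k; rewrite // mem_filter ka kb.
  rewrite mem_filter => /andP[kb ka] ->; split; first exact: mem_dset_map.
  rewrite inE (perp_code dF bc (oac _ ka)) bformC kb andbT.
  have := oas _ ka; rewrite singularE => /and3P[kc k0 _].
  by apply: contra k0 => /eqP/(dec_eq0 dP kc) ->.
have blkE z : z \in codes ->
    (d z \in Sg1 :|: Sg2) = memN z low_block || memN z high_block.
  move=> zc; rewrite (frame_union dF) inE !memNE.
  by rewrite (mem_dset dP low_codes zc) (mem_dset dP high_codes zc).
rewrite IE !(exists_dset1 dP _ cc cu) mE (dset_eq0 d).
set m := count _ oa.
(* Of the three points of the line, [d a] and [d b] are anisotropic, so only their sum can lie on
   the ovoid. *)
have lE : a != b -> (pspan [set d a; d b] :&: dset d oa != set0) = memN (xor a b) oa.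
  move=> ab; have nQ c : c \in nonsingular -> d c \notin quadric f.
    move=> cn; rewrite (mem_Qd dP dQ (nonsingular_codes cn)) singularE.
    by move: cn; rewrite nonsingularE => /andP[-> ->]; rewrite andbF.
  have n0 c : c \in nonsingular -> d c != 0.
    move=> cn; apply: contraL (mem_dset_map d cn) => /eqP ->.
    by rewrite -nZ inE eqxx.
  have oaQ x : x \in dset d oa -> x \in quadric f.
    by case/dsetP => k /oas ks ->; rewrite dQ mem_dset_map.
  have dab : d a != d b by rewrite (inj_in_eq (dec_inj dP) ac bc).
  rewrite (pspan_pair (n0 _ an) (n0 _ bn) dab) memNE -(decD dP).
  rewrite -(mem_dset dP oac (xor_codes ac bc)).
  apply/set0Pn/idP => [[x]|xo]; last by exists (d (xor a b)); rewrite inE xo !inE eqxx !orbT.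
  rewrite !inE -orbA => /andP[/or3P[] /eqP -> // /oaQ xQ].
    by have := nQ _ an; rewrite xQ.
  by have := nQ _ bn; rewrite xQ.
rewrite rel_codeE -/oa -/ob -/common -/m /=.
have -> : N.eqb a b = (a == b) by [].
have -> : eqn m 3 = (m == 3%N) by [].
have -> : eqn m 7 = (m == 7%N) by [].
case: (eqVneq a b) lE => [_ _|ab /(_ isT) ->]; first by case: i i7 => [|[|[|[|[|[|[|i]]]]]]].
move: blkE cc; case: common {cu IE} => [|z [|z' l]] blkE cc.
- by case: (bform a b); (case: (eqVneq m 3%N) => [->|_]; [|case: (m == 7%N)]);
     case: i i7 => [|[|[|[|[|[|[|i]]]]]]] //.
- rewrite blkE ?cc ?mem_head //.
  by case: (memN z low_block || memN z high_block); case: (bform a b);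
     case: (memN (xor a b) oa); (case: (eqVneq m 3%N) => [->|_]; [|case: (m == 7%N)]);
     case: i i7 => [|[|[|[|[|[|[|i]]]]]]] //.
by case: (bform a b); case: i i7 => [|[|[|[|[|[|[|i]]]]]]] //.
Qed.

End Relations.

(** * The association scheme of a group with symmetric orbitals *)

Section SchemeOfGroup.
Variables (T : finType) (X : {set T}) (m : nat) (R : 'I_m.+1 -> {set T * T}).
Variable (G : {set {perm T}}).
Hypotheses (RX : forall i, R i \subset setX X X)
  (Rdiag : {in X &, forall x y, ((x, y) \in R ord0) = (x == y)})
  (Rsym : {in X &, forall x y i, ((y, x) \in R i) = ((x, y) \in R i)})
  (Rpart : {in X &, forall x y, exists i, forall j, ((x, y) \in R j) = (j == i)})
  (GX : {in G, forall s : {perm T}, {in X, forall x, s x \in X}})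
  (GR : {in G, forall s : {perm T}, {in X &, forall x y i,
    ((s x, s y) \in R i) = ((x, y) \in R i)}})
  (Gtrans : forall i, {in R i &, forall p r : T * T,
    exists2 s : {perm T}, s \in G & s p.1 = r.1 /\ s p.2 = r.2}).

Local Notation A := (fun i => adjmx X (R i)).
Local Notation W := (<<[seq A i | i <- enum 'I_m.+1]>>%VS).

(** The centraliser algebra of the group, described through the relations. *)
Definition rel_constant (M : 'M[rat]_#|X|) : Prop := forall i x y x' y',
  (enum_val x, enum_val y) \in R i -> (enum_val x', enum_val y') \in R i -> M x y = M x' y'.

Lemma adjmx_constant i : rel_constant (A i).
Proof.
move=> j x y x' y'; rewrite !mxE.
have [k kE] := Rpart (enum_valP x) (enum_valP y).
have [k' kE'] := Rpart (enum_valP x') (enum_valP y').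
by rewrite !kE !kE' => /eqP <- /eqP <-.
Qed.

Lemma span_constant M : M \in W -> rel_constant M.
Proof.
rewrite -[X in <<X>>%VS]/(val (in_tuple _)) => /coord_span ->.
apply: (big_ind rel_constant) => [i x y x' y' _ _|N1 N2 h1 h2 i x y x' y' h h'|k _].
- by rewrite !mxE.
- by rewrite mxE [RHS]mxE (h1 _ _ _ _ _ h h') (h2 _ _ _ _ _ h h').
have ks : (k < size (in_tuple [seq A i | i <- enum 'I_m.+1]))%N by [].
have /mapP[j _ ->] := mem_nth 0 ks.
by move=> i x y x' y' h h'; rewrite mxE [RHS]mxE (@adjmx_constant j _ _ _ _ _ h h').
Qed.

Lemma constant_span M : rel_constant M -> M \in W.
Proof.
(* The coefficient of [A i] is the value of M at any pair in the relation; the default 0 serves an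
   empty relation. *)
move=> MC; pose c i := if [pick p : 'I_#|X| * 'I_#|X| | (enum_val p.1, enum_val p.2) \in R i]
  is Some p then M p.1 p.2 else 0.
suff -> : M = \sum_i c i *: A i.
  apply: memv_suml => i _; apply: memvZ; apply: memv_span; apply: map_f.
  by rewrite mem_enum.
apply/matrixP => x y; rewrite summxE.
have [k kE] := Rpart (enum_valP x) (enum_valP y).
rewrite (bigD1 k) //= !mxE kE eqxx mulr1 big1 ?addr0 => [|i ik]; last first.
  by rewrite !mxE kE (negPf ik) mulr0.
rewrite /c; case: pickP => [p pR|/(_ (x, y))]; last by rewrite /= kE eqxx.
by apply: MC pR; rewrite kE.
Qed.

(** The sum over the middle index is reindexed by a group element that carries the first pair to the
    second. *)
Lemma constant_mul M N : rel_constant M -> rel_constant N -> rel_constant (M *m N).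
Proof.
move=> MC NC i x y x' y' xy xy'; rewrite !mxE.
have [s sG /= [sx sy]] := Gtrans xy xy'.
pose s' (z : 'I_#|X|) : 'I_#|X| := enum_rank_in (enum_valP x) (s (enum_val z)).
have s'K z : enum_val (s' z) = s (enum_val z).
  by rewrite enum_rankK_in // GX // enum_valP.
rewrite [RHS](reindex_inj (h := s')) => [|z z' zz]; last first.
  by apply: enum_val_inj; apply: (@perm_inj _ s); rewrite -!s'K zz.
apply: eq_bigr => z _; congr (_ * _).
  have [k kE] := Rpart (enum_valP x) (enum_valP z).
  apply: (MC k); rewrite ?kE //.
  by rewrite s'K -sx GR ?kE ?enum_valP.
have [k kE] := Rpart (enum_valP z) (enum_valP y).
apply: (NC k); rewrite ?kE //.
by rewrite s'K -sy GR ?kE ?enum_valP.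
Qed.

Lemma constant_tr M : rel_constant M -> M^T = M.
Proof.
move=> MC; apply/matrixP => x y; rewrite mxE.
have [k kE] := Rpart (enum_valP x) (enum_valP y).
have xy : (enum_val x, enum_val y) \in R k by rewrite kE.
have yx : (enum_val y, enum_val x) \in R k.
  by rewrite (Rsym (enum_valP x) (enum_valP y)).
exact: MC yx xy.
Qed.

Lemma group_scheme : symmetric_scheme X R.
Proof.
split=> //.
- by move=> i; apply/constant_tr/adjmx_constant.
- by apply/matrixP => x y; rewrite !mxE Rdiag ?enum_valP // (inj_eq enum_val_inj).
- apply/matrixP => x y; rewrite summxE [RHS]mxE.
  have [k kE] := Rpart (enum_valP x) (enum_valP y).
  rewrite (bigD1 k) //= mxE kE eqxx big1 ?addr0 // => i ik.
  by rewrite mxE kE (negPf ik).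
move=> M N /span_constant MC /span_constant NC.
(* The product is again constant on relations, hence symmetric, and M N equals its transpose N M. *)
have MNC := constant_mul MC NC; split; first exact: constant_span.
by rewrite -[LHS](constant_tr MNC) trmx_mul (constant_tr MC) (constant_tr NC).
Qed.

Hypotheses (Rne : forall i, R i != set0) (G1 : (1%g : {perm T}) \in G).

Lemma orbitals_group : [set R i | i : 'I_m.+1] = orbitals 'P%act G X.
Proof.
have RE i p : p \in R i -> R i = [set ('P%act p.1 g, 'P%act p.2 g) | g in G].
  move=> pR; apply/setP => r; apply/idP/imsetP => [rR|[s sG ->]].
    by have [s sG [e1 e2]] := Gtrans pR rR; exists s; rewrite //= !apermE e1 e2 -surjective_pairing.
  have : p \in setX X X := subsetP (RX i) _ pR.
  by rewrite inE => /andP[p1 p2]; rewrite /= !apermE GR // -surjective_pairing.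
apply/setP => E; apply/imsetP/imsetP => [[i _ ->]|[p]].
  have /set0Pn[p pR] := Rne i; exists p; last exact: RE.
  exact: subsetP (RX i) _ pR.
rewrite inE => /andP[p1 p2] ->; have [i iE] := Rpart p1 p2.
by exists i => //; rewrite -(RE i) // [p]surjective_pairing iE.
Qed.

Lemma orbitals_image (T' : finType) (to : {action {perm T} &-> T'}) (h : T -> T') :
  {in G, forall s : {perm T}, {in X, forall x, h (s x) = to (h x) s}} ->
  [set [set (h p.1, h p.2) | p in R i] | i : 'I_m.+1] = orbitals to G (h @: X).
Proof.
move=> hG; have hE p : p \in setX X X ->
    [set (h r.1, h r.2) | r in [set ('P%act p.1 g, 'P%act p.2 g) | g in G]]
    = [set (to (h p.1) g, to (h p.2) g) | g in G].
  rewrite inE => /andP[p1 p2]; rewrite -imset_comp; apply: eq_in_imset => s sG /=.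
  by rewrite !apermE !hG.
have -> : [set [set (h p.1, h p.2) | p in R i] | i : 'I_m.+1] =
    [set [set (h r.1, h r.2) | r in (E : {set T * T})] | E in orbitals 'P%act G X].
  by rewrite -orbitals_group -imset_comp.
apply/setP => E; apply/imsetP/imsetP => [[_ /imsetP[p pX ->] ->]|[r]].
  exists (h p.1, h p.2); last exact: hE.
  by move: pX; rewrite inE => /andP[p1 p2]; rewrite in_setX !imset_f.
rewrite inE => /andP[/imsetP[x xX ->] /imsetP[y yX ->]] ->.
exists [set ('P%act x g, 'P%act y g) | g in G]; last first.
  by rewrite (hE (x, y)) // in_setX xX.
by apply/imsetP; exists (x, y); rewrite // in_setX xX.
Qed.

End SchemeOfGroup.

(** * The scheme on the anisotropic points *)

Lemma mem_iota7 i : (i < 7)%N -> i \in iota 0 7.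
Proof. by rewrite mem_iota. Qed.

Lemma reps_bform : all (fun i => bform 17 (nth 0%num reps i) == (i == 5) || (i == 6)) (iota 0 7).
Proof. by vm_compute. Qed.

(** Anisotropic points that span the space, so a linear map is determined by its action on them;
    this yields faithfulness. *)
Definition basis_nonsingular : seq N := [:: 17; 19; 21; 25; 49; 81; 145; 35]%num.

Lemma basis_nonsingular_sub : {subset basis_nonsingular <= nonsingular}.
Proof. by apply: subNP; vm_compute. Qed.

Lemma basis_nonsingular_span : {subset codes <= spanl basis_nonsingular}.
Proof. by apply: subNP; vm_compute. Qed.

Section PointScheme.
Variable f : 'rV['F_2]_8 -> 'F_2.
Local Notation V := 'rV['F_2]_8.
Hypotheses (hf : quadratic_form f) (hnd : nondegenerate_form f) (hhyp : hyperbolic_form f).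
Variables (S : {set {set V}}) (Sg1 Sg2 : {set V}).
Local Notation G := (Gstar f S Sg1 Sg2).
Hypotheses (hS : spread (quadric f) S).
Hypotheses (hSg1 : Sg1 \in S) (hSg2 : Sg2 \in S) (hSg : Sg1 != Sg2).
Variable Y : {set {set V}}.
Hypotheses (hY : Y \in ovoid_orbits f S Sg1 Sg2) (hY120 : #|Y| = 120%N).
Local Notation frame := (frame f S Sg1 Sg2).
Local Notation R := (point_rel f Sg1 Sg2 Y).
Local Notation Z := (anisotropic f).
Local Notation O := (ovoid_of Sg1 Sg2 Y).
Local Notation rep := (nth 0%num reps).

Let relE := point_rel_frame hf hnd hhyp hS hSg1 hSg2 hSg hY hY120.

Lemma rep_nonsingular i : (i < 7)%N -> rep i \in nonsingular.
Proof. by move=> i7; apply: reps_nonsingular; rewrite mem_nth. Qed.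

Lemma frame_anisotropic d : frame d -> Z = dset d nonsingular.
Proof. by move=> dF; apply: anisotropic_dset (frame_decoder dF) (frame_quadric dF). Qed.

Lemma Z_pair : {in Z &, forall x y, exists d i,
  [/\ frame d, (i < 7)%N, x = d 17%num & y = d (rep i)]}.
Proof.
have [d0 dF0] := frame_exists hf hnd hSg1 hSg2 hhyp hS hSg.
move=> x y xZ yZ; have [d [r [dF rr xE yE]]] := point_pair hf dF0 xZ yZ.
exists d, (index r reps); split=> //; first by rewrite -[7%N]/(size reps) index_mem.
by rewrite nth_index.
Qed.

Lemma rel_rep d i j : frame d -> (i < 7)%N -> (j < 7)%N ->
  ((d 17%num, d (rep i)) \in R j) = (j == i) /\ ((d (rep i), d 17%num) \in R j) = (j == i).
Proof.
move=> dF i7 j7; have rn := rep_nonsingular i7.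
rewrite !(relE dF) ?nonsingular17 //.
have /andP[/eqP -> /eqP ->] := allP rel_code_reps i (mem_iota7 i7).
by rewrite eq_sym.
Qed.

Lemma rel_part : {in Z &, forall x y, exists i : 'I_7, forall j : 'I_7,
  ((x, y) \in R j) = (j == i)}.
Proof.
move=> x y xZ yZ; have [d [i [dF i7 -> ->]]] := Z_pair xZ yZ.
exists (Ordinal i7) => j; exact: (proj1 (rel_rep dF i7 (ltn_ord j))).
Qed.

Lemma rel_sym : {in Z &, forall x y (i : 'I_7), ((y, x) \in R i) = ((x, y) \in R i)}.
Proof.
move=> x y xZ yZ j; have [d [i [dF i7 -> ->]]] := Z_pair xZ yZ.
by have [-> ->] := rel_rep dF i7 (ltn_ord j).
Qed.

Lemma Gstar_Z : {in G, forall s : {perm V}, {in Z, forall x, s x \in Z}}.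
Proof.
move=> s sG x xZ; have [d0 dF0] := frame_exists hf hnd hSg1 hSg2 hhyp hS hSg.
rewrite (frame_anisotropic (frame_act hSg1 hSg2 sG dF0)).
move: xZ; rewrite (frame_anisotropic dF0) => /dsetP[k kn ->].
by apply/dsetP; exists k.
Qed.

Lemma rel_act : {in G, forall s : {perm V}, {in Z &, forall x y (i : 'I_7),
  ((s x, s y) \in R i) = ((x, y) \in R i)}}.
Proof.
move=> s sG x y xZ yZ j; have [d [i [dF i7 -> ->]]] := Z_pair xZ yZ.
have dsF := frame_act hSg1 hSg2 sG dF.
rewrite (proj1 (rel_rep dF i7 (ltn_ord j))).
exact: (proj1 (rel_rep dsF i7 (ltn_ord j))).
Qed.

Lemma rel_sub (i : nat) : R i \subset setX Z Z.
Proof. by apply/subsetP => p; rewrite inE => /andP[]. Qed.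

Lemma rel_trans (i : 'I_7) : {in R i &, forall p r : V * V,
  exists2 s : {perm V}, s \in G & s p.1 = r.1 /\ s p.2 = r.2}.
Proof.
move=> [x y] [x' y'] xy xy'.
have := subsetP (rel_sub i) _ xy; have := subsetP (rel_sub i) _ xy'.
rewrite !in_setX => /andP[xZ' yZ'] /andP[xZ yZ].
have [d [j [dF j7 xE yE]]] := Z_pair xZ yZ; have [d' [j' [dF' j7' xE' yE']]] := Z_pair xZ' yZ'.
have ij : val i = j.
  by apply/eqP; rewrite -(proj1 (rel_rep dF j7 (ltn_ord i))) -xE -yE.
have ij' : val i = j'.
  by apply/eqP; rewrite -(proj1 (rel_rep dF' j7' (ltn_ord i))) -xE' -yE'.
have [s sG sE] := frame_transitive hf dF dF'; exists s => //=.
rewrite xE yE xE' yE' -ij' ij (sE _ (nonsingular_codes nonsingular17)).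
by rewrite (sE _ (nonsingular_codes (rep_nonsingular j7))).
Qed.

Lemma rel_diag : {in Z &, forall x y, ((x, y) \in R 0%N) = (x == y)}.
Proof. by move=> x y xZ yZ; rewrite inE in_setX xZ yZ. Qed.

Lemma rel_ne (i : 'I_7) : R i != set0.
Proof.
have [d0 dF0] := frame_exists hf hnd hSg1 hSg2 hhyp hS hSg.
apply/set0Pn; exists (d0 17%num, d0 (rep i)).
by rewrite (proj1 (rel_rep dF0 (ltn_ord i) (ltn_ord i))).
Qed.

Lemma point_scheme : symmetric_scheme Z (fun i : 'I_7 => R i).
Proof.
by apply: (group_scheme (G := G)) => [i||||||]; [exact: rel_sub | exact: rel_diag
  | exact: rel_sym | exact: rel_part | exact: Gstar_Z | exact: rel_act | exact: rel_trans].
Qed.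

Lemma point_orbitals : [set R i | i : 'I_7] = orbitals 'P%act G Z.
Proof.
apply: (orbitals_group (R := fun i : 'I_7 => R i)) => [i||||]; [exact: rel_sub
  | exact: rel_part | exact: rel_act | exact: rel_trans | exact: rel_ne].
Qed.

Lemma ovoid_of_Z : {in Z, forall x, exists d, [/\ frame d, x = d 17%num & O x = dset d root]}.
Proof.
move=> x xZ; have [d [i [dF i7 -> _]]] := Z_pair xZ xZ; exists d; split=> //.
exact: (ovoid_of17 hf hnd hhyp hS hSg1 hSg2 hSg hY hY120 dF).
Qed.

Lemma ovoid_of_act : {in G, forall s : {perm V}, {in Z, forall x, O (s x) = s @: O x}}.
Proof.
move=> s sG x xZ; have [d [dF -> ->]] := ovoid_of_Z xZ.
rewrite -dset_perm; apply: (ovoid_of17 hf hnd hhyp hS hSg1 hSg2 hSg hY hY120).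
exact: (frame_act hSg1 hSg2 sG dF).
Qed.

Lemma base_point_ovoid : {in Z, forall x, O x \in Y /\ base_point Sg1 Sg2 (O x) = x}.
Proof.
move=> x xZ; have [d [dF -> ->]] := ovoid_of_Z xZ.
have rY := frame_root hf hnd hhyp hS hSg1 hSg2 hSg hY hY120 dF; split=> //.
have rO := orbit_ovoid hf hnd hhyp hS hSg1 hSg2 hSg hY rY.
by apply: (base_point17_eq rO dF); apply: mem_dset_map; rewrite -memNE; vm_compute.
Qed.

Lemma ovoid_of_inj : {in Z &, injective O}.
Proof.
move=> x y xZ yZ xy.
by rewrite -(proj2 (base_point_ovoid xZ)) xy (proj2 (base_point_ovoid yZ)).
Qed.

Lemma ovoid_of_image : O @: Z = Y.
Proof.
apply: eqEcard_T; first by apply/subsetP => _ /imsetP[x xZ ->]; have [] := base_point_ovoid xZ.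
rewrite (card_in_imset ovoid_of_inj) hY120.
exact: (card_anisotropic hf hnd hhyp hS hSg1 hSg2 hSg).
Qed.

Lemma ovoid_orbitals : [set [set (O p.1, O p.2) | p in R i] | i : 'I_7] = orbitals 'P^*%act G Y.
Proof.
rewrite -[in RHS]ovoid_of_image.
apply: (orbitals_image (R := fun i : 'I_7 => R i)) => [i|||||]; [exact: rel_sub
  | exact: rel_part | exact: rel_act | exact: rel_trans | exact: rel_ne |].
by move=> s sG x xZ; rewrite ovoid_of_act //; apply: eq_imset => y.
Qed.

Lemma rel_perp : {in Z &, forall x y,
  ((x, y) \in R 5%N :|: R 6%N) = ~~ perp f x y}.
Proof.
move=> x y xZ yZ; have [d [i [dF i7 -> ->]]] := Z_pair xZ yZ.
rewrite inE !(proj1 (rel_rep dF i7 _)) //.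
rewrite (perp_code hf dF (nonsingular_codes nonsingular17)
  (nonsingular_codes (rep_nonsingular i7))) negbK.
have /eqP -> := allP reps_bform i (mem_iota7 i7).
by rewrite !(eq_sym i).
Qed.

Lemma rel_NObar : R 5%N :|: R 6%N = NObar f.
Proof.
apply/setP => -[x y]; rewrite [RHS]inE in_setX.
case: (boolP (x \in Z)) => xZ; last first.
  apply/negP => /setUP[] /(subsetP (rel_sub _)); by rewrite in_setX (negPf xZ).
case: (boolP (y \in Z)) => yZ; first exact: rel_perp.
apply/negP => /setUP[] /(subsetP (rel_sub _)); by rewrite in_setX (negPf yZ) andbF.
Qed.

Lemma Gstar_faithful : [faithful G, on Z | 'P].
Proof.
apply/subsetP => s /setIP[sG /astabP sZ]; rewrite inE; apply/eqP/permP => x.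
have [d dF] := frame_exists hf hnd hSg1 hSg2 hhyp hS hSg.
have [k kc ->] := decoderP x (frame_decoder dF); rewrite perm1.
apply: (additive_eq_on (decD (frame_decoder (frame_act hSg1 hSg2 sG dF)))
  (decD (frame_decoder dF)) _ (basis_nonsingular_span kc)).
move=> c /basis_nonsingular_sub cn; apply: sZ.
by rewrite (frame_anisotropic dF) mem_dset_map.
Qed.

End PointScheme.

(** * Strong regularity and the automorphisms of Gamma* *)

Definition points : seq (N * seq N) := Eval vm_compute in map pointed nonsingular.

Lemma pointsE : points = map pointed nonsingular. Proof. by vm_compute. Qed.

Definition adj_star (p r : N * seq N) : bool :=
  let i := rel_index p r in if eqn i 3 then true else if eqn i 4 then true else eqn i 6.

Definition adj_bar (p r : N * seq N) : bool := bform p.1 r.1.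

(** Pairs starting at 17 suffice, since every pair of anisotropic points becomes one of these in
    some frame. The numbers of common neighbours concern distinct points, hence [behead]. *)
Definition srg_check (adj : N * seq N -> N * seq N -> bool) : bool :=
  let p0 := pointed 17 in let rs := map pointed reps in
  [&& ~~ adj p0 p0, all (fun r => adj p0 r == adj r p0) rs,
      count (adj p0) points == 56%N
    & all (fun r => count (fun p => adj p0 p && adj r p) points
                    == if adj p0 r then 28%N else 24%N) (behead rs)].

Lemma srg_check_star : srg_check adj_star. Proof. by vm_compute. Qed.
Lemma srg_check_bar : srg_check adj_bar. Proof. by vm_compute. Qed.

(* The number of ordered pairs of adjacent common neighbours of 17 and r. *)
Definition pairs_check (adj : N * seq N -> N * seq N -> bool) (r : N) : nat :=
  let common := [seq p <- points | adj (pointed 17) p && adj (pointed r) p] in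
  sumn [seq count (adj p) common | p <- common].

(** The six values are distinct, so the graph alone recovers R_1, ..., R_6. *)
Lemma pairs_star : map (pairs_check adj_star) (behead reps)
  = [:: 306; 312; 386; 396; 328; 402]%N.
Proof. by vm_compute. Qed.

(** Two values only, one for orthogonal and one for non-orthogonal pairs; neither is among the
    values for Gamma*. *)
Lemma pairs_bar : map (pairs_check adj_bar) (behead reps)
  = [:: 288; 288; 288; 288; 432; 432]%N.
Proof. by vm_compute. Qed.

(* Determined by their relations to 17 and 39, and determining all the others. *)
Definition rigid_codes : seq N :=
  [:: 17; 23; 34; 39; 84; 100; 101; 138; 140; 172; 177; 232]%num.

Lemma rigid_codesP : all (fun k => let p := pointed k in
    let i := rel_index (pointed 17) p in let j := rel_index (pointed 39) p in
    all (fun r => if eqn (rel_index (pointed 17) r) i then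
      if eqn (rel_index (pointed 39) r) j then N.eqb r.1 k else true else true) points)
  rigid_codes.
Proof. by vm_compute. Qed.

Lemma rigid_codes_uniq :
  uniq [seq [seq rel_index p r | p <- map pointed rigid_codes] | r <- points].
Proof. by vm_compute. Qed.

Lemma rigid_codes_sub : {subset rigid_codes <= nonsingular}.
Proof. by apply: subNP; vm_compute. Qed.
#[global] Opaque points rigid_codes.

Lemma rel_codeP a b : rel_code a b = rel_index (pointed a) (pointed b).
Proof. by []. Qed.

Section PairCount.
Variables (T : finType) (X : {set T}).
Implicit Types E : {set T * T}.

Definition common E x y : {set T} := [set z in X | ((x, z) \in E) && ((y, z) \in E)].

Definition pair_count E x y : nat :=
  (\sum_(z in common E x y) #|[set t in common E x y | (z, t) \in E]|)%N.

Lemma pair_count_iso E E' (h : T -> T) : {in X &, injective h} -> h @: X = X ->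
  {in X &, forall x y, ((h x, h y) \in E') = ((x, y) \in E)} ->
  {in X &, forall x y, pair_count E' (h x) (h y) = pair_count E x y}.
Proof.
move=> h_inj hX hE x y xX yX.
have cX z : z \in common E x y -> z \in X by rewrite inE => /andP[].
have cE : common E' (h x) (h y) = h @: common E x y.
  apply/setP => z; apply/idP/imsetP => [|[t tc ->]].
    rewrite inE -{1}hX => /andP[/imsetP[t tX ->]]; rewrite !hE // => tE.
    by exists t; rewrite // inE tX tE.
  move: tc; rewrite !inE => /and3P[tX t1 t2].
  by rewrite !hE // t1 t2 -hX imset_f.
rewrite /pair_count cE big_imset /=; last by move=> z t /cX zX /cX; apply: h_inj.
apply: eq_bigr => z zc; have zX := cX _ zc.
rewrite -[RHS](card_in_imset (f := h)); last first.
  move=> t u; rewrite in_set => /andP[/cX tX _]; rewrite in_set => /andP[/cX uX _].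
  exact: h_inj.
congr #|pred_of_set _|; apply/setP => t; apply/idP/imsetP => [|[u]].
  rewrite inE => /andP[/imsetP[u uc ->]]; have uX := cX _ uc; rewrite hE // => zu.
  by exists u; rewrite // inE uc.
by rewrite inE => /andP[uc zu] ->; have uX := cX _ uc; rewrite inE imset_f // hE.
Qed.

End PairCount.

Section Graphs.
Variable f : 'rV['F_2]_8 -> 'F_2.
Local Notation V := 'rV['F_2]_8.
Hypotheses (hf : quadratic_form f) (hnd : nondegenerate_form f) (hhyp : hyperbolic_form f).
Variables (S : {set {set V}}) (Sg1 Sg2 : {set V}).
Local Notation G := (Gstar f S Sg1 Sg2).
Hypotheses (hS : spread (quadric f) S).
Hypotheses (hSg1 : Sg1 \in S) (hSg2 : Sg2 \in S) (hSg : Sg1 != Sg2).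
Local Notation frame := (frame f S Sg1 Sg2).
Local Notation Z := (anisotropic f).
Local Notation rep := (nth 0%num reps).

Let ZE d : frame d -> Z = dset d nonsingular := @frame_anisotropic f hf S Sg1 Sg2 d.
Let Zpair := Z_pair hf hnd hhyp hS hSg1 hSg2 hSg.

Lemma nonsingular_uniq : uniq nonsingular. Proof. by vm_compute. Qed.

Lemma filter_dset d (P : pred V) (p : pred N) l : decoder d -> {subset l <= codes} ->
  {in l, forall c, P (d c) = p c} ->
  [set z in dset d l | P z] = dset d (filter p l).
Proof.
move=> dP lc Pp; apply/setP => z; rewrite inE; apply/andP/dsetP => [[/dsetP[k kl ->]]|[k]].
  by rewrite Pp // => pk; exists k; rewrite // mem_filter pk.
by rewrite mem_filter => /andP[pk kl] ->; rewrite mem_dset_map ?Pp.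
Qed.

Lemma card_filter_dset d (P : pred V) (p : pred N) l : decoder d -> {subset l <= codes} ->
  uniq l -> {in l, forall c, P (d c) = p c} -> #|[set z in dset d l | P z]| = count p l.
Proof.
move=> dP lc lu Pp; rewrite (filter_dset dP lc Pp) (card_dset dP) ?filter_uniq ?size_filter //.
by move=> k; rewrite mem_filter => /andP[_ /lc].
Qed.

Lemma sum_dset (d : N -> V) (F : V -> nat) l : decoder d -> {subset l <= codes} -> uniq l ->
  (\sum_(z in dset d l) F z = sumn [seq F (d k) | k <- l])%N.
Proof.
move=> dP lc lu; rewrite sumnE big_map -(big_map d xpredT F).
rewrite [RHS]big_uniq /=; last first.
  by rewrite map_inj_in_uniq // => a b /lc ac /lc bc; apply: (dec_inj dP).
by apply: eq_bigl => z; apply/dsetP/mapP => -[k kl ->]; exists k.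
Qed.

Section CodedGraph.
Variables (E : {set V * V}) (adj : N * seq N -> N * seq N -> bool).
Hypothesis EZ : E \subset setX Z Z.
Hypothesis Eadj : forall d, frame d -> {in nonsingular &, forall a b,
  ((d a, d b) \in E) = adj (pointed a) (pointed b)}.

Lemma coded_common d a b : frame d -> a \in nonsingular -> b \in nonsingular ->
  common Z E (d a) (d b) = dset d
    [seq c <- nonsingular | adj (pointed a) (pointed c) && adj (pointed b) (pointed c)].
Proof.
move=> dF an bn; rewrite /common (ZE dF).
apply: filter_dset => [||c cn]; [exact: frame_decoder dF|exact: nonsingular_codes|].
by rewrite !Eadj.
Qed.

Lemma coded_srg : srg_check adj -> strongly_regular 120 56 28 24 Z E.
Proof.
case/and4P=> irr /allP sym /eqP deg /allP cnt.
have rep_in i : (i < 7)%N -> rep i \in reps by move=> i7; rewrite mem_nth.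
have rn := rep_nonsingular; have n17 := nonsingular17.
split; [split=> //| exact: (card_anisotropic hf hnd hhyp hS hSg1 hSg2 hSg) | |].
- move=> x xZ; have [d [i [dF i7 -> _]]] := Zpair xZ xZ.
  by rewrite Eadj.
- move=> x y xZ yZ; have [d [i [dF i7 -> ->]]] := Zpair xZ yZ.
  rewrite !Eadj ?rn //; apply/eqP.
  by apply: sym; apply: map_f; apply: rep_in.
- move=> x xZ; have [d [i [dF i7 -> _]]] := Zpair xZ xZ.
  rewrite -{1}deg pointsE count_map {1}(ZE dF); apply: card_filter_dset.
  + exact: frame_decoder dF.
  + exact: nonsingular_codes.
  + exact: nonsingular_uniq.
  by move=> c cn; rewrite Eadj.
move=> x y xZ yZ; have [d [i [dF i7 -> ->]]] := Zpair xZ yZ => xy.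
have i0 : i != 0%N by apply: contra xy => /eqP ->.
have rb : rep i \in behead reps.
  case: i i7 i0 {xy} => // i i7 _; rewrite -nth_behead mem_nth //.
have /eqP := cnt (pointed (rep i)) (map_f _ rb).
rewrite Eadj ?rn // pointsE count_map => <-.
have -> : [set y0 in Z | (d 17%num, y0) \in E] :&: [set y0 in Z | (d (rep i), y0) \in E]
    = common Z E (d 17%num) (d (rep i)).
  by apply/setP => z; rewrite /common in_setI !(in_set (fun _ => _ && _)) andbACA andbb.
rewrite (coded_common dF) ?rn // (card_dset (frame_decoder dF)) ?filter_uniq ?nonsingular_uniq //.
  by rewrite size_filter; apply: eq_count.
by move=> k; rewrite mem_filter => /andP[_ /nonsingular_codes].
Qed.

Lemma coded_pair_count d i : frame d -> (i < 7)%N ->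
  pair_count Z E (d 17%num) (d (rep i)) = pairs_check adj (rep i).
Proof.
move=> dF i7; have ri := rep_nonsingular i7; have dP := frame_decoder dF.
rewrite /pair_count (coded_common dF nonsingular17 ri); set l := filter _ nonsingular.
have ln : {subset l <= nonsingular} by move=> k; rewrite mem_filter => /andP[].
have lc : {subset l <= codes} by move=> k /ln /nonsingular_codes.
have lu : uniq l by rewrite filter_uniq ?nonsingular_uniq.
rewrite (sum_dset _ dP lc lu) /pairs_check pointsE filter_map -/l -map_comp.
congr sumn; apply/eq_in_map => a al; rewrite /= count_map.
by apply: (card_filter_dset dP lc lu) => b bl; rewrite Eadj ?ln.
Qed.

End CodedGraph.

Variable Y : {set {set V}}.
Hypotheses (hY : Y \in ovoid_orbits f S Sg1 Sg2) (hY120 : #|Y| = 120%N).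
Local Notation R := (point_rel f Sg1 Sg2 Y).
Local Notation star := (R 3%N :|: R 4%N :|: R 6%N).
Let relE := point_rel_frame hf hnd hhyp hS hSg1 hSg2 hSg hY hY120.

Lemma star_sub : star \subset setX Z Z.
Proof. by rewrite !subUset !rel_sub. Qed.

Lemma star_adj d : frame d -> {in nonsingular &, forall a b,
  ((d a, d b) \in star) = adj_star (pointed a) (pointed b)}.
Proof.
move=> dF a b an bn; rewrite !in_setU !(relE dF) // rel_codeP /adj_star.
by case: (rel_index _ _) => [|[|[|[|[|[|[|i]]]]]]].
Qed.

Lemma bar_sub : NObar f \subset setX Z Z.
Proof. by apply/subsetP => p; rewrite inE => /andP[]. Qed.

Lemma bar_adj d : frame d -> {in nonsingular &, forall a b,
  ((d a, d b) \in NObar f) = adj_bar (pointed a) (pointed b)}.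
Proof.
move=> dF a b an bn; rewrite inE in_setX (ZE dF) !mem_dset_map //=.
by rewrite (perp_code hf dF (nonsingular_codes an) (nonsingular_codes bn)) negbK.
Qed.

Lemma star_srg : strongly_regular 120 56 28 24 Z star.
Proof. exact: (coded_srg star_sub star_adj srg_check_star). Qed.

Lemma bar_srg : strongly_regular 120 56 28 24 Z (NObar f).
Proof. exact: (coded_srg bar_sub bar_adj srg_check_bar). Qed.

Lemma pairs_check_nth adj i : (0 < i < 7)%N ->
  pairs_check adj (rep i) = nth 0%N (map (pairs_check adj) (behead reps)) i.-1.
Proof.
move=> i6; have i5 : (i.-1 < size (behead reps))%N.
  by rewrite size_behead -[size reps]/7%N /=; lia.
rewrite (nth_map 0%num _ _ i5) nth_behead; congr (pairs_check adj (rep _)).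
by lia.
Qed.

Lemma star_not_bar : ~ graph_isomorphic Z star Z (NObar f).
Proof.
case=> h [h_inj hZ hE]; have [d dF] := frame_exists hf hnd hSg1 hSg2 hhyp hS hSg.
have xZ : d 17%num \in Z by rewrite (ZE dF) mem_dset_map // nonsingular17.
have yZ : d (rep 1) \in Z by rewrite (ZE dF) mem_dset_map // rep_nonsingular.
(* An isomorphism would give some pair of distinct points the count 306 in the other graph, where
   only 288 and 432 occur. *)
have := pair_count_iso h_inj hZ (hE tt) xZ yZ.
have i1 : (1 < 7)%N by [].
have i01 : (0 < 1 < 7)%N by [].
rewrite (coded_pair_count star_adj dF i1) (pairs_check_nth _ i01) pairs_star.
have hxZ : h (d 17%num) \in Z by rewrite -hZ imset_f.
have hyZ : h (d (rep 1)) \in Z by rewrite -hZ imset_f.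
have [d' [i [dF' i7 xE yE]]] := Zpair hxZ hyZ.
have i0 : (0 < i)%N.
  rewrite lt0n; apply/negP => /eqP i0; move: yE; rewrite i0 -xE.
  move/(h_inj _ _ yZ xZ)/(dec_inj (frame_decoder dF)).
  have r17 : rep 1 != 17%num by vm_compute.
  move=> /(_ (nonsingular_codes (rep_nonsingular i1)) (nonsingular_codes nonsingular17)).
  by apply/eqP.
have i07 : (0 < i < 7)%N by rewrite i0.
rewrite xE yE (coded_pair_count bar_adj dF' i7) (pairs_check_nth _ i07) pairs_bar.
by case: i i7 i0 {yE i07} => [|[|[|[|[|[|[|i]]]]]]].
Qed.

(** An automorphism preserves the number of adjacent pairs of common neighbours, and this number
    identifies the relation of two distinct points. *)
Lemma aut_rel (s : {perm V}) : s \in graph_aut Z star ->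
  {in Z, forall x, s x \in Z} /\
  {in Z &, forall x y, forall i : 'I_7, ((s x, s y) \in R i) = ((x, y) \in R i)}.
Proof.
rewrite inE => /andP[sZ /forall_inP sE].
have sZ' x : x \in Z -> s x \in Z by rewrite (perm_closed x sZ).
split=> // x y xZ yZ j; have [d [i [dF i7 xE yE]]] := Zpair xZ yZ.
have [d' [i' [dF' i7' xE' yE']]] := Zpair (sZ' _ xZ) (sZ' _ yZ).
have rr := rel_rep hf hnd hhyp hS hSg1 hSg2 hSg hY hY120.
have := pair_count_iso (X := Z) (E := star) (E' := star) (h := s) (in2W (@perm_inj _ s)).
have sZZ : s @: Z = Z.
  by apply: eqEcard_T; [apply/subsetP => _ /imsetP[z /sZ' ? ->] | rewrite card_imset //; apply: perm_inj].
have sEE : {in Z &, forall a b, ((s a, s b) \in star) = ((a, b) \in star)}.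
  by move=> a b aZ bZ; have /forall_inP/(_ b bZ)/eqP := sE a aZ.
move=> /(_ sZZ sEE _ _ xZ yZ); rewrite xE' yE'.
rewrite (coded_pair_count star_adj dF' i7') xE yE (coded_pair_count star_adj dF i7).
rewrite (proj1 (rr _ _ _ dF i7 (ltn_ord j))) (proj1 (rr _ _ _ dF' i7' (ltn_ord j))).
(* The diagonal is treated apart, by injectivity of [s], because [pairs_star] starts with R_1. *)
have ii0 : (i == 0%N) = (i' == 0%N).
  have c17 := nonsingular_codes nonsingular17.
  have e0 (d1 : N -> V) i1 : frame d1 -> (i1 < 7)%N -> (i1 == 0%N) = (d1 17%num == d1 (rep i1)).
    move=> dF1 i17; rewrite (inj_in_eq (dec_inj (frame_decoder dF1)) c17); last first.
      exact: nonsingular_codes (rep_nonsingular i17).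
    have reps_uniq : uniq reps by vm_compute.
    by rewrite -[17%num]/(rep 0) nth_uniq.
  rewrite (e0 _ _ dF) // (e0 _ _ dF') // -xE -yE -xE' -yE'.
  by rewrite (inj_eq perm_inj).
suff inj : pairs_check adj_star (rep i') = pairs_check adj_star (rep i) -> i' = i.
  by move=> e; rewrite (inj e).
case: (posnP i) ii0 => [i0|i0]; first by rewrite i0 => /esym /eqP -> _.
move=> /esym/negbT; rewrite -lt0n => i0'.
have j07 : (0 < i < 7)%N by rewrite i0.
have j07' : (0 < i' < 7)%N by rewrite i0'.
rewrite (pairs_check_nth _ j07) (pairs_check_nth _ j07') pairs_star.
by case: i i7 i0 {yE j07} => [|[|[|[|[|[|[|i]]]]]]] // _ _;
   case: i' i7' i0' {yE' j07'} => [|[|[|[|[|[|[|i']]]]]]].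
Qed.

Lemma uniq_map_in (T1 T2 : eqType) (h : T1 -> T2) s : uniq (map h s) -> {in s &, injective h}.
Proof.
elim: s => //= z s IH /andP[hz us] x y; rewrite !inE.
case/predU1P => [->|xs] /predU1P[->|ys] // e.
- by move: hz; rewrite e map_f.
- by move: hz; rewrite -e map_f.
exact: IH.
Qed.

(** Since (17, 39) is in R_5 and [G*] is transitive on R_5, some t in [G*] agrees with s on these
    two points. Write s (d c) = t (d c'). Then c and c' have equal relations to 17 and 39, which
    forces c = c' for the rigid codes; equal relations to the rigid codes then force c = c' for
    every c. *)
Lemma aut_Gstar (s : {perm V}) : s \in graph_aut Z star ->
  exists2 t : {perm V}, t \in G & {in Z, s =1 t}.
Proof.
move=> /aut_rel[sZ sE]; have [d dF] := frame_exists hf hnd hSg1 hSg2 hhyp hS hSg.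
have n17 := nonsingular17; have n39 : 39%num \in nonsingular by rewrite -memNE; vm_compute.
have dZ c : c \in nonsingular -> d c \in Z by move=> cn; rewrite (ZE dF) mem_dset_map.
have r5 : (d 17%num, d 39%num) \in R (inord 5 : 'I_7).
  rewrite inordK // (relE dF) //; by vm_compute.
have r5s : (s (d 17%num), s (d 39%num)) \in R (inord 5 : 'I_7) by rewrite sE ?dZ.
have [t tG /= [t17 t39]] := rel_trans hf hnd hhyp hS hSg1 hSg2 hSg hY hY120 r5 r5s.
exists t => //; have tF := frame_act hSg1 hSg2 tG dF.
have sc c : c \in nonsingular -> exists2 c', c' \in nonsingular & s (d c) = t (d c').
  by move=> cn; have := sZ _ (dZ _ cn); rewrite (ZE tF) => /dsetP[c' c'n ->]; exists c'.
have rel7 a b : a \in nonsingular -> b \in nonsingular -> (rel_code a b < 7)%N.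
  move=> an bn; have [i iE] := rel_part hf hnd hhyp hS hSg1 hSg2 hSg hY hY120 (dZ _ an) (dZ _ bn).
  by have := iE i; rewrite eqxx (relE dF) // => /eqP ->.
have relst a a' b b' : a \in nonsingular -> b \in nonsingular -> a' \in nonsingular ->
    b' \in nonsingular -> s (d a) = t (d a') -> s (d b) = t (d b') ->
    rel_code a b = rel_code a' b'.
  move=> an bn an' bn' sa sb; have lt7 := rel7 _ _ an bn.
  have := sE _ _ (dZ _ an) (dZ _ bn) (Ordinal lt7).
  rewrite sa sb (relE dF) // eqxx -[t (d a')]/((t \o d) a') -[t (d b')]/((t \o d) b').
  by rewrite (relE tF) // => /eqP ->.
have fixr : {in rigid_codes, forall c, s (d c) = t (d c)}.
  move=> c cr; have cn := rigid_codes_sub cr; have [c' c'n cc'] := sc _ cn; rewrite cc'.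
  have pc' : pointed c' \in points by rewrite pointsE map_f.
  have /allP/(_ _ pc') := allP rigid_codesP _ cr.
  rewrite -!rel_codeP -(relst _ _ _ _ n17 cn n17 c'n (esym t17) cc') -(relst _ _ _ _ n39 cn n39 c'n (esym t39) cc').
  have eqnn m : eqn m m by elim: m.
  rewrite !eqnn => /N.eqb_eq e; have -> : c' = c := e.
  by [].
move=> z; rewrite (ZE dF) => /dsetP[c cn ->]; have [c' c'n cc'] := sc _ cn; rewrite cc'.
congr (t (d _)); suff e : pointed c' = pointed c by exact: (congr1 fst e).
apply: (uniq_map_in rigid_codes_uniq); rewrite ?pointsE ?map_f //.
rewrite -!map_comp; apply/eq_in_map => r rr /=; have rn := rigid_codes_sub rr.
by rewrite -!rel_codeP (relst _ _ _ _ rn cn rn c'n (fixr _ rr) cc').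
Qed.

Lemma Gstar_norm (t : {perm V}) : t \in G -> t \in 'N(Z | 'P)%g.
Proof.
move=> tG; rewrite /astabs in_setI in_setT inE; apply/subsetP => x xZ; rewrite inE.
exact: (Gstar_Z hf hnd hhyp hS hSg1 hSg2 hSg tG xZ).
Qed.

Lemma star_aut : graph_aut Z star = [set restr_perm Z s | s in G].
Proof.
apply/setP => s; apply/idP/imsetP => [sA|[t tG ->]].
  have [t tG st] := aut_Gstar sA; exists t => //.
  have /andP[sZ _] : perm_on Z s && true.
    by move: sA; rewrite inE => /andP[->].
  have tN := Gstar_norm tG.
  apply/permP => x; case: (boolP (x \in Z)) => xZ; first by rewrite restr_permE // st.
  by rewrite (out_perm sZ xZ) (out_perm (restr_perm_on Z t) xZ).
have tN := Gstar_norm tG.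
rewrite inE restr_perm_on /=; apply/forall_inP => x xZ; apply/forall_inP => y yZ.
rewrite !restr_permE //; have tR := rel_act hf hnd hhyp hS hSg1 hSg2 hSg hY hY120 tG xZ yZ.
have t3 : ((t x, t y) \in R 3%N) = ((x, y) \in R 3%N) := tR (@Ordinal 7 3 isT).
have t4 : ((t x, t y) \in R 4%N) = ((x, y) \in R 4%N) := tR (@Ordinal 7 4 isT).
have t6 : ((t x, t y) \in R 6%N) = ((x, y) \in R 6%N) := tR (@Ordinal 7 6 isT).
by rewrite !in_setU t3 t4 t6.
Qed.

End Graphs.

(** * The standard model and transport of results to other quadrics *)

Section Model.

Definition form8 (x : 'rV['F_2]_8) : 'F_2 :=
  \sum_(i < 4) x 0 (@lshift 4 4 i) * x 0 (@rshift 4 4 i).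

Definition dec8 (k : N) : 'rV['F_2]_8 := row_mx (nibble 0 k) (nibble 1 k) : 'rV_(4 + 4).

Lemma dec8P : decoder dec8.
Proof.
split=> [a b|k kc]; first by rewrite /dec8 !nibble_xor -add_row_mx.
move=> k0; apply: code_nibbles0 => //.
  have := congr1 (fun x : 'rV_8 => lsubmx (x : 'rV_(4 + 4))) k0.
  by rewrite row_mxKl linear0.
have := congr1 (fun x : 'rV_8 => rsubmx (x : 'rV_(4 + 4))) k0.
by rewrite row_mxKr linear0.
Qed.

Lemma form_dec8 : {in codes, forall k, form8 (dec8 k) = (qform k)%:R}.
Proof.
move=> k kc; rewrite -nibbles_qform // mxE; apply: eq_bigr => i _.
have -> : dec8 k 0 (@lshift 4 4 i) = nibble 0 k 0 i by exact: row_mxEl.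
have -> : dec8 k 0 (@rshift 4 4 i) = nibble 1 k 0 i by exact: row_mxEr.
by congr (_ * _); rewrite [RHS]mxE.
Qed.

Lemma quadric8 : quadric form8 = dset dec8 singular.
Proof. exact: dset_quadric dec8P form_dec8. Qed.

Lemma mul_polar (A : comNzRingType) (a b c e : A) :
  (a + b) * (c + e) - a * c - b * e = a * e + b * c.
Proof. by ring. Qed.

Lemma bilinear_term (A : comNzRingType) (t a b c e g h : A) :
  (t * a + b) * g + h * (t * c + e) = t * (a * g + h * c) + (b * g + h * e).
Proof. by ring. Qed.

Lemma bilinear_term_r (A : comNzRingType) (t a b c e g h : A) :
  h * (t * c + e) + (t * a + b) * g = t * (h * c + a * g) + (h * e + b * g).
Proof. by ring. Qed.

Lemma polar8 x y : polar form8 x y =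
  \sum_(i < 4) (x 0 (@lshift 4 4 i) * y 0 (@rshift 4 4 i)
                + y 0 (@lshift 4 4 i) * x 0 (@rshift 4 4 i)).
Proof.
rewrite /polar /form8 -!sumrB; apply: eq_bigr => i _; rewrite 2!mxE.
exact: mul_polar.
Qed.

Lemma form8_quadratic : quadratic_form form8.
Proof.
split=> [a x|].
  rewrite /form8 mulr_sumr; apply: eq_bigr => i _.
  by rewrite 2!mxE mulrACA expr2.
split=> y a u v; rewrite /= !polar8 mulr_sumr -big_split; apply: eq_bigr => i _ /=; rewrite 4!mxE.
  exact: bilinear_term.
exact: bilinear_term_r.
Qed.

Lemma form8_nondegenerate : nondegenerate_form form8.
Proof.
move=> x _ xP; have [k kc xE] := decoderP x dec8P.
have /allP h : all (fun k => N.eqb k 0 || has (fun j => bform k j) basis8) codes by vm_compute.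
case/orP: (h k kc) => [/N.eqb_eq k0|/hasP[j jb]]; first by rewrite xE k0 (dec0 dec8P).
have jc : j \in codes by apply: (subNP _ jb); vm_compute.
have := xP (dec8 j); rewrite xE /polar -(decD dec8P) !form_dec8 ?xor_codes // /bform.
by case: (qform (xor k j)); case: (qform k); case: (qform j).
Qed.

(** Being a subspace becomes a condition on the codes alone, hence independent of the decoder and of
    n. *)
Lemma psubspace_dset n (d : N -> 'rV['F_2]_n) l : decoder d -> {subset l <= codes} ->
  reflect (0%num \notin l /\ {in l &, forall a b, a != b -> xor a b \in l})
    (psubspace (dset d l)).
Proof.
move=> dP lc; apply: (iffP (psubspaceP _)) => -[l0 lD]; split.
- by rewrite -(mem_dset dP lc codes0) (dec0 dP).
- move=> a b al bl ab; rewrite -(mem_dset dP lc (xor_codes (lc _ al) (lc _ bl))) (decD dP).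
  apply: lD; rewrite ?mem_dset_map //; apply: contra ab => /eqP/(dec_inj dP) ->; rewrite ?lc //.
- by rewrite -(dec0 dP) (mem_dset dP lc codes0).
move=> _ _ /dsetP[a al ->] /dsetP[b bl ->] ab.
by rewrite -(decD dP) mem_dset_map // lD //; apply: contra ab => /eqP ->.
Qed.

Lemma form8_hyperbolic : hyperbolic_form form8.
Proof.
have sL : psubspace (dset dec8 low_block).
  apply/(psubspace_dset dec8P low_codes); split; first by rewrite -memNE; vm_compute.
  have h : all (fun a => all (fun b => (a == b) || memN (xor a b) low_block) low_block) low_block.
    by vm_compute.
  move=> a b al bl; have := allP (allP h _ al) _ bl; rewrite memNE.
  by case: (a == b).
exists <<enum (dset dec8 low_block)>>%VS; split.
  move=> x xL; case: (eqVneq x 0) => [->|x0]; first by rewrite form0 //; apply: form8_quadratic.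
  have : x \in dset dec8 low_block by rewrite (eqP sL) inE x0.
  case/dsetP => k kl ->; rewrite form_dec8 ?low_codes //.
  have /allP h : all (fun k => ~~ qform k) low_block by vm_compute.
  by have := h k kl; case: (qform k).
have := card_psubspace sL; rewrite (card_dset dec8P low_codes low_uniq).
rewrite -[_.+1]/(2 ^ 4)%N => /eqP; rewrite eqn_exp2l // => /eqP <-.
by [].
Qed.

Section Transport.
Variables (n : nat) (e : N -> 'rV['F_2]_n) (Qd : {set 'rV['F_2]_n}).
Hypotheses (eP : decoder e) (eQ : Qd = dset e singular).

Lemma psubspace_transport n' (d : N -> 'rV['F_2]_n') l : decoder d -> {subset l <= codes} ->
  psubspace (dset d l) = psubspace (dset e l).
Proof. by move=> dP lc; apply/psubspace_dset/psubspace_dset. Qed.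

(** Through the codes, subspaces inside [Qd] correspond to subspaces inside the standard quadric,
    with inclusions preserved; so maximality carries over. *)
Lemma generator_transport U : quadric_generator Qd U ->
  quadric_generator (quadric form8) (dset dec8 (decode e U)).
Proof.
move=> /maxsetP[/andP[sU UQ] Umax].
have Uc := sub_Qd_codes eQ UQ; have dc := @sub_decode n e U.
have sing l : {subset l <= singular} -> {subset l <= codes}.
  by move=> ls k /ls/singular_codes.
have sub_sing m (d : N -> 'rV['F_2]_m) l : decoder d -> {subset l <= codes} ->
    dset d l \subset dset d singular -> {subset l <= singular}.
  move=> dP lc /subsetP h k kl; rewrite -(mem_dset dP singular_codes (lc _ kl)).
  by apply: h; apply: mem_dset_map.
have us : {subset decode e U <= singular}.
  by apply: (sub_sing _ _ _ eP dc); rewrite (dset_decode_sub Uc) -eQ.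
apply/maxsetP; split.
  rewrite (psubspace_transport dec8P dc) (dset_decode_sub Uc) sU quadric8.
  exact: sub_dset us.
move=> W /andP[sW WQ] UW; have Wc := sub_Qd_codes quadric8 WQ.
have wc := @sub_decode _ dec8 W.
have ws : {subset decode dec8 W <= singular}.
  by apply: (sub_sing _ _ _ dec8P wc); rewrite (dset_decode_sub Wc) -quadric8.
rewrite -(dset_decode_sub Wc); apply: eq_dset.
have WE : dset e (decode dec8 W) = U.
  apply: Umax.
    rewrite -(psubspace_transport dec8P wc) (dset_decode_sub Wc) sW eQ /=.
    exact: sub_dset ws.
  rewrite -{1}(dset_decode_sub Uc); apply: sub_dset => k ku.
  rewrite (mem_decode dec8) dc // andbT (subsetP UW) //.
  exact: mem_dset_map.
by move=> k; rewrite -WE [RHS](decode_dset eP k wc).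
Qed.

Lemma generator_card_transport U : quadric_generator Qd U -> #|U| = 15%N.
Proof.
move=> gU; have /maxsetP[/andP[_ UQ] _] := gU.
have := generator_card form8_quadratic form8_nondegenerate form8_hyperbolic (generator_transport gU).
by rewrite (card_dset dec8P (@sub_decode _ e U) (decode_uniq e U))
  (size_decode eP (sub_Qd_codes eQ UQ)).
Qed.

Lemma pair_frame_transport U1 U2 : psubspace U1 -> psubspace U2 ->
  U1 \subset Qd -> U2 \subset Qd -> #|U1| = 15%N -> #|U2| = 15%N -> [disjoint U1 & U2] ->
  exists e', [/\ decoder e', Qd = dset e' singular, U1 = dset e' low_block
               & U2 = dset e' high_block].
Proof.
move=> s1 s2 q1 q2 c1 c2 dis.
pose u U := dset dec8 (decode e U).
have uc U : {subset decode e U <= codes} := @sub_decode _ e U.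
have uK (U : {set 'rV_n}) : U \subset Qd -> dset e (decode e U) = U.
  by move=> UQ; exact: (dset_decode_sub (sub_Qd_codes eQ UQ)).
have us (U : {set 'rV_n}) : psubspace U -> U \subset Qd -> psubspace (u U).
  by move=> sU UQ; rewrite /u (psubspace_transport dec8P (uc U)) uK.
have uq (U : {set 'rV_n}) : U \subset Qd -> u U \subset quadric form8.
  move=> UQ; rewrite quadric8; apply: sub_dset => k; rewrite mem_decode => /andP[kU kc].
  by rewrite -(mem_Qd eP eQ kc) (subsetP UQ).
have ucard (U : {set 'rV_n}) : U \subset Qd -> #|U| = 15%N -> #|u U| = 15%N.
  move=> UQ cU; rewrite (card_dset dec8P (uc U) (decode_uniq _ _)) (size_decode eP) //.
  exact: (sub_Qd_codes eQ UQ).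
have udis : [disjoint u U1 & u U2].
  rewrite -setI_eq0; apply/eqP/setP => x; rewrite !inE; apply/negP => /andP[/dsetP[k]].
  rewrite mem_decode => /andP[k1 kc] ->; rewrite (mem_dset dec8P (uc _) kc) mem_decode kc andbT.
  by move=> k2; have /setP/(_ (e k)) := disjoint_setI0 dis; rewrite !inE k1 k2.
have [d [dP dQ d1 d2]] := pair_frame form8_quadratic form8_nondegenerate
  (us _ s1 q1) (us _ s2 q2) (uq _ q1) (uq _ q2) (ucard _ q1 c1) (ucard _ q2 c2) udis.
(* The frame [d] found in the standard model, read back in codes by [dec8] and then decoded by
   [e]. *)
pose e' k := e (code_of dec8 (d k)).
have cP x : code_of dec8 x \in codes.
  by have [k kc ->] := decoderP x dec8P; rewrite code_ofK //; exact: dec8P.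
have cE x : dec8 (code_of dec8 x) = x.
  by have [k kc ->] := decoderP x dec8P; rewrite code_ofK //; exact: dec8P.
have e'P : decoder e'.
  split=> [a b|k kc]; rewrite /e'.
    rewrite -(decD eP); congr e; apply: (dec_inj dec8P); rewrite ?xor_codes ?cP //.
    apply: etrans (cE _) _; apply: etrans (decD dP a b) _.
    apply: esym; apply: etrans (decD dec8P _ _) _.
    by congr (_ + _); exact: cE.
  move/(dec_eq0 eP (cP _)) => c0; apply: (dec_eq0 dP kc).
  by rewrite -(cE (d k)) c0 (dec0 dec8P).
have e'E l m : {subset m <= codes} -> dset d l = dset dec8 m -> dset e' l = dset e m.
  move=> mc lm; apply/setP => x; apply/dsetP/dsetP => -[k kl ->].
    have : d k \in dset dec8 m by rewrite -lm mem_dset_map.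
    by case/dsetP => j jm jE; exists j; rewrite // /e' jE code_ofK ?mc //; exact: dec8P.
  have : dec8 k \in dset d l by rewrite lm mem_dset_map.
  by case/dsetP => j jl jE; exists j; rewrite // /e' -jE code_ofK ?mc //; exact: dec8P.
exists e'; split; first exact: e'P.
- by rewrite eQ; symmetry; apply: (e'E _ _ singular_codes); rewrite -dQ quadric8.
- by rewrite -[LHS]uK //; symmetry; apply: (e'E _ _ (uc _)); rewrite -d1.
by rewrite -[LHS]uK //; symmetry; apply: (e'E _ _ (uc _)); rewrite -d2.
Qed.

End Transport.
End Model.

(** * The model on the vectors of F_2^9 with coordinate sum 0 *)

Definition cols9 : seq N := [:: 510; 172; 312; 240; 509; 340; 408; 480]%num.

Definition bits9 (k : N) : 'rV['F_2]_9 := \row_j (N.testbit k (N.of_nat j))%:R.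

(* The isometry onto the model on F_2^9 that maps root to the points Q_1, ..., Q_9. *)
Definition dec9 (k : N) : 'rV['F_2]_9 := bits9 (lin cols9 k).

Local Notation W := 'rV['F_2]_9.

Lemma dec9_cols : all (fun k => N.eqb k 0 || has (fun j => N.testbit (lin cols9 k) (N.of_nat j)) (iota 0 9)) codes.
Proof. by vm_compute. Qed.

Lemma dec9_rootE : all (fun i => all (fun j =>
  N.testbit (lin cols9 (nth 0%num root i)) (N.of_nat j) == (j != i)) (iota 0 9)) (iota 0 9).
Proof. by vm_compute. Qed.

Lemma dec9E k (j : 'I_9) : dec9 k 0 j = (N.testbit (lin cols9 k) (N.of_nat j))%:R.
Proof. by rewrite mxE. Qed.

Lemma root_span : {subset codes <= spanl root}.
Proof. by apply: subNP; vm_compute. Qed.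

#[global] Opaque cols9.
#[global] Arguments lin : simpl never.

Lemma mem_iota9 (i : 'I_9) : val i \in iota 0 9.
Proof. by rewrite mem_iota /= add0n ltn_ord. Qed.

Lemma dec9P : decoder dec9.
Proof.
split=> [a b|k kc k0].
  apply/rowP => j; rewrite [RHS]mxE !dec9E lin_xor N.lxor_spec.
  by case: (N.testbit (lin cols9 a) _); case: (N.testbit (lin cols9 b) _); apply: val_inj.
case/orP: (allP dec9_cols _ kc) => [/N.eqb_eq //|/hasP[j]].
rewrite mem_iota /= add0n => j9 kj; have /rowP/(_ (Ordinal j9)) := k0.
by rewrite dec9E [N.testbit _ _]kj [X in _ = X]mxE => /eqP; rewrite oner_eq0.
Qed.

Lemma dec9_root (i : 'I_9) : dec9 (nth 0%num root i) = Qpoint i.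
Proof.
apply/rowP => j; rewrite dec9E [RHS]mxE.
by have /eqP -> := allP (allP dec9_rootE _ (mem_iota9 i)) _ (mem_iota9 j).
Qed.

Lemma root_nth_codes i : nth 0%num root i \in codes.
Proof.
case: (ltnP i (size root)) => si; first by apply: root_codes; rewrite mem_nth.
by rewrite nth_default ?codes0.
Qed.

(** Coordinate j of the right side is the sum of the x_i with i distinct from j, which is x_j when
    the total is 0. *)
Lemma sum_Qpoint (x : W) : \sum_i x 0 i = 0 -> x = \sum_i x 0 i *: Qpoint i.
Proof.
move=> x0; apply/rowP => j; rewrite summxE.
have -> : \sum_(i < 9) (x 0 i *: Qpoint i) 0 j = \sum_(i < 9) (x 0 i - x 0 i * (j == i)%:R).
  apply: eq_bigr => i _; rewrite !mxE.
  by case: (j == i); rewrite ?mulr0 ?mulr1 ?subrr ?subr0.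
rewrite sumrB x0 sub0r (bigD1 j) //= eqxx mulr1 big1 ?addr0 => [|i ij].
  by case: (F2_cases (x 0 j)) => ->; apply: val_inj.
by rewrite eq_sym (negPf ij) mulr0.
Qed.

Lemma even_dec9 (x : W) : \sum_i x 0 i = 0 -> x \in dset dec9 codes.
Proof.
move=> /sum_Qpoint ->; apply: (big_ind (fun z => z \in dset dec9 codes)).
- by rewrite -(dec0 dec9P) mem_dset_map ?codes0.
- move=> _ _ /dsetP[a ac ->] /dsetP[b bc ->].
  by rewrite -(decD dec9P) mem_dset_map ?xor_codes.
move=> i _; case: (F2_cases (x 0 i)) => ->.
  by rewrite scale0r -(dec0 dec9P) mem_dset_map ?codes0.
by rewrite scale1r -dec9_root mem_dset_map ?root_nth_codes.
Qed.

Lemma natr_odd (m : nat) : (m%:R : 'F_2) = (odd m)%:R.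
Proof.
elim: m => // m IH; rewrite -natr1 IH /=.
by case: (odd m); apply: val_inj.
Qed.

Definition weight9 (k : N) : nat :=
  sumn [seq nat_of_bool (N.testbit (lin cols9 k) (N.of_nat j)) | j <- iota 0 9].

Definition pairs9 (k : N) : nat :=
  sumn [seq sumn [seq nat_of_bool [&& i < j, N.testbit (lin cols9 k) (N.of_nat i)
    & N.testbit (lin cols9 k) (N.of_nat j)] | j <- iota 0 9] | i <- iota 0 9]%N.

Lemma dec9_even : all (fun k => ~~ odd (weight9 k) && (odd (pairs9 k) == qform k)) codes.
Proof. by vm_compute. Qed.

Lemma sum_ord9 (F : nat -> nat) : (\sum_(i < 9) F i = sumn [seq F i | i <- iota 0 9])%N.
Proof. by rewrite sumnE big_map -[iota 0 9]/(index_iota 0 9) big_mkord. Qed.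

Lemma quadric9E : quadric9 = dset dec9 singular.
Proof.
have wE k : k \in codes -> \sum_i dec9 k 0 i = 0.
  move=> kc; have /andP[/negPf wk _] := allP dec9_even _ kc.
  have -> : \sum_i dec9 k 0 i = (weight9 k)%:R.
    by rewrite /weight9 -sum_ord9 natr_sum; apply: eq_bigr => i _; rewrite dec9E.
  by rewrite natr_odd wk.
have pE k : k \in codes ->
    \sum_(i < 9) \sum_(j < 9 | (i < j)%N) dec9 k 0 i * dec9 k 0 j = (qform k)%:R.
  move=> kc; have /andP[_ /eqP <-] := allP dec9_even _ kc.
  rewrite -natr_odd /pairs9 -sum_ord9 natr_sum; apply: eq_bigr => i _.
  rewrite -sum_ord9 natr_sum big_mkcond; apply: eq_bigr => j _.
  rewrite !dec9E; case: (i < j)%N; last by [].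
  by rewrite -natrM mulnb.
apply/setP => x; rewrite inE; apply/and3P/dsetP => [[x0 xe]|[k]].
  have /dsetP[k kc xE] := even_dec9 (eqP xe); rewrite xE (pE k kc) => qk.
  exists k; last by []; rewrite singularE kc andTb; apply/andP; split.
    by apply: contra x0 => /eqP k0; rewrite xE k0 (dec0 dec9P).
  by case: (qform k) qk.
rewrite singularE => /and3P[kc k0 qk] ->; split; last by rewrite pE // (negPf qk).
  by apply: contra k0 => /eqP/(dec_eq0 dec9P kc) ->.
by rewrite wE.
Qed.

Lemma Qpoint_inj : injective Qpoint.
Proof.
by move=> i j /rowP/(_ i); rewrite !mxE eqxx; case: eqVneq.
Qed.

Lemma Qpoint_nonperp (i j : 'I_9) : Qpoint i + Qpoint j \notin quadric9.
Proof.
rewrite -!dec9_root -(decD dec9P) quadric9E.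
rewrite (mem_dset dec9P singular_codes) ?xor_codes ?root_nth_codes //.
have h : all (fun a => all (fun b => ~~ memN (xor a b) singular) root) root by vm_compute.
have rin (l : 'I_9) : nth 0%num root l \in root by rewrite mem_nth.
by have := allP (allP h _ (rin i)) _ (rin j); rewrite memNE.
Qed.

Lemma Qpoint_quadric i : Qpoint i \in quadric9.
Proof.
rewrite -dec9_root quadric9E; apply: mem_dset_map.
have h : {subset root <= singular} by apply: subNP; vm_compute.
by apply: h; rewrite mem_nth.
Qed.

(** * Coordinate permutations acting on spreads, and the two invariants *)

Lemma col_perm_add (s : 'S_9) : {morph (fun x : W => col_perm s x) : x y / x + y}.
Proof. by move=> x y; apply/rowP => j; rewrite !mxE. Qed.

Lemma col_perm_inj (s : 'S_9) : injective (fun x : W => col_perm s x).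
Proof. by move=> x y /rowP h; apply/rowP => j; have := h ((s^-1)%g j); rewrite !mxE permKV. Qed.

(** [col_perm s] reads coordinate [s j] at place j, so it permutes the points Q_i by the inverse of
    s. This accounts for [s i] in [pblock_act] and for the inverses in [gen_perm]. *)
Lemma col_perm_Qpoint (s : 'S_9) i : col_perm s (Qpoint (s i)) = Qpoint i.
Proof. by apply/rowP => j; rewrite !mxE (inj_eq perm_inj). Qed.

Local Notation act s U := [set col_perm s x | x in (U : {set W})].

Lemma psubspace_act (s : 'S_9) (U : {set W}) : psubspace U -> psubspace (act s U).
Proof.
have s0 : col_perm s (0 : W) = 0 by apply/rowP => j; rewrite !mxE.
move=> /psubspaceP[U0 UD]; apply/psubspaceP; split.
  by apply/imsetP => -[x xU]; rewrite -{1}s0 => /col_perm_inj x0; rewrite x0 xU in U0.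
move=> _ _ /imsetP[x xU ->] /imsetP[y yU ->] xy; rewrite -col_perm_add imset_f // UD //.
by apply: contra xy => /eqP ->.
Qed.

Lemma pdim_eq (n n' : nat) (U : {set 'rV['F_2]_n}) (U' : {set 'rV['F_2]_n'}) :
  psubspace U -> psubspace U' -> #|U| = #|U'| -> pdim U = pdim U'.
Proof.
move=> sU sU' UU'; rewrite (pdim_psubspace sU' (m := \dim <<enum U>>)) //.
by rewrite -UU' card_psubspace.
Qed.

Lemma act_setI (s : 'S_9) (U U' : {set W}) : act s U :&: act s U' = act s (U :&: U').
Proof. by rewrite -imsetI // => x y _ _; apply: col_perm_inj. Qed.

Lemma pdim_act (s : 'S_9) (U U' : {set W}) : psubspace U -> psubspace U' ->
  pdim (act s U :&: act s U') = pdim (U :&: U').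
Proof.
move=> sU sU'; rewrite act_setI; apply: pdim_eq; rewrite ?psubspace_act ?psubspaceI //.
by rewrite card_imset //; apply: col_perm_inj.
Qed.

Lemma pline_act (s : 'S_9) (U U' : {set W}) : psubspace U -> psubspace U' ->
  pline (act s U :&: act s U') = pline (U :&: U').
Proof.
by move=> sU sU'; rewrite /pline pdim_act // act_setI psubspace_act psubspaceI.
Qed.

(** Enough for each point Q_i to lie in a well-defined member that is a subspace, which is all that
    the invariants refer to. *)
Definition good_spread (T : {set {set W}}) : Prop :=
  [/\ trivIset T, forall i, Qpoint i \in cover T & {in T, forall U, psubspace U}].

Lemma good_block T i : good_spread T -> pblock T (Qpoint i) \in T /\ Qpoint i \in pblock T (Qpoint i).
Proof. by case=> tT cT _; rewrite pblock_mem ?mem_pblock. Qed.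

Lemma act_inj (s : 'S_9) : injective (fun U : {set W} => act s U).
Proof. exact/imset_inj/col_perm_inj. Qed.

Lemma good_act (s : 'S_9) T : good_spread T -> good_spread (coord_act s T).
Proof.
move=> gT; have [tT cT sT] := gT; split.
- apply/trivIsetP => _ _ /imsetP[U UT ->] /imsetP[U' UT' ->] UU'.
  rewrite -setI_eq0 act_setI (_ : U :&: U' = set0) ?imset0 ?eqxx //.
  apply/disjoint_setI0/(trivIsetP tT) => //; by apply: contra UU' => /eqP ->.
- move=> i; have [bT Qb] := good_block (s i) gT; apply/bigcupP.
  by exists (act s (pblock T (Qpoint (s i)))); rewrite ?imset_f // -{1}(col_perm_Qpoint s) imset_f.
by move=> _ /imsetP[U UT ->]; apply/psubspace_act/sT.
Qed.

Lemma pblock_act (s : 'S_9) T i : good_spread T ->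
  pblock (coord_act s T) (Qpoint i) = act s (pblock T (Qpoint (s i))).
Proof.
move=> gT; have [tT _ _] := good_act s gT; have [bT Qb] := good_block (s i) gT.
by apply: def_pblock => //; rewrite ?imset_f // -{1}(col_perm_Qpoint s) imset_f.
Qed.

Definition fixes12 (s : 'S_9) : Prop := (s coord1 = coord1 /\ s coord2 = coord2)
  \/ (s coord1 = coord2 /\ s coord2 = coord1).

Lemma Inv1_act (s : 'S_9) A T : fixes12 s -> good_spread A -> good_spread T ->
  Inv1 (coord_act s A) (coord_act s T) = Inv1 A T.
Proof.
move=> s12 gA gT; have sb B i : good_spread B -> psubspace (pblock B (Qpoint i)).
  by move=> gB; have [bB _] := good_block i gB; case: gB => _ _; apply.
rewrite /Inv1 !pblock_act // !pdim_act ?sb //.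
by case: s12 => -[-> ->] //; rewrite addrC.
Qed.

Lemma Inv2_act (s : 'S_9) A T : fixes12 s -> good_spread A -> good_spread T ->
  Inv2 (coord_act s A) (coord_act s T) = Inv2 A T.
Proof.
move=> s12 gA gT; have sb B i : good_spread B -> psubspace (pblock B (Qpoint i)).
  by move=> gB; have [bB _] := good_block i gB; case: gB => _ _; apply.
rewrite /Inv2 -[RHS](card_imset _ (act_inj (s := s))); congr #|pred_of_set _|.
have s1 : forall i : 'I_9, (1 < s i)%N = (1 < i)%N.
  have g1 (i : 'I_9) : (1 < i)%N = (i != coord1) && (i != coord2).
    by case: i => [[|[|i]] i9].
  move=> i; rewrite !g1 -!(inj_eq (@perm_inj _ s) i).
  by case: s12 => -[-> ->] //; rewrite andbC.
apply/setP => U; rewrite inE !pblock_act //; apply/andP/imsetP => [[/imsetP[i i1 UE] h]|].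
  exists (pblock T (Qpoint (s i))); last by rewrite UE pblock_act.
  rewrite inE; apply/andP; split; first by apply/imsetP; exists (s i); rewrite // inE s1.
  move: h; rewrite UE !pblock_act // !pline_act ?sb //.
  by case: s12 => -[-> ->] //; rewrite andbC.
case=> U'; rewrite inE => /andP[/imsetP[i i1 ->] h] ->; split.
  apply/imsetP; exists ((s^-1)%g i); last by rewrite pblock_act // permKV.
  by rewrite inE -s1 permKV.
rewrite !pline_act ?sb //; move: h.
by case: s12 => -[-> ->] //; rewrite andbC.
Qed.

Lemma coord_act_inj (s : 'S_9) : injective (coord_act s).
Proof. exact/imset_inj/act_inj. Qed.

Lemma coord_actM (s t : 'S_9) A : coord_act (s * t) A = coord_act s (coord_act t A).
Proof.
rewrite /coord_act -imset_comp; apply: eq_imset => U /=.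
by rewrite -imset_comp; apply: eq_imset => x; apply/rowP => j; rewrite !mxE permM.
Qed.

Lemma spread_rel_act (s : 'S_9) (X : {set {set {set W}}}) A T (i : nat) : fixes12 s ->
  good_spread A -> good_spread T -> A \in X -> T \in X ->
  ((coord_act s A, coord_act s T) \in spread_rel [set coord_act s B | B in X] i)
  = ((A, T) \in spread_rel X i).
Proof.
move=> s12 gA gT AX TX.
rewrite [LHS]inE [RHS]inE !in_setX /= !(imset_f (coord_act s)) // AX TX.
by rewrite Inv1_act // Inv2_act // (inj_eq (@coord_act_inj s)).
Qed.

(** * Evaluations on the spreads of the table *)

Definition families (m : seq N) : seq (seq N) :=
  [seq [seq k <- codes | memN (lin m k) u] | u <- std_spread].

Lemma ovoid_maps_onto : all (fun m => subN codes (map (lin m) codes)) ovoid_maps.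
Proof. by vm_compute. Qed.

(* Among the eight spreads containing both blocks, only std_spread is fixed. *)
Lemma rot7_families : all (fun m => eqfamN (map (map (lin rot7)) (families m)) (families m)
  ==> eqfamN (families m) std_spread) ovoid_maps.
Proof. by vm_compute. Qed.

Lemma families_blocks : all (fun m => has (eqsetN low_block) (families m)
  && has (eqsetN high_block) (families m)) ovoid_maps.
Proof. by vm_compute. Qed.

Definition spread_sets (c : N) : seq (seq N) := map span1 (spread_code c).

(** The table follows one path to each code. This check shows that the spread reached does not
    depend on the path, so the assignment is equivariant under all generators. *)
Lemma spread_table : all (fun gh => all (fun c =>
    eqfamN (map (map (lin gh.2)) (spread_sets c)) (spread_sets (lin gh.1 c))) nonsingular) gen_pairs.
Proof. by vm_compute. Qed.

Definition block (c : N) (i : nat) : seq N :=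
  nth [::] (spread_sets c) (find (memN (nth 0%num root i)) (spread_sets c)).

Lemma block_root : all (fun c => all (fun i => (block c i \in spread_sets c) &&
  all (fun j => memN (nth 0%num root i) (block c j) == (i == j)) (iota 0 9)) (iota 0 9)) reps.
Proof. by vm_compute. Qed.

(** Hence the unordered pairs of the first two blocks over 17 and over c are distinct. *)
Lemma block_reps : all (fun c =>
  (~~ eqsetN (block 17 0) (block c 0) && ~~ eqsetN (block 17 0) (block c 1))
  || (~~ eqsetN (block 17 1) (block c 0) && ~~ eqsetN (block 17 1) (block c 1))) (behead reps).
Proof. by vm_compute. Qed.

Definition meet_size (u v : seq N) : nat := count (fun k => memN k v) u.

(* Vector space dimension, one more than the projective one. *)
Definition meet_dim (u v : seq N) : nat :=
  let s := meet_size u v in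
  (if eqn s 0 then 0 else if eqn s 1 then 1 else if eqn s 3 then 2
   else if eqn s 7 then 3 else 4)%N.

Definition inv1_code (a b : N) : nat * nat :=
  (meet_dim (block a 0) (block b 1), meet_dim (block a 1) (block b 0)).

Definition inv2_code (a b : N) : nat :=
  sumn [seq nat_of_bool [&& (1 < i)%N, meet_size (block b i) (block a 0) == 3%N
    & meet_size (block b i) (block a 1) == 3%N] | i <- iota 0 9].

Lemma meet_dim_reps : all (fun c =>
  ((meet_size (block 17 0) (block c 1)).+1 == 2 ^ meet_dim (block 17 0) (block c 1))%N &&
  ((meet_size (block 17 1) (block c 0)).+1 == 2 ^ meet_dim (block 17 1) (block c 0))%N) reps.
Proof. by vm_compute. Qed.

(** Each of the two vector space dimensions exceeds the projective one by 1. After subtracting 2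
    from the first entries, these are the values that define R_1', ..., R_6', in that order. *)
Lemma inv_reps : [seq ((inv1_code 17 c).1 + (inv1_code 17 c).2, inv2_code 17 c)%N | c <- behead reps]
  = [:: (4, 0); (0, 0); (0, 2); (4, 2); (2, 1); (2, 3)]%N.
Proof. by vm_compute. Qed.

(** * The group [H9] and its generators *)

Lemma fixes12P (s : 'S_9) : fixes12 s <-> s \in 'N([set coord1; coord2] | 'P)%g.
Proof.
rewrite /astabs in_setI in_setT inE /=; split=> [s12|/subsetP sN].
  by apply/subsetP => x; rewrite !inE /= !apermE => /orP[] /eqP ->;
     case: s12 => -[e1 e2]; rewrite ?e1 ?e2 eqxx ?orbT.
have h1 := sN coord1 (set21 _ _); have h2 := sN coord2 (set22 _ _).
have s_neq : s coord1 != s coord2 by rewrite (inj_eq perm_inj).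
move: h1 h2; rewrite !inE /= !apermE => /orP[] /eqP e1 /orP[] /eqP e2.
- by rewrite e1 e2 eqxx in s_neq.
- by left.
- by right.
by rewrite e1 e2 eqxx in s_neq.
Qed.

Lemma H9P (s : 'S_9) : reflect (~~ odd_perm s /\ fixes12 s) (s \in H9).
Proof.
rewrite /H9 in_setI Alt_even; apply: (iffP andP) => -[s0 s12]; split=> //.
  exact/fixes12P.
exact/fixes12P.
Qed.

Lemma H9J (t s : 'S_9) : t \in H9 -> fixes12 s -> (t ^ s)%g \in H9.
Proof.
move=> /H9P[t0 t12] s12; apply/H9P; rewrite odd_permJ; split=> //.
by apply/fixes12P; rewrite groupJ //; apply/fixes12P.
Qed.

Lemma H9M (t s : 'S_9) : t \in H9 -> s \in H9 -> (t * s)%g \in H9.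
Proof.
move=> /H9P[t0 t12] /H9P[s0 s12]; apply/H9P; rewrite odd_permM (negPf t0) (negPf s0).
by split=> //; apply/fixes12P; rewrite groupM //; apply/fixes12P.
Qed.

Lemma H9_1 : (1%g : 'S_9) \in H9.
Proof. by apply/H9P; rewrite odd_perm1; split=> //; left; rewrite !perm1. Qed.

Lemma fixes12V (s : 'S_9) : fixes12 s -> fixes12 (s^-1)%g.
Proof. by move=> /fixes12P sN; apply/fixes12P; rewrite groupV. Qed.

Lemma coord_act1 A : coord_act 1 A = A.
Proof.
rewrite /coord_act -[RHS]imset_id; apply: eq_imset => U /=.
by rewrite -[RHS]imset_id; apply: eq_imset => x; apply/rowP => j; rewrite mxE perm1.
Qed.

(** The points of [root] span, so a linear map that permutes them is the coordinate permutation
    inducing the same permutation of the Q_i. *)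
Lemma col_perm_code (p : 'S_9) h :
  (forall i : 'I_9, lin h (nth 0%num root i) = nth 0%num root (p i)) ->
  {in codes, forall k, col_perm p^-1 (dec9 k) = dec9 (lin h k)}.
Proof.
move=> ph k /root_span ks.
apply: (@additive_eq_on _ (fun k => col_perm p^-1 (dec9 k)) (fun k => dec9 (lin h k)) root _ _ _ _ ks).
- by move=> a b; rewrite (decD dec9P) col_perm_add.
- by move=> a b; rewrite lin_xor (decD dec9P).
move=> _ /(nthP 0%num)[i i9 <-]; have i9' : (i < 9)%N := i9.
have := ph (Ordinal i9'); rewrite /= => ->; rewrite (dec9_root (p (Ordinal i9'))).
by rewrite -[i]/(val (Ordinal i9')) dec9_root -(col_perm_Qpoint p^-1 (p _)) permK.
Qed.

Lemma act_dset (s : 'S_9) h (l : seq N) : {subset l <= codes} ->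
  {in codes, forall k, col_perm s (dec9 k) = dec9 (lin h k)} ->
  [set col_perm s x | x in dset dec9 l] = dset dec9 (map (lin h) l).
Proof.
move=> lc sh; apply/setP => x; apply/imsetP/dsetP => [[_ /dsetP[k kl ->] ->]|].
  by exists (lin h k); [apply: map_f | rewrite sh // lc].
by case=> _ /mapP[k kl ->] ->; exists (dec9 k); rewrite ?mem_dset_map // sh // lc.
Qed.

Lemma coord_act_dsets (s : 'S_9) h (fam : seq (seq N)) : {in fam, forall l, {subset l <= codes}} ->
  {in codes, forall k, col_perm s (dec9 k) = dec9 (lin h k)} ->
  coord_act s (dsets dec9 fam) = dsets dec9 (map (map (lin h)) fam).
Proof.
move=> fc sh; apply/setP => U; apply/imsetP/dsetsP => [[_ /dsetsP[l lf ->] ->]|].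
  by exists (map (lin h) l); [apply: map_f | apply: act_dset => //; apply: fc].
case=> _ /mapP[l lf ->] ->; exists (dset dec9 l); rewrite ?mem_dsets //.
by rewrite (act_dset (fc _ lf) sh).
Qed.

Local Notation ord9 i := (@Ordinal 9 i isT).

(** The 7-cycle that [rot7] induces on the points of [root]. It and the next two permutations are
    products of transpositions, which makes their parity a count. *)
Definition perm7 : 'S_9 :=
  (tperm (ord9 2) (ord9 3) * tperm (ord9 2) (ord9 5) * tperm (ord9 2) (ord9 4) * tperm (ord9 2) (ord9 7)
   * tperm (ord9 2) (ord9 8) * tperm (ord9 2) (ord9 6))%g.

Definition perm6 : 'S_9 :=
  (tperm (ord9 0) (ord9 1) * (tperm (ord9 3) (ord9 8) * tperm (ord9 3) (ord9 7) * tperm (ord9 3) (ord9 6)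
   * tperm (ord9 3) (ord9 5) * tperm (ord9 3) (ord9 4)))%g.

Definition perm2 : 'S_9 := (tperm (ord9 0) (ord9 1) * tperm (ord9 3) (ord9 8))%g.

Lemma perm7E (i : 'I_9) : lin rot7 (nth 0%num root i) = nth 0%num root (perm7 i).
Proof.
by rewrite !permM !permE; case: i => [[|[|[|[|[|[|[|[|[|i]]]]]]]]] //= i9]; vm_compute.
Qed.

Lemma perm6E (i : 'I_9) : lin rot6 (nth 0%num root i) = nth 0%num root (perm6 i).
Proof.
by rewrite !permM !permE; case: i => [[|[|[|[|[|[|[|[|[|i]]]]]]]]] //= i9]; vm_compute.
Qed.

Lemma perm2E (i : 'I_9) : lin swap_ovoid (nth 0%num root i) = nth 0%num root (perm2 i).
Proof.
by rewrite !permM !permE; case: i => [[|[|[|[|[|[|[|[|[|i]]]]]]]]] //= i9]; vm_compute.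
Qed.

Lemma gen_perm : {in gen_pairs, forall gh, exists2 s : 'S_9, s \in H9 &
  {in codes, forall k, col_perm s (dec9 k) = dec9 (lin gh.2 k)}}.
Proof.
have HV (p : 'S_9) : ~~ odd_perm p -> fixes12 p -> (p^-1)%g \in H9.
  by move=> p0 p12; apply/H9P; rewrite odd_permV; split=> //; apply: fixes12V.
have E : gen_pairs = [:: (rot7, rot7); (rot6, rot6); (swap_spread, swap_ovoid)] by [].
move=> gh; rewrite E !inE => /or3P[] /eqP -> /=.
- exists (perm7^-1)%g; last exact: col_perm_code perm7E.
  apply: HV; first by rewrite !odd_permM !odd_tperm.
  by left; split; apply: val_inj; rewrite !permM !permE.
- exists (perm6^-1)%g; last exact: col_perm_code perm6E.
  apply: HV; first by rewrite !odd_permM !odd_tperm.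
  by right; split; apply: val_inj; rewrite !permM !permE.
exists (perm2^-1)%g; last exact: col_perm_code perm2E.
apply: HV; first by rewrite !odd_permM !odd_tperm.
by right; split; apply: val_inj; rewrite !permM !permE.
Qed.

Lemma std_codes : {in std_spread, forall u, {subset u <= codes}}.
Proof.
move=> u us; have /andP[/andP[/subNP h _] _] := allP std_spread_ok _ us.
by move=> k /h/singular_codes.
Qed.

Lemma families_codes m : {in families m, forall u, {subset u <= codes}}.
Proof. by move=> _ /mapP[v _ ->] k; rewrite mem_filter => /andP[]. Qed.

Lemma families_dsets (d : N -> W) m : m \in ovoid_maps ->
  dsets d std_spread = dsets (d \o lin m) (families m).
Proof.
move=> mm; rewrite /families; have /subNP onto := allP ovoid_maps_onto _ mm.
have E : {in std_spread, forall u, dset (d \o lin m) [seq k <- codes | memN (lin m k) u] = dset d u}.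
  move=> u us; apply/setP => x; apply/dsetP/dsetP => [[k]|[j ju ->]].
    by rewrite mem_filter memNE => /andP[ku _] ->; exists (lin m k).
  have /mapP[k kc jE] := onto _ (std_codes us ju).
  by exists k; rewrite /= -?jE // mem_filter memNE -jE ju.
apply/setP => U; apply/dsetsP/dsetsP => [[u us ->]|[_ /mapP[u us ->] ->]].
  by exists [seq k <- codes | memN (lin m k) u]; [apply/mapP; exists u | rewrite E].
by exists u; rewrite ?E.
Qed.

(** * Spreads of the model up to coordinate permutations *)

Section SpreadOrbit.
Variables (rho : {set W}) (X : {set {set {set W}}}).
Hypotheses (hX : X \in spread_orbits rho) (hX120 : #|X| = 120%N).

Lemma orbit_spread : exists A, cspread quadric9 A /\ X = [set coord_act s A | s in H9].
Proof.
case/imsetP: hX => A; rewrite inE => /andP[/andP[/forallP gA pA] _] ->; exists A; split=> //.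
split=> // U UA; have gU : quadric_generator quadric9 U by move/implyP: (gA U); apply.
split; last exact: (generator_card_transport dec9P quadric9E gU).
by have /maxsetP[/andP[sU _] _] := gU; exact: sU.
Qed.

Lemma cspread_good A : cspread quadric9 A -> good_spread A.
Proof.
case=> pA gA; have /and3P[/eqP cA tA _] := pA; split=> // [i|U /gA[]//].
by rewrite cA Qpoint_quadric.
Qed.

Lemma Qpoint_sum_nonsingular (e : N -> W) a b i j : decoder e -> quadric9 = dset e singular ->
  a \in codes -> b \in codes -> Qpoint i = e a -> Qpoint j = e b -> i != j -> xor a b \in nonsingular.
Proof.
move=> eP eQ ac bc ia jb ij; have xc := xor_codes ac bc.
have := Qpoint_nonperp i j; rewrite ia jb -(decD eP) (mem_Qd eP eQ xc) singularE xc /=.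
rewrite nonsingularE xc negb_and !negbK /= => /orP[/eqP/xor_eq0 ab|] //.
by case/negP: ij; apply/eqP/Qpoint_inj; rewrite ia jb ab.
Qed.

(** In any frame of A at the two blocks, Q_1 + Q_2 is an anisotropic code; the generators in [gens]
    bring it to 17 by changing the frame. *)
Lemma spread_blocks_frame A : cspread quadric9 A -> exists e,
  (gframe quadric9 A (pblock A (Qpoint coord1)) (pblock A (Qpoint coord2)) e
   \/ gframe quadric9 A (pblock A (Qpoint coord2)) (pblock A (Qpoint coord1)) e)
  /\ e 17%num = Qpoint coord1 + Qpoint coord2.
Proof.
move=> cA; have gA := cspread_good cA; have [pA sA] := cA.
have [b1 Q1] := good_block coord1 gA; have [b2 Q2] := good_block coord2 gA.
set U1 := pblock A (Qpoint coord1) in b1 Q1 *; set U2 := pblock A (Qpoint coord2) in b2 Q2 *.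
have /and3P[/eqP covA tA _] := pA.
have [s1 c1] := sA _ b1; have [s2 c2] := sA _ b2.
have q1 : U1 \subset quadric9.
  by rewrite -covA; apply/subsetP => x xU; apply/bigcupP; exists U1.
have q2 : U2 \subset quadric9.
  by rewrite -covA; apply/subsetP => x xU; apply/bigcupP; exists U2.
have U12 : U1 != U2.
  apply/eqP => E; rewrite -E in Q2; case/negP: (Qpoint_nonperp coord1 coord2).
  apply: (subsetP q1); have /psubspaceP[_ h] := s1; apply: h => //.
  by apply/eqP => /Qpoint_inj.
have dis : [disjoint U1 & U2] by apply: (trivIsetP tA).
have [e0 [e0P e0Q e01 e02]] := pair_frame_transport dec9P quadric9E s1 s2 q1 q2 c1 c2 dis.
have [||e1 e1F] := spread_frame e0P e0Q cA; rewrite -?e01 -?e02 //.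
rewrite -e01 -e02 in e1F.
have [e1P e1Q _ e1L e1H] := e1F.
have [a al ia] : exists2 a, a \in low_block & Qpoint coord1 = e1 a.
  by apply/dsetP; rewrite -e1L.
have [b bh ib] : exists2 b, b \in high_block & Qpoint coord2 = e1 b.
  by apply/dsetP; rewrite -e1H.
have cn := Qpoint_sum_nonsingular e1P e1Q (low_codes al) (high_codes bh) ia ib isT.
rewrite ia ib -(decD e1P).
have : gframe quadric9 A U1 U2 e1 \/ gframe quadric9 A U2 U1 e1 by left.
move: (xor a b) cn e1 {e1F e1P e1Q e1L e1H ia ib}.
apply: nonsingular_ind => [e eF|g gG c IH e eF]; first by exists e.
have gF := allP gens_frame _ gG.
apply: (IH (e \o lin g)).
by case: eF => /(gframe_lin gF) []; [left|right|right|left].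
Qed.

(** In a frame of A with Q_1 + Q_2 at 17, the ovoid of the Q_i passes through 1 and 16, so some m of
    [ovoid_maps] turns it into [root], and A into [families m]. The new frame and [dec9] both send
    [root] to the Q_i, hence differ by a coordinate permutation. *)
Lemma spread_standard A : cspread quadric9 A -> exists s m,
  [/\ fixes12 s, m \in ovoid_maps & A = coord_act s (dsets dec9 (families m))].
Proof.
move=> cA; have [e [eF e17]] := spread_blocks_frame cA; have gA := cspread_good cA.
have [_ Q1] := good_block coord1 gA; have [_ Q2] := good_block coord2 gA.
have [eP eQ eS] : [/\ decoder e, quadric9 = dset e singular & A = dsets e std_spread].
  by case: eF => -[].
have [a [b [[al bh] ab]]] : exists a b, (a \in low_block /\ b \in high_block) /\
    ((Qpoint coord1 = e a /\ Qpoint coord2 = e b) \/ (Qpoint coord1 = e b /\ Qpoint coord2 = e a)).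
  case: eF => [[_ _ _ E1 E2]|[_ _ _ E2 E1]]; rewrite E1 in Q1; rewrite E2 in Q2.
    case/dsetP: Q1 => a al ia; case/dsetP: Q2 => b bh ib.
    by exists a, b; split=> //; left.
  case/dsetP: Q1 => b bh ib; case/dsetP: Q2 => a al ia.
  by exists a, b; split=> //; right.
have xc : xor a b \in codes := xor_codes (low_codes al) (high_codes bh).
have [a1 b16] : a = 1%num /\ b = 16%num.
  apply: low_high17 => //; apply: (dec_inj eP xc (nonsingular_codes nonsingular17)).
  by rewrite (decD eP) e17; case: ab => -[-> ->]; rewrite // addrC.
subst a b; pose O : {set W} := [set Qpoint i | i : 'I_9].
have OQ : O \subset quadric9 by apply/subsetP => _ /imsetP[i _ ->]; apply: Qpoint_quadric.
have cO : #|O| = 9%N by rewrite card_imset ?card_ord //; apply: Qpoint_inj.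
have ON : {in O &, forall x y, x + y \notin quadric9}.
  by move=> _ _ /imsetP[i _ ->] /imsetP[j _ ->]; apply: Qpoint_nonperp.
have [O1 O16] : e 1%num \in O /\ e 16%num \in O.
  by case: ab => -[<- <-]; rewrite !imset_f.
have [m [mm mi mb m17 OE]] := ovoid_frame eP eQ OQ cO ON O1 O16.
have e2P : decoder (e \o lin m) by apply: decoder_lin => //; case/andP: mi.
have [m1 m16] : lin m 1 = 1%num /\ lin m 16 = 16%num.
  case/andP: mb => /eqsetNP ml /eqsetNP mh; apply: low_high17.
  - by rewrite -ml map_f.
  - by rewrite -mh map_f.
  by rewrite -lin_xor.
pose r i := nth 0%num root i.
have rP (i : 'I_9) : exists j : 'I_9, Qpoint j == (e \o lin m) (r i).
  have : (e \o lin m) (r i) \in O by rewrite OE mem_dset_map // mem_nth.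
  by case/imsetP => j _ ->; exists j.
(* The order in which the frame lists the points Q_j. *)
pose pf i := xchoose (rP i).
have pfE i : Qpoint (pf i) = (e \o lin m) (r i) by apply/eqP; exact: (xchooseP (rP i)).
have root_uniq : uniq root by vm_compute.
have pf_inj : injective pf.
  move=> i j ij; apply: val_inj; apply/eqP.
  rewrite -(nth_uniq 0%num _ _ root_uniq) ?ltn_ord //; apply/eqP.
  by apply: (dec_inj e2P); rewrite ?root_nth_codes // -!pfE ij.
pose p := perm pf_inj.
have pE i : Qpoint (p i) = (e \o lin m) (r i) by rewrite permE.
have p12 : fixes12 p.
  have p1 : Qpoint (p coord1) = e 1%num by rewrite pE /= -[in RHS]m1.
  have p2 : Qpoint (p coord2) = e 16%num by rewrite pE /= -[in RHS]m16.
  by case: ab => -[i1 i2]; [left|right]; split; apply: Qpoint_inj; rewrite ?p1 ?p2.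
have e2E : {in codes, forall k, (e \o lin m) k = col_perm p^-1 (dec9 k)}.
  move=> k /root_span ks.
  apply: (@additive_eq_on _ (e \o lin m) (fun k => col_perm p^-1 (dec9 k)) root _ _ _ _ ks).
  - exact: (decD e2P).
  - by move=> x y; rewrite (decD dec9P) col_perm_add.
  move=> _ /(nthP 0%num)[i i9 <-]; have i9' : (i < 9)%N := i9.
  by rewrite -[i]/(val (Ordinal i9')) dec9_root -(pE (Ordinal i9'))
    -(col_perm_Qpoint p^-1 (p _)) permK.
exists (p^-1)%g, m; split=> //; first exact: fixes12V.
rewrite {1}eS (families_dsets _ mm).
have E l : {subset l <= codes} ->
    dset (e \o lin m) l = [set col_perm p^-1 x | x in dset dec9 l].
  move=> lc; apply/setP => x; apply/dsetP/imsetP => [[k kl ->]|[_ /dsetP[k kl ->] ->]].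
    by exists (dec9 k); [exact: mem_dset_map | exact: e2E (lc _ kl)].
  by exists k; rewrite // (e2E _ (lc _ kl)).
apply/setP => U; apply/dsetsP/imsetP => [[l lf ->]|[_ /dsetsP[l lf ->] ->]].
  by exists (dset dec9 l); [exact: mem_dsets | exact: E (families_codes lf)].
by exists l; rewrite // (E _ (families_codes lf)).
Qed.

Definition couple (T : {set {set W}}) : {set {set W}} :=
  [set pblock T (Qpoint coord1); pblock T (Qpoint coord2)].

Lemma couple_act (s : 'S_9) T : fixes12 s -> good_spread T ->
  couple (coord_act s T) = [set [set col_perm s x | x in (U : {set W})] | U in couple T].
Proof.
move=> s12 gT; rewrite /couple !pblock_act // imsetU1 imset_set1.
by case: s12 => -[-> ->] //; rewrite setUC.
Qed.

(** [H9] is normalised by s, so s moves [H9]-orbits to [H9]-orbits even when it is odd. *)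
Lemma orbit_standard : exists2 s : 'S_9, fixes12 s & exists2 m, m \in ovoid_maps &
  good_spread (dsets dec9 (families m)) /\
  X = [set coord_act s B | B in [set coord_act t (dsets dec9 (families m)) | t in H9]].
Proof.
have [A [cA XE]] := orbit_spread; have [s [m [s12 mm AE]]] := spread_standard cA.
exists s => //; exists m => //; split.
  rewrite -[dsets _ _]coord_act1 -(mulVg s) coord_actM -AE.
  exact/good_act/cspread_good.
rewrite XE -imset_comp; apply/setP => B; apply/imsetP/imsetP => -[t tH ->].
  exists (t ^ s)%g; first exact: H9J.
  by rewrite AE /= -!coord_actM conjgE !mulgA mulgV mul1g.
exists (t ^ s^-1)%g; first exact: H9J tH (fixes12V s12).
by rewrite AE /= -!coord_actM conjgE invgK !mulgA mulgKV.
Qed.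

End SpreadOrbit.

(** * The orbit of 120 spreads through the standard one *)

Lemma std_spread_closed : all (fun u => ~~ memN 0 u && all (fun a => all (fun b =>
  N.eqb a b || memN (xor a b) u) u) u) std_spread.
Proof. by vm_compute. Qed.

Lemma std_spread_disjoint : all (fun u => all (fun v => eqsetN u v || ~~ meetN u v) std_spread)
  std_spread.
Proof. by vm_compute. Qed.

Lemma std_spread_root : all (fun i => has (memN (nth 0%num root i)) std_spread) (iota 0 9).
Proof. by vm_compute. Qed.

Lemma spread_bases_sets : map span1 spread_bases = std_spread.
Proof. by vm_compute. Qed.

Lemma rot7_blocks : fixes_blocks rot7. Proof. by vm_compute. Qed.

Lemma bases_std : all (fun e : entry => all (fun b => subN b codes) e.2.2) table.
Proof. by vm_compute. Qed.

Local Notation A0 := (dsets dec9 std_spread).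

Lemma good_std : good_spread A0.
Proof.
split.
- apply/trivIsetP => _ _ /dsetsP[u us ->] /dsetsP[v vs ->] uv.
  rewrite -setI_eq0; apply/eqP/setP => x; rewrite !inE; apply/negP => /andP[/dsetP[k ku ->]].
  rewrite (mem_dset dec9P (std_codes vs) (std_codes us ku)) => kv.
  case/orP: (allP (allP std_spread_disjoint _ us) _ vs) => [/eqsetNP uv'|/negP[]].
    by rewrite (eq_dset _ uv') eqxx in uv.
  by apply/hasP; exists k; rewrite // memNE.
- move=> i; have /hasP[u us] := allP std_spread_root _ (mem_iota9 i); rewrite memNE => iu.
  by apply/bigcupP; exists (dset dec9 u); rewrite ?mem_dsets // -dec9_root mem_dset_map.
move=> _ /dsetsP[u us ->]; apply/(psubspace_dset dec9P (std_codes us)).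
have /andP[u0 /allP uX] := allP std_spread_closed _ us; rewrite memNE in u0; split=> // a b au bu ab.
by have /orP[/N.eqb_eq e|] := allP (uX _ au) _ bu; [rewrite e eqxx in ab | rewrite memNE].
Qed.

Lemma dsets_eqfamN (f g : seq (seq N)) : {in f, forall u, {subset u <= codes}} ->
  {in g, forall u, {subset u <= codes}} -> dsets dec9 f = dsets dec9 g -> eqfamN f g.
Proof.
have half (f' g' : seq (seq N)) : {in f', forall u, {subset u <= codes}} -> {in g', forall u, {subset u <= codes}} ->
    dsets dec9 f' = dsets dec9 g' -> all (fun u => has (eqsetN u) g') f'.
  move=> fc gc fg; apply/allP => u uf; have : dset dec9 u \in dsets dec9 g' by rewrite -fg mem_dsets.
  case/dsetsP => v vg uv; apply/hasP; exists v => //.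
  have E := dset_inj dec9P (fc _ uf) (gc _ vg) uv.
  by apply/andP; split; apply/allP => k; rewrite memNE E.
by move=> fc gc fg; apply/andP; split; apply: half.
Qed.

Lemma couple_blocks T : good_spread T -> dset dec9 low_block \in T -> dset dec9 high_block \in T ->
  couple T = [set dset dec9 low_block; dset dec9 high_block].
Proof.
move=> [tT _ _] lT hT; rewrite /couple; congr [set _; _]; apply: def_pblock => //.
  by rewrite -(dec9_root coord1) (mem_dset_map _ one_low).
by rewrite -(dec9_root coord2) (mem_dset_map _ sixteen_high).
Qed.

Definition model_spread (c : N) : {set {set W}} := dsets dec9 (spread_sets c).

Local Notation orb A := [set coord_act t A | t in H9].

Lemma orbit_actH (s : 'S_9) A T : s \in H9 -> T \in orb A -> coord_act s T \in orb A.
Proof.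
move=> sH /imsetP[t tH ->]; rewrite -coord_actM; apply/imsetP.
by exists (s * t)%g; rewrite // H9M.
Qed.

Lemma orbit_good A T : good_spread A -> T \in orb A -> good_spread T.
Proof. by move=> gA /imsetP[t tH ->]; apply: good_act. Qed.

Lemma span1_map h b : span1 (map (lin h) b) = map (lin h) (span1 b).
Proof.
rewrite /span1 -behead_map; congr behead; elim: b => /= [|v b ->]; first by rewrite lin0.
by rewrite map_cat -!map_comp; congr cat; apply: eq_map => k /=; rewrite lin_xor.
Qed.

Lemma spread_sets_codes c : c \in nonsingular -> {in spread_sets c, forall u, {subset u <= codes}}.
Proof.
move=> /mem_lookup ct _ /mapP[b bs ->] k /mem_behead.
apply: (@spanlP (fun k => k \in codes)) => //; first exact: xor_codes.
exact: subNP (allP (allP bases_std _ ct) _ bs).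
Qed.

Lemma model_spread_orbit : {in nonsingular, forall c, model_spread c \in orb A0}.
Proof.
move=> c /mem_lookup; rewrite /model_spread /spread_sets /spread_code.
pose P (e : entry) := e \in table -> dsets dec9 (map span1 e.2.2) \in orb A0.
move=> ct; suff : P (c, lookup c) by apply.
(* The induction also carries that the bases consist of codes, without which a generator could not
   be applied to the spread. *)
pose Q (e : entry) := {in e.2.2, forall b, {subset b <= codes}} /\
  dsets dec9 (map span1 e.2.2) \in orb A0.
suff : Q (c, lookup c) by case=> _ h _.
apply: (@table_ind Q) ct => [|[g h] gh e [ec eO]]; split.
- have /allP h : all (fun b => subN b codes) spread_bases by vm_compute.
  by move=> b /h/subNP.
- rewrite spread_bases_sets; apply/imsetP; exists 1%g; first exact: H9_1.
  by rewrite coord_act1.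
- move=> _ /mapP[b be ->] _ /mapP[k kb ->] /=.
  have /allP hok : all (fun gh => lin_ok gh.2) gen_pairs by vm_compute.
  by apply: (lin_ok_codes (hok _ gh)); apply: ec kb.
have [s sH sE] := gen_perm gh.
rewrite /= -map_comp (eq_map (g := map (lin h) \o span1)); last by move=> b /=; apply: span1_map.
rewrite map_comp -(coord_act_dsets _ sE) ?orbit_actH //.
move=> _ /mapP[b be ->] k /mem_behead.
by apply: (@spanlP (fun k => k \in codes)) => //; [exact: xor_codes | exact: ec].
Qed.

Lemma model_spread_act gh (s : 'S_9) : gh \in gen_pairs ->
  {in codes, forall k, col_perm s (dec9 k) = dec9 (lin gh.2 k)} ->
  {in nonsingular, forall c, model_spread (lin gh.1 c) = coord_act s (model_spread c)}.
Proof.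
move=> ghG sE c cn; rewrite /model_spread (coord_act_dsets (spread_sets_codes cn) sE).
by symmetry; apply: eq_dsets; exact: (allP (allP spread_table _ ghG) _ cn).
Qed.

Lemma gens_pairs g : g \in gens -> exists h, (g, h) \in gen_pairs.
Proof.
have E : gens = map fst gen_pairs by [].
by rewrite E => /mapP[[g' h] gh ->]; exists h.
Qed.

Lemma model_spread_good c : c \in nonsingular -> good_spread (model_spread c).
Proof. by move=> cn; apply: orbit_good good_std _; apply: model_spread_orbit. Qed.

Lemma pblock_model c (i : 'I_9) : c \in reps ->
  pblock (model_spread c) (Qpoint i) = dset dec9 (block c i).
Proof.
move=> cr; have [tT _ _] := model_spread_good (reps_nonsingular cr).
have /andP[ib /allP/(_ _ (mem_iota9 i))] := allP (allP block_root _ cr) _ (mem_iota9 i).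
rewrite eqxx memNE => /eqP ii; apply: def_pblock => //; first exact: mem_dsets.
by rewrite -dec9_root mem_dset_map.
Qed.

Lemma block_codes c (i : 'I_9) : c \in reps -> {subset block c i <= codes}.
Proof.
move=> cr; have /andP[ib _] := allP (allP block_root _ cr) _ (mem_iota9 i).
exact: spread_sets_codes (reps_nonsingular cr) _ ib.
Qed.

Lemma couple_model_inj : {in nonsingular &, forall a b, a != b ->
  couple (model_spread a) != couple (model_spread b)}.
Proof.
pose P a b := [/\ a \in nonsingular, b \in nonsingular & a != b ->
  couple (model_spread a) != couple (model_spread b)].
suff h : {in nonsingular &, forall a b, P a b} by move=> a b an bn; have [] := h a b an bn.
apply: nonsingular_ind2 => [c cr|g gG a b [an bn ab]].
  split=> [||c17]; [exact: nonsingular17 | exact: reps_nonsingular |].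
  have c17' : c \in behead reps.
    have E : reps = 17%num :: behead reps by [].
    by move: cr; rewrite {1}E inE eq_sym (negPf c17).
  have r17 : 17%num \in reps by rewrite -memNE; vm_compute.
  have blk (i j : 'I_9) : ~~ eqsetN (block 17 i) (block c j) ->
      pblock (model_spread 17) (Qpoint i) != pblock (model_spread c) (Qpoint j).
    rewrite !pblock_model //; apply: contra => /eqP.
    move/(dset_inj dec9P (block_codes r17) (block_codes cr)) => E.
    by apply/andP; split; apply/allP => k; rewrite memNE E.
  apply/eqP => E; case/orP: (allP block_reps _ c17') => /andP[n1 n2].
    have : pblock (model_spread 17) (Qpoint coord1) \in couple (model_spread c) by rewrite -E set21.
    by rewrite !inE (negPf (blk coord1 coord1 n1)) (negPf (blk coord1 coord2 n2)).
  have : pblock (model_spread 17) (Qpoint coord2) \in couple (model_spread c) by rewrite -E set22.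
  by rewrite !inE (negPf (blk coord2 coord1 n1)) (negPf (blk coord2 coord2 n2)).
have [h gh] := gens_pairs gG; have [s sH sE] := gen_perm gh; have /H9P[_ s12] := sH.
have gn c : c \in nonsingular -> lin g c \in nonsingular.
  have /andP[/subNP gs _] := allP gens_nonsingular _ gG.
  by move=> cn; apply: gs; apply: map_f.
split; [exact: gn | exact: gn |] => gab.
rewrite (model_spread_act gh sE an) (model_spread_act gh sE bn).
rewrite (couple_act s12 (model_spread_good an)) (couple_act s12 (model_spread_good bn)).
have nab : a != b by apply: contra gab => /eqP ->.
by apply: contra (ab nab) => /eqP /(imset_inj (@act_inj s)) ->.
Qed.

(** The spread [families m] and [std_spread] share both blocks, so their translates have equal
    couples, and these take 120 values. An orbit of only 120 spreads is thus separated by [couple].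
    As [rot7] fixes both blocks it fixes the spread, and among the eight candidates this holds for
    [std_spread] only. *)
Lemma families_standard m : m \in ovoid_maps -> good_spread (dsets dec9 (families m)) ->
  #|orb (dsets dec9 (families m))| = 120%N -> dsets dec9 (families m) = A0.
Proof.
set A := dsets dec9 (families m) => mm gA cA.
have [lA hA] : dset dec9 low_block \in A /\ dset dec9 high_block \in A.
  have /andP[/hasP[u uf /eqsetNP ul] /hasP[v vf /eqsetNP vh]] := allP families_blocks _ mm.
  by rewrite (eq_dset _ ul) (eq_dset _ vh) /A !mem_dsets.
have coupleA := couple_blocks gA lA hA.
have couple0 := couple_blocks good_std (mem_dsets _ std_spread_low) (mem_dsets _ std_spread_high).
have couple_t (t : 'S_9) : t \in H9 -> couple (coord_act t A) = couple (coord_act t A0).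
  by move=> /H9P[_ t12]; rewrite !couple_act ?coupleA ?couple0 //; apply: good_std.
have c_inj : {in orb A &, injective couple}.
  apply/imset_injP; rewrite eqn_leq leq_imset_card cA /=.
  rewrite cardE -[120%N]/(size nonsingular) -(size_map (fun c => couple (model_spread c))).
  apply: uniq_leq_size => [|_ /mapP[c cn ->]].
    rewrite map_inj_in_uniq ?nonsingular_uniq // => a b an bn ab; apply/eqP/negPn/negP => nab.
    by have := couple_model_inj an bn nab; rewrite ab eqxx.
  have /imsetP[t tH ->] := model_spread_orbit cn.
  rewrite mem_enum -couple_t //; apply: imset_f; apply/imsetP.
  by exists t.
have rr : (rot7, rot7) \in gen_pairs by rewrite mem_head.
have [s sH sE] := gen_perm rr; have /H9P[_ s12] := sH.
have AO : A \in orb A by apply/imsetP; exists 1%g; [exact: H9_1 | rewrite coord_act1].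
have sA : coord_act s A = A.
  apply: c_inj => //; first exact: orbit_actH.
  rewrite couple_act // coupleA imsetU1 imset_set1.
  have /andP[rl rh] := rot7_blocks.
  rewrite (act_dset low_codes sE) (act_dset high_codes sE).
  by rewrite (eq_dset _ (eqsetNP rl)) (eq_dset _ (eqsetNP rh)).
apply: eq_dsets; apply: (implyP (allP rot7_families _ mm)); apply: dsets_eqfamN.
- move=> _ /mapP[u uf ->] _ /mapP[k ku ->].
  have rok : lin_ok rot7 by vm_compute.
  exact: lin_ok_codes rok (families_codes uf ku).
- exact: families_codes.
by rewrite -(coord_act_dsets (@families_codes m) sE).
Qed.

Lemma meet_dset u v : {subset u <= codes} -> {subset v <= codes} -> uniq u ->
  #|dset dec9 u :&: dset dec9 v| = meet_size u v.
Proof.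
move=> uc vc uu; rewrite /meet_size -size_filter -(card_dset dec9P) ?filter_uniq //; last first.
  by move=> k; rewrite mem_filter => /andP[_ /uc].
congr #|pred_of_set _|; apply/setP => x; rewrite inE; apply/andP/dsetP => [[/dsetP[k ku ->]]|[k]].
  by rewrite (mem_dset dec9P vc (uc _ ku)) => kv; exists k; rewrite // mem_filter memNE kv.
by rewrite mem_filter memNE => /andP[kv ku] ->; rewrite !mem_dset_map.
Qed.

Lemma block_uniq : all (fun c => all (fun u => uniq u) (spread_sets c)) reps.
Proof. by vm_compute. Qed.

Section Invariants.
Variables (c : N).
Hypothesis cr : c \in reps.

Let r17 : 17%num \in reps. Proof. by rewrite -memNE; vm_compute. Qed.

Let block_ok a (i : 'I_9) : a \in reps -> uniq (block a i) /\ psubspace (dset dec9 (block a i)).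
Proof.
move=> ar; have /andP[ib _] := allP (allP block_root _ ar) _ (mem_iota9 i).
split; first exact: (allP (allP block_uniq _ ar) _ ib).
have [_ _] := model_spread_good (reps_nonsingular ar); apply.
exact: mem_dsets.
Qed.

Let pdim_blocks a b (i j : 'I_9) m : a \in reps -> b \in reps ->
  ((meet_size (block a i) (block b j)).+1 = 2 ^ m)%N ->
  pdim (pblock (model_spread a) (Qpoint i) :&: pblock (model_spread b) (Qpoint j)) = m%:Z - 1.
Proof.
move=> ar br abm; rewrite !pblock_model //.
have [au ap] := block_ok i ar; have [bu bp] := block_ok j br.
apply: pdim_psubspace; first exact: psubspaceI.
by rewrite (meet_dset (block_codes ar) (block_codes br)).
Qed.

Lemma Inv1_model : Inv1 (model_spread 17) (model_spread c)
  = ((inv1_code 17 c).1 + (inv1_code 17 c).2)%:Z - 2.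
Proof.
have /andP[/eqP d1 /eqP d2] := allP meet_dim_reps _ cr.
rewrite /Inv1 (pdim_blocks (i := coord1) (j := coord2) r17 cr d1).
rewrite (pdim_blocks (i := coord2) (j := coord1) r17 cr d2).
by rewrite PoszD addrACA -opprD.
Qed.

Lemma Inv2_model : Inv2 (model_spread 17) (model_spread c) = inv2_code 17 c.
Proof.
have plineM (i j : 'I_9) : pline (pblock (model_spread c) (Qpoint i) :&: pblock (model_spread 17) (Qpoint j))
    = (meet_size (block c i) (block 17 j) == 3)%N.
  rewrite !pblock_model // plineE; have [iu ip] := block_ok i cr; have [ju jp] := block_ok j r17.
  by rewrite psubspaceI // (meet_dset (block_codes cr) (block_codes r17)).
pose D : {set 'I_9} := [set i : 'I_9 | [&& (1 < i)%N, meet_size (block c i) (block 17 0) == 3%N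
    & meet_size (block c i) (block 17 1) == 3%N]].
have -> : Inv2 (model_spread 17) (model_spread c)
    = #|[set pblock (model_spread c) (Qpoint i) | i in D]|.
  congr #|pred_of_set _|; apply/setP => U; rewrite inE; apply/andP/imsetP => [[/imsetP[i i1 ->]]|].
    by rewrite !plineM => h; exists i; rewrite // inE; move: i1; rewrite inE => ->.
  case=> i; rewrite inE => /andP[i1 h] ->; rewrite !plineM; split; last exact: h.
  by apply/imsetP; exists i; rewrite // inE.
(* A member contains only one of the points Q_i, so indices may be counted in place of
   generators. *)
rewrite card_in_imset => [|i j _ _].
  rewrite -sum1_card big_mkcond /= /inv2_code -sum_ord9; apply: eq_bigr => i _.
  by rewrite inE; case: ifP.
rewrite !pblock_model // => /(dset_inj dec9P (block_codes cr) (block_codes cr)) E.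
have /andP[_ /allP h] := allP (allP block_root _ cr) _ (mem_iota9 i).
apply/val_inj/eqP; have /eqP <- := h _ (mem_iota9 j); rewrite memNE -E -memNE.
by have /eqP -> := h _ (mem_iota9 i); rewrite eqxx.
Qed.

End Invariants.

(** * The isomorphism of the two schemes *)

Section SpreadIsomorphism.

Lemma model_spread_inj : {in nonsingular &, injective model_spread}.
Proof.
move=> a b an bn ab; apply/eqP/negPn/negP => nab.
by have := couple_model_inj an bn nab; rewrite ab eqxx.
Qed.

Lemma spread_rel_reps j : (j < 7)%N -> forall i, (i < 7)%N ->
  ((model_spread 17, model_spread (nth 0%num reps j)) \in spread_rel (orb A0) i) = (j == i).
Proof.
move=> j7 i i7; have cr : nth 0%num reps j \in reps by rewrite mem_nth.
have cn := reps_nonsingular cr; have n17 := nonsingular17.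
rewrite inE in_setX /= !model_spread_orbit //= (inj_in_eq model_spread_inj n17 cn).
have -> : (17%num == nth 0%num reps j) = (j == 0%N).
  have reps_uniq : uniq reps by vm_compute.
  by rewrite -[17%num]/(nth 0%num reps 0) nth_uniq // eq_sym.
rewrite (Inv1_model cr) (Inv2_model cr).
case: (posnP j) => [->|j0]; first by case: i i7 => [|[|[|[|[|[|[|i]]]]]]].
have e : (((inv1_code 17 (nth 0%num reps j)).1 + (inv1_code 17 (nth 0%num reps j)).2,
    inv2_code 17 (nth 0%num reps j))
    = nth (0, 0) [:: (4, 0); (0, 0); (0, 2); (4, 2); (2, 1); (2, 3)] j.-1)%N.
  have j5 : (j.-1 < size (behead reps))%N by rewrite size_behead -[size reps]/7%N /=; lia.
  by rewrite -inv_reps (nth_map 0%num _ _ j5) nth_behead prednK.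
move: (congr1 fst e) (congr1 snd e) => /= -> ->; case: j j7 j0 {cr cn e} => [|[|[|[|[|[|[|j]]]]]]] // _ _;
  by case: i i7 => [|[|[|[|[|[|[|i]]]]]]].
Qed.

Variable f : 'rV['F_2]_8 -> 'F_2.
Local Notation V := 'rV['F_2]_8.
Hypotheses (hf : quadratic_form f) (hnd : nondegenerate_form f) (hhyp : hyperbolic_form f).
Variables (S : {set {set V}}) (Sg1 Sg2 : {set V}).
Hypotheses (hS : spread (quadric f) S).
Hypotheses (hSg1 : Sg1 \in S) (hSg2 : Sg2 \in S) (hSg : Sg1 != Sg2).
Variable Y : {set {set V}}.
Hypotheses (hY : Y \in ovoid_orbits f S Sg1 Sg2) (hY120 : #|Y| = 120%N).
Local Notation R := (point_rel f Sg1 Sg2 Y).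
Local Notation Z := (anisotropic f).
Let relE := point_rel_frame hf hnd hhyp hS hSg1 hSg2 hSg hY hY120.

Lemma orbit_act_eq (s : 'S_9) A : s \in H9 -> [set coord_act s B | B in orb A] = orb A.
Proof.
move=> sH; apply: eqEcard_T; last by rewrite card_imset //; apply: coord_act_inj.
by apply/subsetP => _ /imsetP[B BO ->]; apply: orbit_actH.
Qed.

Lemma spread_rel_code : {in nonsingular &, forall a b, forall i, (i < 7)%N ->
  ((model_spread a, model_spread b) \in spread_rel (orb A0) i) = (rel_code a b == i)}.
Proof.
have [d dF] := frame_exists hf hnd hSg1 hSg2 hhyp hS hSg.
pose P a b := [/\ a \in nonsingular, b \in nonsingular & forall i, (i < 7)%N ->
  ((model_spread a, model_spread b) \in spread_rel (orb A0) i) = (rel_code a b == i)].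
suff h : {in nonsingular &, forall a b, P a b} by move=> a b an bn; have [] := h a b an bn.
apply: nonsingular_ind2 => [c cr|g gG a b [an bn ab]].
  split=> [||i i7]; [exact: nonsingular17 | exact: reps_nonsingular |].
  have jr : (index c reps < 7)%N by rewrite -[7%N]/(size reps) index_mem.
  have cE : nth 0%num reps (index c reps) = c by rewrite nth_index.
  rewrite -{1}cE (spread_rel_reps jr i7).
  have /andP[/eqP + _] := allP rel_code_reps _ (mem_iota7 jr).
  by rewrite cE => ->.
have [h gh] := gens_pairs gG; have [s sH sE] := gen_perm gh; have /H9P[_ s12] := sH.
have gn c : c \in nonsingular -> lin g c \in nonsingular.
  have /andP[/subNP gs _] := allP gens_nonsingular _ gG.
  by move=> cn; apply: gs; apply: map_f.
split=> [||i i7]; [exact: gn | exact: gn |].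
rewrite (model_spread_act gh sE an) (model_spread_act gh sE bn) -{1}(orbit_act_eq A0 sH).
rewrite (spread_rel_act _ s12 (model_spread_good an) (model_spread_good bn)
  (model_spread_orbit an) (model_spread_orbit bn)) ab //.
(* That g preserves [rel_code] comes from the points: one pair of points is described by codes in
   the frames [d] and [d \o lin g]. *)
rewrite -(relE dF (gn _ an) (gn _ bn) i7).
by rewrite -(relE (frame_lin (allP gens_frame _ gG) dF) an bn i7).
Qed.

(** Codes index both sides, the points through a frame and the spreads through the table; the
    coordinate permutation s carries the standard orbit to X. *)
Lemma spread_isomorphism (rho : {set W}) (X : {set {set {set W}}}) :
  X \in spread_orbits rho -> #|X| = 120%N ->
  isomorphic Z (fun i : 'I_7 => R i) X (fun i : 'I_7 => spread_rel X i).
Proof.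
move=> hX hX120; have [s s12 [m mm [gA XE]]] := orbit_standard hX.
have [d dF] := frame_exists hf hnd hSg1 hSg2 hhyp hS hSg.
have dP := frame_decoder dF; have ZE := frame_anisotropic hf dF.
have cX : #|orb (dsets dec9 (families m))| = 120%N.
  by rewrite -hX120 XE [RHS](card_imset _ (@coord_act_inj s)).
rewrite (families_standard mm gA cX) in XE.
pose phi x := coord_act s (model_spread (code_of d x)).
have phiE c : c \in nonsingular -> phi (d c) = coord_act s (model_spread c).
  by move=> cn; rewrite /phi code_ofK // nonsingular_codes.
have phi_inj : {in Z &, injective phi}.
  rewrite ZE => _ _ /dsetP[a an ->] /dsetP[b bn ->].
  by rewrite !phiE // => /coord_act_inj /model_spread_inj ->.
exists phi; split=> //.
  apply: eqEcard_T; last by rewrite card_in_imset // hX120 (card_anisotropic hf hnd hhyp hS hSg1 hSg2 hSg).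
  apply/subsetP => _ /imsetP[x + ->]; rewrite ZE => /dsetP[a an ->].
  by rewrite phiE // XE imset_f // model_spread_orbit.
move=> i x y; rewrite ZE => /dsetP[a an ->] /dsetP[b bn ->].
rewrite !phiE // XE (spread_rel_act _ s12 (model_spread_good an) (model_spread_good bn)
  (model_spread_orbit an) (model_spread_orbit bn)).
by rewrite (spread_rel_code an bn (ltn_ord i)) (relE dF an bn (ltn_ord i)).
Qed.

End SpreadIsomorphism.

Theorem theorem4p3
  (f : 'rV['F_2]_8 -> 'F_2)
  (hf : quadratic_form f) (hnd : nondegenerate_form f) (hhyp : hyperbolic_form f)
  (S : {set {set 'rV['F_2]_8}}) (hS : spread (quadric f) S)
  (Sg1 Sg2 : {set 'rV['F_2]_8})
  (hSg1 : Sg1 \in S) (hSg2 : Sg2 \in S) (hSg : Sg1 != Sg2)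
  (Y : {set {set 'rV['F_2]_8}})
  (hY : Y \in ovoid_orbits f S Sg1 Sg2) (hY120 : #|Y| = 120%N) :
  let G := Gstar f S Sg1 Sg2 in
  let Z := anisotropic f in
  let O := ovoid_of Sg1 Sg2 Y in
  let R := point_rel f Sg1 Sg2 Y in
  let Rfam := fun i : 'I_7 => R i in
  let GammaStar := R 3%N :|: R 4%N :|: R 6%N in
  [/\ [/\ symmetric_scheme Z Rfam,
          [set Rfam i | i : 'I_7] = orbitals 'P%act G Z,
          {in Z &, injective O} /\ O @: Z = Y
        & [set [set (O p.1, O p.2) | p in Rfam i] | i : 'I_7]
          = orbitals 'P^*%act G Y],
      forall (rho : {set 'rV['F_2]_9}) (X : {set {set {set 'rV['F_2]_9}}}),
        quadric_generator quadric9 rho -> X \in spread_orbits rho -> #|X| = 120%N ->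
        isomorphic Z Rfam X (fun i : 'I_7 => spread_rel X i),
      R 5%N :|: R 6%N = NObar f,
      [/\ strongly_regular 120 56 28 24 Z (NObar f),
          strongly_regular 120 56 28 24 Z GammaStar
        & ~ graph_isomorphic Z GammaStar Z (NObar f)]
    & graph_aut Z GammaStar = [set restr_perm Z s | s in G]
      /\ [faithful G, on Z | 'P]].
Proof.
move=> G Z O R Rfam GammaStar; split.
- split.
  + exact: (point_scheme hf hnd hhyp hS hSg1 hSg2 hSg hY hY120).
  + exact: (point_orbitals hf hnd hhyp hS hSg1 hSg2 hSg hY hY120).
  + split; first exact: (ovoid_of_inj hf hnd hhyp hS hSg1 hSg2 hSg hY hY120).
    exact: (ovoid_of_image hf hnd hhyp hS hSg1 hSg2 hSg hY hY120).
  exact: (ovoid_orbitals hf hnd hhyp hS hSg1 hSg2 hSg hY hY120).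
- move=> rho X _; exact: (spread_isomorphism hf hnd hhyp hS hSg1 hSg2 hSg hY hY120).
- exact: (rel_NObar hf hnd hhyp hS hSg1 hSg2 hSg hY hY120).
- split; first exact: (bar_srg hf hnd hhyp hS hSg1 hSg2 hSg).
    exact: (star_srg hf hnd hhyp hS hSg1 hSg2 hSg hY hY120).
  exact: (star_not_bar hf hnd hhyp hS hSg1 hSg2 hSg hY hY120).
split; first exact: (star_aut hf hnd hhyp hS hSg1 hSg2 hSg hY hY120).
exact: (Gstar_faithful hf hnd hhyp hS hSg1 hSg2 hSg).
Qed.
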